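(* Along a ray of quartic differentials on a fixed Riemann surface, the volume entropy of the induced metrics decreases monotonically to $0$. That is, let $(\sigma,q)\in\mathcal{Q}^4(S)$ with $q\neq0$, and for $t\ge 0$ let $g_t=4e^{\psi_1^t-\psi_2^t}\sigma$ be the induced metric associated with $(\sigma,tq)$. Then the function $t\mapsto\mathrm{Ent}(g_t)$ is monotonically decreasing and $\lim_{t\to+\infty}\mathrm{Ent}(g_t)=0$.
   Context: $S$ is a closed, connected, oriented smooth surface of genus at least $2$, and $\mathcal{Q}^4(S)\to\mathcal{T}(S)$ is the bundle of holomorphic quartic differentials over Teichmüller space. A point of $\mathcal{Q}^4(S)$ is written $(\sigma,q)$, where the Riemann surface is represented by the conformal metric $\sigma=\sigma(z)|dz|^2$ normalized so that $2\sigma=2\sigma(z)(dx^2+dy^2)$ is the hyperbolic metric of curvature $-1$; $\kappa(\sigma)$ is the (constant) Gaussian curvature of $\sigma(z)(dx^2+dy^2)$ (so $\kappa(\sigma)=-2$), $\Delta_\sigma=\frac{1}{\sigma(z)}\bar\partial\partial$ (one quarter of the usual Laplacian), and $\|q\|_\sigma^2=|q(z)|^2/\sigma(z)^4$. For each $t$, $(\psi_1^t,\psi_2^t)$ is the unique pair of smooth functions on $S$ solving $$\Delta_\sigma\psi_1^t=e^{\psi_1^t-\psi_2^t}-e^{-2\psi_1^t}\|tq\|_\sigma^2+\tfrac34\kappa(\sigma),\qquad \Delta_\sigma\psi_2^t=e^{2\psi_2^t}-e^{\psi_1^t-\psi_2^t}+\tfrac14\kappa(\sigma).$$ (The metric $g_t=4e^{\psi_1^t-\psi_2^t}\sigma$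 is the metric induced on the maximal surface in $\mathbb{H}^{2,2}$ equivariant under the $\mathrm{SO}_0(2,3)$-Hitchin representation parametrized by $(\sigma,tq)$.) For a Riemannian metric $g$ on $S$ with lift $\tilde g$ to the universal cover $\widetilde S$ and a base point $p_0\in\widetilde S$, the volume entropy is $$\mathrm{Ent}(g)=\limsup_{r\to+\infty}\frac{\log\#\{p\in\widetilde S: p\in(\pi_1(S)\cdot p_0)\cap B_{\tilde g}(p_0,r)\}}{r}.$$ *)

(* Defs.v *)
From HB Require Import structures.
From mathcomp Require Import all_boot all_order all_algebra.
From mathcomp Require Import all_classical all_reals all_analysis.
From mathcomp Require Import complex.

Set Implicit Arguments.
Unset Strict Implicit.
Unset Printing Implicit Defensive.

Import Order.TTheory GRing.Theory Num.Theory numFieldNormedType.Exports.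

Local Open Scope classical_set_scope.
Local Open Scope ring_scope.
Local Open Scope complex_scope.

(* R[i] seen as a numFieldType: this gives it its norm topology, and makes
   [derivable f z 1] and [derive1 f z] complex differentiability and the complex
   derivative for [f : cplx R -> cplx R]. *)
Definition cplx (R : realType) : numFieldType := R[i].

Definition cmod (R : realType) (z : cplx R) : R := ComplexField.Normc.normc z.

Section PlaneCalculus.
Variable R : realType.
Implicit Types (f rho : cplx R -> R) (U : set (cplx R)) (z : cplx R).

Definition dx f z : R := derive1 (fun s : R => f (z + (s +i* 0))) 0.
Definition dy f z : R := derive1 (fun s : R => f (z + (0 +i* s))) 0.

Fixpoint Ck (k : nat) U f : Prop :=
  (forall z, U z -> {for z, continuous f}) /\
  if k is k'.+1 then
    [/\ forall z, U z -> derivable (fun s : R => f (z + (s +i* 0))) 0 1,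
        forall z, U z -> derivable (fun s : R => f (z + (0 +i* s))) 0 1,
        Ck k' U (dx f) & Ck k' U (dy f)]
  else True.

Definition smooth U f : Prop := forall k, Ck k U f.

Definition eucl_laplacian f z : R := dx (dx f) z + dy (dy f) z.

(* The operator (1 / rho) d/dzbar d/dz, i.e. one quarter of the
   Laplace-Beltrami operator of rho (dx^2 + dy^2). *)
Definition laplacian rho f z : R := (eucl_laplacian f z / 4) / rho z.

(* Gaussian curvature of rho (dx^2 + dy^2). *)
Definition gauss_curvature rho z : R :=
  - (eucl_laplacian (fun w => ln (rho w)) z / (2 * rho z)).

End PlaneCalculus.

(* A complex atlas on S.  The maps [chart i] and [param i] are total functions;
   only their restrictions to [dom i] and to its image are meaningful.
   [chart_at x] selects a chart around x. *)
Record riemannSurface (R : realType) (S : topologicalType) := RiemannSurface {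
  chart_index : Type;
  dom : chart_index -> set S;
  chart : chart_index -> S -> cplx R;
  param : chart_index -> cplx R -> S;
  chart_at : S -> chart_index;
  dom_open : forall i, open (dom i);
  dom_chart_at : forall x, dom (chart_at x) x;
  cod_open : forall i, open (chart i @` dom i);
  chartK : forall i x, dom i x -> param i (chart i x) = x;
  chart_continuous : forall i x, dom i x -> {for x, continuous (chart i)};
  param_continuous :
    forall i z, (chart i @` dom i) z -> {for z, continuous (param i)};
  transition_holomorphic :
    forall i j z, (chart i @` (dom i `&` dom j)) z ->
      derivable (fun w => chart j (param i w)) z 1
}.

Section Tensors.
Variables (R : realType) (S : topologicalType) (M : riemannSurface R S).

Definition cod (i : chart_index M) : set (cplx R) := chart i @` dom i.
Definition overlap (i j : chart_index M) : set (cplx R) :=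
  chart i @` (dom i `&` dom j).
Definition transition (i j : chart_index M) : cplx R -> cplx R :=
  fun z => chart j (param i z).

(* The metric rho_i(z) |dz|^2 in the chart i. *)
Record conformalMetric := ConformalMetric {
  density :> chart_index M -> cplx R -> R;
  density_gt0 : forall i z, cod i z -> 0 < density i z;
  density_smooth : forall i, smooth (cod i) (density i);
  density_transition : forall i j z, overlap i j z ->
    density i z =
      density j (transition i j z) * cmod (derive1 (transition i j) z) ^+ 2
}.

(* The section q_i(z) dz^4 of the fourth power of the canonical bundle. *)
Record quarticDifferential := QuarticDifferential {
  qcoef :> chart_index M -> cplx R -> cplx R;
  qcoef_holomorphic : forall i z, cod i z -> derivable (qcoef i) z 1;
  qcoef_transition : forall i j z, overlap i j z ->
    qcoef i z = qcoef j (transition i j z) * derive1 (transition i j) z ^+ 4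
}.

Definition qd_nonzero (q : quarticDifferential) : Prop :=
  exists i z, cod i z /\ q i z != 0.

Section Scale.
Variables (t : R) (q : quarticDifferential).

Let tq (i : chart_index M) (z : cplx R) : cplx R := (t +i* 0) * q i z.

Let tq_holomorphic i z : cod i z -> derivable (tq i) z 1.
Proof. by move=> Uz; apply: derivableM; [|exact: qcoef_holomorphic]. Qed.

Let tq_transition i j z : overlap i j z ->
  tq i z = tq j (transition i j z) * derive1 (transition i j) z ^+ 4.
Proof. by move=> Uz; rewrite /tq (qcoef_transition _ Uz) mulrA. Qed.

Definition qd_scale : quarticDifferential :=
  QuarticDifferential tq_holomorphic tq_transition.

End Scale.

Definition hyperbolic_normalized (sigma : conformalMetric) : Prop :=
  forall i z, cod i z -> gauss_curvature (fun w => 2 * sigma i w) z = -1.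

Definition qd_norm2 (sigma : conformalMetric) (q : quarticDifferential) i z : R :=
  cmod (q i z) ^+ 2 / sigma i z ^+ 4.

Definition smooth_function (psi : S -> R) : Prop :=
  forall i : chart_index M, smooth (cod i) (fun z => psi (param i z)).

Definition maximal_surface_system (sigma : conformalMetric)
    (q : quarticDifferential) (psi1 psi2 : S -> R) : Prop :=
  [/\ smooth_function psi1, smooth_function psi2 &
    forall i z, cod i z ->
      let u1 := fun w => psi1 (param i w) in
      let u2 := fun w => psi2 (param i w) in
      let kappa := gauss_curvature (sigma i) z in
      laplacian (sigma i) u1 z =
        expR (u1 z - u2 z) - expR (- (2 * u1 z)) * qd_norm2 sigma q i z
        + 3 / 4 * kappa /\
      laplacian (sigma i) u2 z =
        expR (2 * u2 z) - expR (u1 z - u2 z) + 1 / 4 * kappa].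

Definition induced_metric (sigma : conformalMetric) (psi1 psi2 : S -> R)
    (i : chart_index M) (z : cplx R) : R :=
  4 * expR (psi1 (param i z) - psi2 (param i z)) * sigma i z.

End Tensors.

(* There are k pairwise disjoint simple closed curves in S whose union does not
   disconnect S.  The largest such k is the genus of a closed connected oriented
   surface. *)
Definition genus_ge (R : realType) (k : nat) (S : topologicalType) : Prop :=
  exists c : 'I_k -> R -> S,
    [/\ forall l, {within `[0, 1], continuous (c l)} /\ c l 0 = c l 1,
        forall l, set_inj `[0, 1[ (c l),
        forall l m, l != m -> (c l @` `[0, 1]) `&` (c m @` `[0, 1]) = set0 &
        connected (~` \bigcup_l (c l @` `[0, 1]))].

Section Covering.
Variables (R : realType) (S X : topologicalType).

Definition path_connected : Prop :=
  forall x y : X, exists c : R -> X,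
    [/\ {within `[0, 1], continuous c}, c 0 = x & c 1 = y].

Definition null_homotopic (c : R -> X) : Prop :=
  exists H : R * R -> X,
    [/\ {within `[0, 1] `*` `[0, 1], continuous H},
        forall s, s \in `[0, 1] -> H (s, 0) = c s /\ H (s, 1) = c 0 &
        forall u, u \in `[0, 1] -> H (0, u) = c 0 /\ H (1, u) = c 0].

Definition simply_connected : Prop :=
  path_connected /\
  forall c : R -> X, {within `[0, 1], continuous c} -> c 0 = c 1 ->
    null_homotopic c.

Definition evenly_covered (p : X -> S) (V : set S) : Prop :=
  exists (I : Type) (sheet : I -> set X),
    [/\ p @^-1` V = \bigcup_k sheet k,
        forall k l, sheet k `&` sheet l !=set0 -> k = l &
        forall k, [/\ open (sheet k), set_bij (sheet k) V p &
          forall W, open W -> W `<=` sheet k -> open (p @` W)]].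

Definition covering_map (p : X -> S) : Prop :=
  continuous p /\
  forall x, exists V : set S, [/\ open V, V x & evenly_covered p V].

Definition universal_cover (p : X -> S) : Prop :=
  [/\ covering_map p, set_surj setT setT p & simply_connected].

(* The orbit under pi_1(S), acting on the universal cover X as the group of deck
   transformations. *)
Definition deck_orbit (p : X -> S) (x0 : X) : set X :=
  [set x | exists f g : X -> X,
    [/\ continuous f /\ continuous g, cancel f g /\ cancel g f,
        forall y, p (f y) = p y & f x0 = x]].

End Covering.

Section Entropy.
Variables (R : realType) (S : topologicalType) (M : riemannSurface R S).
Variables (X : topologicalType) (p : X -> S).
Implicit Types (g : chart_index M -> cplx R -> R) (c : R -> X).

Definition coord_re (i : chart_index M) c (s : R) : R :=
  complex.Re (chart i (p (c s))).
Definition coord_im (i : chart_index M) c (s : R) : R :=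
  complex.Im (chart i (p (c s))).

Definition C1_curve c : Prop :=
  forall s : R, s \in `[0, 1] ->
    {for s, continuous c} /\
    forall i : chart_index M, dom i (p (c s)) ->
      [/\ \forall r \near s, derivable (coord_re i c) r 1,
          \forall r \near s, derivable (coord_im i c) r 1,
          {for s, continuous (derive1 (coord_re i c))} &
          {for s, continuous (derive1 (coord_im i c))}].

(* Norm of the velocity for the pull-back by p of g = g_i(z) |dz|^2. *)
Definition speed g c (s : R) : R :=
  let i := chart_at M (p (c s)) in
  Num.sqrt (g i (chart i (p (c s))) *
    (derive1 (coord_re i c) s ^+ 2 + derive1 (coord_im i c) s ^+ 2)).

Definition curve_length g c : \bar R :=
  (\int[lebesgue_measure]_(s in `[0%R, 1%R]) (speed g c s)%:E)%E.

(* Infimum of the lengths of piecewise C^1 paths, given by their n + 1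
   successive C^1 pieces. *)
Definition riem_dist g (x y : X) : \bar R :=
  ereal_inf [set L | exists (n : nat) (c : nat -> R -> X),
    [/\ forall k, (k <= n)%N -> C1_curve (c k),
        c 0%N 0 = x /\ c n 1 = y,
        forall k, (k < n)%N -> c k 1 = c k.+1 0 &
        L = (\sum_(0 <= k < n.+1) curve_length g (c k))%E]].

Definition orbit_count g (x0 : X) (r : R) : \bar R :=
  counting (deck_orbit p x0 `&` [set x | (riem_dist g x0 x < r%:E)%E]).

Definition volume_entropy g (x0 : X) : \bar R :=
  limf_esup (fun r : R => lne (orbit_count g x0 r) * (r^-1)%:E)%E
    (pinfty_nbhs R).

End Entropy.

(* Main.v *)
(* Write u_t = (psi1 - psi2)(t) - (psi1 - psi2)(0), so that g_t = e^(u_t) g_0.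
   The system is cooperative, and the maximum principle, applied successively to
   psi1(t) - psi1(s) and psi2(t) - psi2(s), to their difference with ln (t / s), and to
   u_t - u_s, shows that u_t is nondecreasing in t; hence the entropy is nonincreasing.
   Near a point where q <> 0, u_t tends to infinity, since its Laplacian is at most
   C - c t as long as u_t stays bounded.  The zeros of q are nowhere dense (three circles
   theorem for ln |q|, whose smoothness comes from the equations), and near a zero the
   barrier - ln r + C + r, r the distance to a nearby nonzero of q, forces u_t to be
   large as well.  By Dini's argument u_t tends to infinity uniformly on S.
   For g_0, cover S by finitely many evenly covered coordinate boxes: a path of length L
   meets at most about L / d of them, and the sequence of boxes determines its end point
   in a given fibre of the covering.  Thus g_0 has finite entropy E, and if
   u_t >= 2 ln l then the entropy of g_t is at most E / l. *)
From HB Require Import structures.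
Require Import Defs.
From mathcomp Require Import all_boot all_order all_algebra.
From mathcomp Require Import all_classical all_reals all_analysis.
From mathcomp Require Import complex ring lra.

Set Implicit Arguments.
Unset Strict Implicit.
Unset Printing Implicit Defensive.

Import Order.TTheory GRing.Theory Num.Theory numFieldNormedType.Exports.

Local Open Scope classical_set_scope.
Local Open Scope ring_scope.
Local Open Scope complex_scope.

(** * The complex plane *)

(** The only maximum principle used is the second-derivative test: the Laplacian is nonnegative at a
    minimum. For the system the minima of two differences compete, and the smaller one has to be
    examined. The bound by ln (t / s) matters because it says exactly that e^(-2 psi1(t)) t^2 does
    not decrease with t, the sign that the equation for psi1 - psi2 requires. The decay C - c t is
    an arithmetic-geometric mean estimate: the equation for u_t contains e^(2 psi2) and e^(-2 psi1)
    t^2 |q|^2, whose geometric mean t |q| e^(-(psi1 - psi2)) is large as long as u_t is bounded and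
    q does not vanish. At a zero of q only an inequality of the form Laplacian(u) <= K e^u survives,
    whence the barrier. Holomorphy is given as complex differentiability at each point, which yields
    only continuity at first. No contour integral is used: the smoothness of |q|^2, read off from
    the equations, replaces Cauchy's theory. The orbit count uses neither geodesics nor
    completeness: a path is recorded by the boxes it visits, and only its length is estimated. *)

Section PlaneTopology.
Variable R : realType.
Implicit Types (z w : cplx R) (e : R).

Definition hz (s : R) : cplx R := s +i* 0.
Definition vt (s : R) : cplx R := 0 +i* s.
Definition re (z : cplx R) : R := complex.Re z.
Definition im (z : cplx R) : R := complex.Im z.

(** Squares rather than discs: segments parallel to the axes and the coordinatewise Lipschitz
    estimates for curves fit them directly. *)
Definition box z e : set (cplx R) :=
  [set w | `|re w - re z| < e /\ `|im w - im z| < e].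
Definition cbox z e : set (cplx R) :=
  [set w | `|re w - re z| <= e /\ `|im w - im z| <= e].

Lemma reD z w : re (z + w) = re z + re w.
Proof. by case: z; case: w. Qed.
Lemma imD z w : im (z + w) = im z + im w.
Proof. by case: z; case: w. Qed.
Lemma reN z : re (- z) = - re z.
Proof. by case: z. Qed.
Lemma imN z : im (- z) = - im z.
Proof. by case: z. Qed.
Lemma cplx_eq z w : re z = re w -> im z = im w -> z = w.
Proof. by case: z w => [a b] [c d] /= -> ->. Qed.

Lemma cmod2E z : cmod z ^+ 2 = re z ^+ 2 + im z ^+ 2.
Proof.
case: z => a b; rewrite /cmod /re /im /= sqr_sqrtr//.
by rewrite addr_ge0 ?sqr_ge0.
Qed.

Lemma norm_cplxE z : `|z| = (cmod z +i* 0 : cplx R).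
Proof. by rewrite /cmod; case: z. Qed.

Lemma cplx_gt0 (e : cplx R) : 0 < e -> e = (re e +i* 0) /\ 0 < re e.
Proof.
case: e => a b; rewrite ltcE /= => /andP[/eqP b0 a0].
by rewrite /re /= b0.
Qed.

(** The balls of [cplx R] have radii in [R[i]], and a positive element of [R[i]] is real. The box of
    half-width e / 2 lies in the ball of radius e because 2 (e / 2)^2 < e^2. *)
Lemma nbhs_boxP z (A : set (cplx R)) :
  nbhs z A <-> exists2 e, 0 < e & box z e `<=` A.
Proof.
split.
- move=> /nbhs_ballP[/= e /cplx_gt0[eE e0] sA].
  exists (re e / 2); first by rewrite divr_gt0.
  move=> w [w1 w2]; apply: sA; rewrite -ball_normE /ball_ /= eE norm_cplxE.
  rewrite ltcE /= eqxx /=.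
  rewrite -(@ltr_pXn2r _ 2) ?nnegrE ?sqrtr_ge0 ?(ltW e0)//; last first.
    by rewrite /cmod; case: (z - w) => ? ?; rewrite sqrtr_ge0.
  rewrite cmod2E !reD !imD !reN !imN.
  rewrite -(real_normK (num_real (re z - re w))) -(real_normK (num_real (im z - im w))).
  rewrite distrC (distrC (im z)).
  have /= := @ltr_pXn2r R 2 isT (`|re w - re z|) (re e / 2).
  rewrite !nnegrE w1 normr_ge0 (divr_ge0 (ltW e0) _)// => /(_ isT isT) h1.
  have /= := @ltr_pXn2r R 2 isT (`|im w - im z|) (re e / 2).
  rewrite !nnegrE w2 normr_ge0 (divr_ge0 (ltW e0) _)// => /(_ isT isT) h2.
  have : 0 < re e ^+ 2 by rewrite exprn_gt0.
  move: h1 h2; rewrite exprMn exprVn -[2 ^+ 2]natrX => h1 h2 h3.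
  have := ltrD h1 h2; lra.
- move=> [e e0 sA]; apply/nbhs_ballP; exists (e +i* 0 : cplx R) => /=.
    by rewrite ltcE /= eqxx.
  move=> w; rewrite -ball_normE /ball_ /= norm_cplxE ltcE /= eqxx /= => h.
  apply: sA; rewrite /box /= distrC (distrC (im w)).
  have h2 : cmod (z - w) ^+ 2 < e ^+ 2.
    rewrite ltr_pXn2r// ?nnegrE ?(ltW e0)//.
    by rewrite /cmod; case: (z - w) => ? ?; rewrite sqrtr_ge0.
  move: h2; rewrite cmod2E !reD !imD !reN !imN => h2.
  by split; rewrite -(@ltr_pXn2r _ 2) ?nnegrE ?normr_ge0 ?(ltW e0)// real_normK ?num_real//;
    apply: le_lt_trans h2; rewrite ?lerDl ?lerDr sqr_ge0.
Qed.

Lemma nbhs_box z e : 0 < e -> nbhs z (box z e).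
Proof. by move=> e0; apply/nbhs_boxP; exists e. Qed.

Lemma re_continuous : continuous (re : cplx R -> R).
Proof.
move=> z A /nbhs_ballP[e e0 sA]; apply/nbhs_boxP; exists e => // w [h _].
by apply: sA; rewrite -ball_normE /ball_ /= distrC.
Qed.

Lemma im_continuous : continuous (im : cplx R -> R).
Proof.
move=> z A /nbhs_ballP[e e0 sA]; apply/nbhs_boxP; exists e => // w [_ h].
by apply: sA; rewrite -ball_normE /ball_ /= distrC.
Qed.

Lemma cvg_cplx (T : Type) (F : set_system T) {FF : Filter F} (a b : T -> R) (z : cplx R) :
  a x @[x --> F] --> re z -> b x @[x --> F] --> im z ->
  ((a x +i* b x : cplx R) @[x --> F] --> z).
Proof.
move=> /cvgrPdist_lt ha /cvgrPdist_lt hb A /nbhs_boxP[e e0 sA].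
near=> x; apply: sA; split => /=; rewrite distrC; near: x; [exact: ha|exact: hb].
Unshelve. all: by end_near. Qed.

Lemma continuous_cplx (T : topologicalType) (a b : T -> R) (x : T) :
  {for x, continuous a} -> {for x, continuous b} ->
  {for x, continuous (fun x => a x +i* b x : cplx R)}.
Proof. by move=> ca cb; apply: (@cvg_cplx T (nbhs x) _ a b). Qed.

Lemma line_h_continuous z : continuous (fun s : R => z + hz s).
Proof.
move=> s; have -> : (fun s => z + hz s) = (fun s => (re z + s) +i* (im z) : cplx R).
  by apply/funext => r; apply: cplx_eq; rewrite ?reD ?imD //= addr0.
by apply: (@continuous_cplx _ (fun r => re z + r) (fun=> im z));
  [apply: cvgD; [exact: cvg_cst|exact: cvg_id]|exact: cvg_cst].
Qed.

Lemma line_v_continuous z : continuous (fun s : R => z + vt s).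
Proof.
move=> s; have -> : (fun s => z + vt s) = (fun s => (re z) +i* (im z + s) : cplx R).
  by apply/funext => r; apply: cplx_eq; rewrite ?reD ?imD //= addr0.
by apply: (@continuous_cplx _ (fun=> re z) (fun r => im z + r));
  [exact: cvg_cst|apply: cvgD; [exact: cvg_cst|exact: cvg_id]].
Qed.

Lemma hzD z (s r : R) : z + hz s + hz r = z + hz (s + r).
Proof. by apply: cplx_eq; rewrite ?reD ?imD /=; ring. Qed.
Lemma vtD z (s r : R) : z + vt s + vt r = z + vt (s + r).
Proof. by apply: cplx_eq; rewrite ?reD ?imD /=; ring. Qed.
Lemma hz0 z : z + hz 0 = z.
Proof. by apply: cplx_eq; rewrite ?reD ?imD /=; ring. Qed.
Lemma vt0 z : z + vt 0 = z.
Proof. by apply: cplx_eq; rewrite ?reD ?imD /=; ring. Qed.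

Lemma cbox_compact z e : compact (cbox z e).
Proof.
pose A := `[re z - e, re z + e]%classic : set R.
pose B := `[im z - e, im z + e]%classic : set R.
have -> : cbox z e = (fun u : R * R => u.1 +i* u.2 : cplx R) @` (A `*` B).
  apply/seteqP; split => [w [h1 h2]|_ [[a b] [/= h1 h2] <-]].
    exists (re w, im w); last exact: cplx_eq.
    by split; rewrite /A /B /= in_itv /=; move: h1 h2; rewrite !ler_distl.
  by move: h1 h2; rewrite /A /B /= !in_itv /= /cbox /= !ler_distl.
apply: continuous_compact.
  apply: continuous_subspaceT => u.
  by apply: (@continuous_cplx _ fst snd); [exact: cvg_fst|exact: cvg_snd].
by apply: compact_setX; exact: segment_compact.
Qed.

Lemma box_sub_cbox z e : box z e `<=` cbox z e.
Proof. by move=> w [/ltW ? /ltW ?]. Qed.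

Lemma cbox_sub_box z e e' : e < e' -> cbox z e `<=` box z e'.
Proof. by move=> ee' w [h1 h2]; split; apply: le_lt_trans ee'. Qed.

Lemma box_sub z e e' : e <= e' -> box z e `<=` box z e'.
Proof. by move=> ee' w [h1 h2]; split; apply: lt_le_trans ee'. Qed.

Lemma box_open z e : open (box z e).
Proof.
rewrite openE => w [h1 h2]; apply/nbhs_boxP.
exists (Num.min (e - `|re w - re z|) (e - `|im w - im z|)).
  by rewrite lt_min !subr_gt0 h1 h2.
move=> v [/=]; rewrite !lt_min => /andP[g1 _] /andP[_ g2].
split; rewrite /=.
  rewrite -(subrKA (re w)) addrC; apply: (le_lt_trans (ler_normD _ _)); lra.
rewrite -(subrKA (im w)) addrC; apply: (le_lt_trans (ler_normD _ _)); lra.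
Qed.

Lemma open_boxP (U : set (cplx R)) z : open U -> U z ->
  exists2 e, 0 < e & box z e `<=` U.
Proof. by move=> oU Uz; apply/nbhs_boxP; exact: open_nbhs_nbhs. Qed.

Lemma box_center z e : 0 < e -> box z e z.
Proof. by move=> e0; rewrite /box /= !subrr normr0. Qed.

Lemma line_h_box z e s : `|s| < e -> box z e (z + hz s).
Proof.
move=> h; rewrite /box /= !reD !imD [re (hz s)]/= [im (hz s)]/= addr0 subrr normr0.
by rewrite [re z + s]addrC addrK (le_lt_trans (normr_ge0 s)).
Qed.

Lemma line_v_box z e s : `|s| < e -> box z e (z + vt s).
Proof.
move=> h; rewrite /box /= !reD !imD [re (vt s)]/= [im (vt s)]/= addr0 subrr normr0.
by rewrite [im z + s]addrC addrK (le_lt_trans (normr_ge0 s)).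
Qed.

End PlaneTopology.

(** * Partial derivatives *)

Lemma continuous_near_eq (T U : topologicalType) (f g : T -> U) (x : T) :
  (\forall y \near x, f y = g y) -> {for x, continuous f} -> {for x, continuous g}.
Proof.
move=> fg cf A; rewrite /= -(nbhs_singleton fg) => /cf fA.
by apply: filterS2 fg fA => y; rewrite /= => ->.
Qed.

(* Locked: comparing two partial derivatives up to conversion would unfold limits. *)
HB.lock Definition pd (R : realType) (v : bool) (f : cplx R -> R) (z : cplx R) : R :=
  derive1 (fun s : R => f (z + if v then vt s else hz s)) 0.

HB.lock Definition lap (R : realType) (f : cplx R -> R) (z : cplx R) : R :=
  pd false (pd false f) z + pd true (pd true f) z.

HB.lock Definition Cn (R : realType) (k : nat) (U : set (cplx R)) (f : cplx R -> R) : Prop :=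
  Ck k U f.

Section PartialDerivatives.
Variable R : realType.
Implicit Types (f g : cplx R -> R) (U : set (cplx R)) (z w : cplx R) (v : bool).

Definition along v (s : R) : cplx R := if v then vt s else hz s.

Lemma pdE v f z : pd v f z = derive1 (fun s : R => f (z + along v s)) 0.
Proof. by rewrite pd.unlock. Qed.

(** A relation, because [pd] has a value even where the derivative does not exist; the
    differentiation rules below carry existence and value together. *)
Definition has_pd v f z (l : R) := is_derive (0 : R) 1 (fun s => f (z + along v s)) l.

Lemma dxE f : dx f = pd false f.
Proof. by apply/funext => z; rewrite pdE. Qed.
Lemma dyE f : dy f = pd true f.
Proof. by apply/funext => z; rewrite pdE. Qed.

Lemma alongD v z (s r : R) : z + along v s + along v r = z + along v (s + r).
Proof. by case: v; [exact: vtD|exact: hzD]. Qed.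
Lemma along0 v z : z + along v 0 = z.
Proof. by case: v; [exact: vt0|exact: hz0]. Qed.
Lemma along_continuous v z : continuous (fun s : R => z + along v s).
Proof. by case: v; [exact: line_v_continuous|exact: line_h_continuous]. Qed.
Lemma along_box v z e s : `|s| < e -> box z e (z + along v s).
Proof. by case: v; [exact: line_v_box|exact: line_h_box]. Qed.

Lemma has_pdP v f z l : has_pd v f z l ->
  derivable (fun s => f (z + along v s)) 0 1 /\ pd v f z = l.
Proof. by case=> h1 h2; split => //; rewrite pdE derive1E. Qed.

Lemma pd_has_pd v f z : derivable (fun s => f (z + along v s)) 0 1 ->
  has_pd v f z (pd v f z).
Proof. by move=> h; rewrite /has_pd pdE derive1E; apply/derivableP. Qed.

Lemma is_derive_along v f z s l :
  has_pd v f (z + along v s) l <-> is_derive s 1 (fun r => f (z + along v r)) l.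
Proof.
pose g r := f (z + along v r).
have E : (fun r => f (z + along v s + along v r)) = g \o shift s.
  by apply/funext => r; rewrite /g /= alongD [s + r]addrC.
split=> h.
- change (is_derive s 1 g l).
  have -> : g = (fun r => f (z + along v s + along v r)) \o shift (- s).
    by apply/funext => r; rewrite E /= subrK.
  rewrite -[l]mulr1; apply: is_derive1_comp; last exact: is_derive_shift.
  by rewrite /= subrr.
- rewrite /has_pd E -[l]mulr1; apply: is_derive1_comp; last exact: is_derive_shift.
  by rewrite /= add0r.
Qed.

Lemma near_along v z (P : set (cplx R)) : nbhs z P ->
  \forall s \near (0 : R), P (z + along v s).
Proof.
by move=> zP; apply: (@along_continuous v z 0); rewrite along0.
Qed.

Lemma has_pd_ext v f g z l : (\forall w \near z, f w = g w) ->
  has_pd v f z l -> has_pd v g z l.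
Proof.
move=> fg; apply: (@near_eq_is_derive _ _ _ (fun s => f (z + along v s)) (fun s => g (z + along v s))).
by have := near_along v fg; apply: filterS => s.
Qed.

Lemma has_pdD v f g z a b : has_pd v f z a -> has_pd v g z b ->
  has_pd v (fun w => f w + g w) z (a + b).
Proof. by move=> ? ?; apply: is_deriveD. Qed.

Lemma has_pdN v f z a : has_pd v f z a -> has_pd v (fun w => - f w) z (- a).
Proof. by move=> ?; apply: is_deriveN. Qed.

Lemma has_pdM v f g z a b : has_pd v f z a -> has_pd v g z b ->
  has_pd v (fun w => f w * g w) z (f z * b + g z * a).
Proof.
move=> fa gb.
have := @is_deriveM _ _ (fun s => f (z + along v s)) (fun s => g (z + along v s)) 0 1 a b fa gb.
by rewrite /= !along0.
Qed.

Lemma has_pd_cst v (c : R) z : has_pd v (fun=> c) z 0.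
Proof. exact: is_derive_cst. Qed.

Lemma has_pd_comp v (F : R -> R) f z a b : is_derive (f z) 1 F b ->
  has_pd v f z a -> has_pd v (fun w => F (f w)) z (b * a).
Proof.
move=> Fb fa; apply: (@is_derive1_comp _ F (fun s => f (z + along v s))) => //.
by rewrite along0.
Qed.

Lemma has_pd_expR v f z a : has_pd v f z a ->
  has_pd v (fun w => expR (f w)) z (expR (f z) * a).
Proof. by move=> fa; apply: has_pd_comp. Qed.

Lemma has_pd_ln v f z a : 0 < f z -> has_pd v f z a ->
  has_pd v (fun w => ln (f w)) z ((f z)^-1 * a).
Proof. by move=> f0 fa; apply: has_pd_comp => //; exact: is_derive1_ln. Qed.

Lemma has_pdV v f z a : f z != 0 -> has_pd v f z a ->
  has_pd v (fun w => (f w)^-1) z (- (f z)^-1 * (f z)^-1 * a).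
Proof.
move=> f0 fa.
have := @is_deriveV R (fun s => f (z + along v s)) 0 a 1 _ fa.
rewrite along0 => /(_ f0); rewrite /has_pd; congr is_derive.
by rewrite /GRing.scale /= expr2 invfM !mulNr.
Qed.

Lemma CkSP k U f : Ck k.+1 U f <->
  [/\ forall z, U z -> {for z, continuous f},
      forall v z, U z -> has_pd v f z (pd v f z) &
      forall v, Ck k U (pd v f)].
Proof.
rewrite [Ck _ _ _]/= dxE dyE; split=> [[cf [hx hy kx ky]]|[cf h hk]].
  split; [exact: cf| |by case].
  by move=> v z Uz; apply: pd_has_pd; case: v; [exact: (hy z Uz)|exact: (hx z Uz)].
split=> //; split; [| |exact: (hk false)|exact: (hk true)].
  by move=> z /(h false)/has_pdP[].
by move=> z /(h true)/has_pdP[].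
Qed.

Lemma CnE k U f : Cn k U f = Ck k U f.
Proof. by rewrite Cn.unlock. Qed.

Lemma Cn0P U f : Cn 0 U f <-> forall z, U z -> {for z, continuous f}.
Proof. by rewrite CnE; split => [[]|h]. Qed.

Lemma CnSP k U f : Cn k.+1 U f <->
  [/\ forall z, U z -> {for z, continuous f},
      forall v z, U z -> has_pd v f z (pd v f z) &
      forall v, Cn k U (pd v f)].
Proof.
rewrite CnE CkSP; split => -[h1 h2 h3]; split => // v; have := h3 v; rewrite CnE //.
Qed.

Lemma Cn_continuous k U f z : Cn k U f -> U z -> {for z, continuous f}.
Proof. by case: k => [/Cn0P h|k /CnSP[h _ _]]; exact: h. Qed.

Lemma Cn_has_pd k U f v z : Cn k.+1 U f -> U z -> has_pd v f z (pd v f z).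
Proof. by case/CnSP => _ h _ Uz; apply: h. Qed.

Lemma Cn_pd k U f v : Cn k.+1 U f -> Cn k U (pd v f).
Proof. by case/CnSP. Qed.

Lemma Cn_S k : forall U f, Cn k.+1 U f -> Cn k U f.
Proof.
elim: k => [|k IH] U f; first by move=> /CnSP[h _ _]; apply/Cn0P.
by move=> /CnSP[cf h hk]; apply/CnSP; split => // v; apply: IH.
Qed.

Lemma Cn_le k k' U f : (k <= k')%N -> Cn k' U f -> Cn k U f.
Proof.
move=> /subnKC <-; elim: (k' - k)%N => [|n IH]; first by rewrite addn0.
by rewrite addnS => /Cn_S.
Qed.

Lemma Cn_sub k U V f : U `<=` V -> Cn k V f -> Cn k U f.
Proof.
move=> UV; elim: k f => [|k IH] f; first by move=> /Cn0P h; apply/Cn0P => z /UV/h.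
by move=> /CnSP[cf h hk]; apply/CnSP; split => [z /UV/cf|v z /UV/h|v] //; apply: IH.
Qed.

Lemma near_open_eq U f g z : open U -> {in U, f =1 g} -> U z ->
  \forall w \near z, f w = g w.
Proof.
move=> oU fg Uz; have /= := open_nbhs_nbhs (conj oU Uz).
by apply: filterS => w Uw; apply: fg; rewrite inE.
Qed.

Lemma pd_ext v U f g z : open U -> {in U, f =1 g} -> U z -> has_pd v f z (pd v f z) ->
  has_pd v g z (pd v f z).
Proof.
by move=> oU fg Uz; apply: has_pd_ext; exact: near_open_eq fg Uz.
Qed.

Lemma Cn_ext k : forall U f g, open U -> {in U, f =1 g} -> Cn k U f -> Cn k U g.
Proof.
have C U f g z : open U -> {in U, f =1 g} -> U z -> {for z, continuous f} ->
    {for z, continuous g}.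
  by move=> oU fg Uz; apply: continuous_near_eq; exact: near_open_eq fg Uz.
elim: k => [|k IH] U f g oU fg.
  by move=> /Cn0P h; apply/Cn0P => z Uz; exact: (C _ _ _ _ oU fg Uz (h z Uz)).
move=> /CnSP[cf h hk]; have P v z : U z -> has_pd v g z (pd v f z).
  by move=> Uz; exact: (pd_ext oU fg Uz (h v z Uz)).
have E v z : U z -> pd v g z = pd v f z by move=> /(P v)/has_pdP[].
apply/CnSP; split => [z Uz|v z Uz|v].
- exact: (C _ _ _ _ oU fg Uz (cf z Uz)).
- by rewrite E//; exact: P.
- by apply: (IH U (pd v f)) => // z; rewrite inE => Uz; rewrite E.
Qed.

(** Higher partials differentiate [pd v f], which agrees with the formula [d v] only on [U];
    openness makes this enough. Regularity can then be proved by induction on [k] from explicit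
    formulas for the derivatives. *)
Lemma Cn_intro k U f (d : bool -> cplx R -> R) : open U ->
  (forall z, U z -> {for z, continuous f}) ->
  (forall v z, U z -> has_pd v f z (d v z)) ->
  (forall v, Cn k U (d v)) -> Cn k.+1 U f.
Proof.
move=> oU cf h hk.
have E v z : U z -> pd v f z = d v z by move=> /(h v)/has_pdP[].
apply/CnSP; split => // [v z Uz|v]; first by rewrite E//; exact: h.
by apply: (@Cn_ext _ _ (d v)) => // z; rewrite inE => Uz; rewrite E.
Qed.

Lemma Cn_cst k U (c : R) : open U -> Cn k U (fun=> c).
Proof.
move=> oU; elim: k c => [|k IH] c; first by apply/Cn0P => z _; exact: cst_continuous.
by apply: (@Cn_intro _ _ _ (fun _ _ => 0)) => // [z _|v z _];
  [exact: cst_continuous|exact: has_pd_cst].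
Qed.

Lemma CnD k U f g : open U -> Cn k U f -> Cn k U g -> Cn k U (fun z => f z + g z).
Proof.
move=> oU; elim: k f g => [|k IH] f g.
  by move=> /Cn0P h1 /Cn0P h2; apply/Cn0P => z Uz; apply: continuousD; [exact: h1|exact: h2].
move=> /CnSP[cf h hk] /CnSP[cg h' hk'].
apply: (@Cn_intro _ _ _ (fun v z => pd v f z + pd v g z)) => // [z Uz|v z Uz|v].
- by apply: continuousD; [exact: cf|exact: cg].
- by apply: has_pdD; [exact: h|exact: h'].
- exact: IH.
Qed.

Lemma CnM k U f g : open U -> Cn k U f -> Cn k U g -> Cn k U (fun z => f z * g z).
Proof.
move=> oU; elim: k f g => [|k IH] f g.
  by move=> /Cn0P h1 /Cn0P h2; apply/Cn0P => z Uz; apply: continuousM; [exact: h1|exact: h2].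
move=> Hf Hg; case/CnSP: (Hf) => cf h hk; case/CnSP: (Hg) => cg h' hk'.
apply: (@Cn_intro _ _ _ (fun v z => f z * pd v g z + g z * pd v f z)) => // [z Uz|v z Uz|v].
- by apply: continuousM; [exact: cf|exact: cg].
- by apply: has_pdM; [exact: h|exact: h'].
- by apply: CnD => //; apply: IH => //; exact: Cn_S.
Qed.

Lemma CnN k U f : open U -> Cn k U f -> Cn k U (fun z => - f z).
Proof.
move=> oU hf; under eq_fun do rewrite -mulN1r.
by apply: CnM => //; exact: Cn_cst.
Qed.

Lemma CnB k U f g : open U -> Cn k U f -> Cn k U g -> Cn k U (fun z => f z - g z).
Proof. by move=> oU hf hg; apply: CnD => //; apply: CnN. Qed.

Lemma CnX k U f n : open U -> Cn k U f -> Cn k U (fun z => f z ^+ n).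
Proof.
move=> oU hf; elim: n => [|n IH].
  by under eq_fun do rewrite expr0; exact: Cn_cst.
by under eq_fun do rewrite exprS; exact: CnM.
Qed.

Lemma continuous_at_comp (F : R -> R) f z : {for f z, continuous F} ->
  {for z, continuous f} -> {for z, continuous (fun w => F (f w))}.
Proof. by move=> cF cf; apply: (continuous_comp cf). Qed.

Lemma Cn_expR k U f : open U -> Cn k U f -> Cn k U (fun z => expR (f z)).
Proof.
move=> oU; elim: k f => [|k IH] f.
  move=> /Cn0P h1; apply/Cn0P => z Uz.
  by apply: continuous_at_comp; [exact: continuous_expR|exact: h1].
move=> Hf; case/CnSP: (Hf) => cf h hk.
apply: (@Cn_intro _ _ _ (fun v z => expR (f z) * pd v f z)) => // [z Uz|v z Uz|v].
- by apply: continuous_at_comp; [exact: continuous_expR|exact: cf].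
- by apply: has_pd_expR; exact: h.
- by apply: CnM => //; apply: IH => //; exact: Cn_S.
Qed.

Lemma CnV k U f : open U -> (forall z, U z -> f z != 0) ->
  Cn k U f -> Cn k U (fun z => (f z)^-1).
Proof.
move=> oU f0; elim: k => [|k IH].
  by move=> /Cn0P h1; apply/Cn0P => z Uz; apply: continuousV; [exact: f0|exact: h1].
move=> Hf; case/CnSP: (Hf) => cf h hk.
apply: (@Cn_intro _ _ _ (fun v z => - (f z)^-1 * (f z)^-1 * pd v f z)) => // [z Uz|v z Uz|v].
- by apply: continuousV; [exact: f0|exact: cf].
- by apply: has_pdV; [exact: f0|exact: h].
- have ? := IH (Cn_S Hf).
  by apply: CnM => //; apply: CnM => //; apply: CnN.
Qed.

Lemma Cn_ln k U f : open U -> (forall z, U z -> 0 < f z) ->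
  Cn k U f -> Cn k U (fun z => ln (f z)).
Proof.
move=> oU f0; case: k => [|k].
  move=> /Cn0P h1; apply/Cn0P => z Uz.
  by apply: continuous_at_comp; [apply: continuous_ln; exact: f0|exact: h1].
move=> Hf; case/CnSP: (Hf) => cf h hk.
apply: (@Cn_intro _ _ _ (fun v z => (f z)^-1 * pd v f z)) => // [z Uz|v z Uz|v].
- by apply: continuous_at_comp; [apply: continuous_ln; exact: f0|exact: cf].
- by apply: has_pd_ln; [exact: f0|exact: h].
- apply: CnM => //; apply: CnV => //; last exact: Cn_S.
  by move=> z Uz; rewrite gt_eqF// f0.
Qed.

Lemma has_pd_re v z : has_pd v (@re R) z (if v then 0 else 1).
Proof.
case: v; rewrite /has_pd /along.
  have -> : (fun s => re (z + vt s)) = cst (re z).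
    by apply/funext => s; rewrite reD /= addr0.
  exact: is_derive_cst.
have -> : (fun s => re (z + hz s)) = shift (re z).
  by apply/funext => s; rewrite reD /= addrC.
exact: is_derive_shift.
Qed.

Lemma has_pd_im v z : has_pd v (@im R) z (if v then 1 else 0).
Proof.
case: v; rewrite /has_pd /along; last first.
  have -> : (fun s => im (z + hz s)) = cst (im z).
    by apply/funext => s; rewrite imD /= addr0.
  exact: is_derive_cst.
have -> : (fun s => im (z + vt s)) = shift (im z).
  by apply/funext => s; rewrite imD /= addrC.
exact: is_derive_shift.
Qed.

Lemma Cn_re k U : open U -> Cn k U (@re R).
Proof.
move=> oU; case: k => [|k]; first by apply/Cn0P => z _; exact: re_continuous.
apply: (@Cn_intro _ _ _ (fun v _ => if v then 0 else 1)) => // [z _|v z _|v].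
- exact: re_continuous.
- exact: has_pd_re.
- exact: Cn_cst.
Qed.

Lemma Cn_im k U : open U -> Cn k U (@im R).
Proof.
move=> oU; case: k => [|k]; first by apply/Cn0P => z _; exact: im_continuous.
apply: (@Cn_intro _ _ _ (fun v _ => if v then 1 else 0)) => // [z _|v z _|v].
- exact: im_continuous.
- exact: has_pd_im.
- exact: Cn_cst.
Qed.

End PartialDerivatives.

(** * The Laplacian *)

Lemma continuous_dist_lt (T : topologicalType) (R : realType) (f : T -> R) (x : T) (e : R) :
  {for x, continuous f} -> 0 < e -> \forall y \near x, `|f x - f y| < e.
Proof. by move=> /cvgrPdist_lt; apply. Qed.

Section Laplacian.
Variable R : realType.
Implicit Types (f g : cplx R -> R) (U : set (cplx R)) (z w : cplx R) (v : bool).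

Lemma lapE f z : lap f z = pd false (pd false f) z + pd true (pd true f) z.
Proof. by rewrite lap.unlock. Qed.

Lemma eucl_laplacianE f z : eucl_laplacian f z = lap f z.
Proof. by rewrite lapE /eucl_laplacian dxE dyE dxE dyE. Qed.

Definition grad2 f z : R := pd false f z ^+ 2 + pd true f z ^+ 2.

Lemma pd_eq U f g v z : open U -> {in U, f =1 g} -> U z ->
  has_pd v f z (pd v f z) -> pd v g z = pd v f z.
Proof. by move=> oU fg Uz h; have [] := has_pdP (pd_ext oU fg Uz h). Qed.

Lemma pd2E U f (d : bool -> cplx R -> R) v z l : open U -> U z ->
  (forall w, U w -> has_pd v f w (d v w)) -> has_pd v (d v) z l ->
  pd v (pd v f) z = l.
Proof.
move=> oU Uz hf hd.
have E : {in U, d v =1 pd v f}.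
  by move=> w; rewrite inE => /hf /has_pdP[].
have [_ dl] := has_pdP hd.
by rewrite (pd_eq oU E Uz) ?dl.
Qed.

Lemma lapD U f g z : open U -> U z -> Cn 2 U f -> Cn 2 U g ->
  lap (fun w => f w + g w) z = lap f z + lap g z.
Proof.
move=> oU Uz cf cg; rewrite !lapE.
have E v : pd v (pd v (fun w => f w + g w)) z = pd v (pd v f) z + pd v (pd v g) z.
  apply: (@pd2E U _ (fun v w => pd v f w + pd v g w) v z _ oU Uz) => [w Uw|].
    by apply: has_pdD; [exact: (Cn_has_pd v cf)|exact: (Cn_has_pd v cg)].
  by apply: has_pdD; [exact: (Cn_has_pd v (Cn_pd v cf))|exact: (Cn_has_pd v (Cn_pd v cg))].
by rewrite !E; ring.
Qed.

Lemma lapZ U (c : R) f z : open U -> U z -> Cn 2 U f ->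
  lap (fun w => c * f w) z = c * lap f z.
Proof.
move=> oU Uz cf; rewrite !lapE.
have E v : pd v (pd v (fun w => c * f w)) z = c * pd v (pd v f) z.
  apply: (@pd2E U _ (fun v w => c * pd v f w + f w * 0) v z _ oU Uz) => [w Uw|].
    by apply: has_pdM; [exact: has_pd_cst|exact: (Cn_has_pd v cf)].
  have -> : c * pd v (pd v f) z = (c * pd v (pd v f) z + pd v f z * 0) + (f z * 0 + 0 * pd v f z).
    by ring.
  apply: has_pdD; apply: has_pdM.
  - exact: has_pd_cst.
  - exact: (Cn_has_pd v (Cn_pd v cf)).
  - exact: (Cn_has_pd v cf).
  - exact: has_pd_cst.
by rewrite !E; ring.
Qed.

Lemma lapN U f z : open U -> U z -> Cn 2 U f ->
  lap (fun w => - f w) z = - lap f z.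
Proof.
by move=> oU Uz cf; under eq_fun do rewrite -mulN1r; rewrite (lapZ _ oU Uz cf) mulN1r.
Qed.

Lemma lapB U f g z : open U -> U z -> Cn 2 U f -> Cn 2 U g ->
  lap (fun w => f w - g w) z = lap f z - lap g z.
Proof.
by move=> oU Uz cf cg; rewrite (lapD oU Uz cf (CnN oU cg)) (lapN oU Uz cg).
Qed.

Lemma lap_cst (c : R) z : lap (fun=> c) z = 0.
Proof.
rewrite lapE.
have E v : pd v (pd v (fun=> c)) z = 0.
  apply: (@pd2E setT _ (fun _ _ => 0) v z _ openT I) => [w _|].
    exact: has_pd_cst.
  exact: has_pd_cst.
by rewrite !E addr0.
Qed.

Lemma lap_ln U f z : open U -> U z -> (forall w, U w -> 0 < f w) -> Cn 2 U f ->
  lap (fun w => ln (f w)) z = lap f z / f z - grad2 f z / f z ^+ 2.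
Proof.
move=> oU Uz f0 cf; rewrite !lapE /grad2.
have fz0 : f z != 0 by rewrite gt_eqF// f0.
have E v : pd v (pd v (fun w => ln (f w))) z =
    pd v (pd v f) z / f z - pd v f z ^+ 2 / f z ^+ 2.
  have -> : pd v (pd v f) z / f z - pd v f z ^+ 2 / f z ^+ 2 =
      (f z)^-1 * pd v (pd v f) z + pd v f z * (- (f z)^-1 * (f z)^-1 * pd v f z).
    by field.
  apply: (@pd2E U _ (fun v w => (f w)^-1 * pd v f w) v z _ oU Uz) => [w Uw|].
    by apply: has_pd_ln; [exact: f0|exact: (Cn_has_pd v cf)].
  apply: has_pdM; last exact: (Cn_has_pd v (Cn_pd v cf)).
  by apply: has_pdV => //; exact: (Cn_has_pd v cf).
by rewrite !E; ring.
Qed.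

Lemma lap_expR U f z : open U -> U z -> Cn 2 U f ->
  lap (fun w => expR (f w)) z = expR (f z) * (lap f z + grad2 f z).
Proof.
move=> oU Uz cf; rewrite !lapE /grad2.
have E v : pd v (pd v (fun w => expR (f w))) z =
    expR (f z) * pd v (pd v f) z + pd v f z * (expR (f z) * pd v f z).
  apply: (@pd2E U _ (fun v w => expR (f w) * pd v f w) v z _ oU Uz) => [w Uw|].
    by apply: has_pd_expR; exact: (Cn_has_pd v cf).
  apply: has_pdM; last exact: (Cn_has_pd v (Cn_pd v cf)).
  by apply: has_pd_expR => //; exact: (Cn_has_pd v cf).
by rewrite !E; ring.
Qed.

(** If [l] were negative then, as g'(0) = 0, g' would be negative on a short interval to the right
    of 0, and the mean value theorem would produce a value below g(0). *)
Lemma second_derivative_min (g : R -> R) (e l : R) : 0 < e ->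
  (forall s, `|s| < e -> derivable g s 1) ->
  (forall s, `|s| < e -> g 0 <= g s) ->
  is_derive (0 : R) 1 (derive1 g) l -> 0 <= l.
Proof.
move=> e0 dg g0 [dl El]; rewrite leNgt; apply/negP => l0.
have d0 : derive1 g 0 = 0.
  rewrite derive1E; apply: derive_val; apply: (@derive1_at_min R g (- e) e 0).
  - by rewrite (@le_trans _ _ 0)// ?oppr_le0 ltW.
  - by move=> t; rewrite in_itv /= -ltr_norml => /dg.
  - by rewrite in_itv /= e0 oppr_lt0 e0.
  - by move=> t; rewrite in_itv /= -ltr_norml => /g0.
have : derive1 (derive1 g) 0 = l by rewrite derive1E.
rewrite /(derive1 (derive1 g)) => El'.
move: dl; rewrite /derivable => dl.
have cl : (h^-1 *: (derive1 g (h + 0) - derive1 g 0)) @[h --> 0^'] --> l.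
  rewrite -El'; have := dl; under eq_fun do rewrite /= /GRing.scale /= mulr1.
  by [].
(* With tolerance -l / 2 the difference quotients of g' at 0 stay below l / 2 < 0. *)
have /cvgrPdist_lt /(_ (- l / 2)) := cl.
have l2 : 0 < - l / 2 by lra.
move=> /(_ l2) /nbhs_ballP[d /= d1 hd].
pose s := Num.min (d / 2) (e / 2).
have s0 : 0 < s by rewrite lt_min !divr_gt0.
have sd : s < d by rewrite gt_min; apply/orP; left; lra.
have se : s < e by rewrite gt_min; apply/orP; right; lra.
have neg r : 0 < r <= s -> derive1 g r < 0.
  move=> /andP[r0 rs]; have := hd r.
  rewrite -ball_normE /= sub0r normrN gtr0_norm// (le_lt_trans rs)// gt_eqF//.
  move=> /(_ isT isT); rewrite addr0 d0 subr0 /GRing.scale /= => H.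
  have : r^-1 * derive1 g r < 0 by move: H; rewrite ltr_norml; lra.
  by rewrite pmulr_rlt0// invr_gt0.
have [||c] := @MVT R g (derive1 g) 0 s s0.
- move=> x; rewrite in_itv /= => /andP[x0 xs]; rewrite derive1E; apply/derivableP.
  by apply: dg; rewrite gtr0_norm// (lt_trans xs).
- apply: derivable_within_continuous => x; rewrite in_itv /= => /andP[x0 xs].
  by apply: dg; rewrite ger0_norm// (le_lt_trans xs).
rewrite in_itv /= => /andP[c0 cs] E.
have := g0 s; rewrite gtr0_norm// => /(_ se); rewrite -subr_ge0 E subr0.
rewrite pmulr_lge0// leNgt neg// c0 ltW//.
Qed.

Lemma pd_line U f v z : open U -> U z -> Cn 2 U f ->
  [/\ exists2 e, 0 < e & forall s : R, `|s| < e -> derivable (fun r => f (z + along v r)) s 1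
    & is_derive (0 : R) 1 (derive1 (fun r => f (z + along v r))) (pd v (pd v f) z)].
Proof.
move=> oU Uz cf.
have [e e0 eU] := open_boxP oU Uz.
have D (s : R) : `|s| < e ->
    is_derive s 1 (fun r => f (z + along v r)) (pd v f (z + along v s)).
  move=> se; apply/is_derive_along; apply: (Cn_has_pd v cf).
  by apply: eU; exact: along_box.
split; first by exists e => // s /D[].
have := Cn_has_pd v (Cn_pd v cf) Uz.
apply: near_eq_is_derive; apply/nbhs_ballP; exists e => // s.
rewrite -ball_normE /= sub0r normrN => /D[_ <-].
by rewrite derive1E.
Qed.

(** Each pure second derivative is nonnegative by the one-variable test along a coordinate line.
    Every later comparison rests on this, at a minimum supplied by compactness. *)
Lemma lap_local_min U f z : open U -> U z -> Cn 2 U f ->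
  (\forall w \near z, f z <= f w) -> 0 <= lap f z.
Proof.
move=> oU Uz cf /nbhs_boxP[d d0 hd]; rewrite lapE.
have P v : 0 <= pd v (pd v f) z.
  have [[e e0 he] D] := pd_line v oU Uz cf.
  apply: (@second_derivative_min (fun r => f (z + along v r)) (Num.min e d)) => //.
  - by rewrite lt_min e0.
  - by move=> s; rewrite lt_min => /andP[+ _]; exact: he.
  - by move=> s; rewrite lt_min along0 => /andP[_ sd]; apply: hd; exact: along_box.
by rewrite addr_ge0.
Qed.

(* Both mixed partials are limits of the same second difference quotient,
   which the mean value theorem evaluates in either order. *)
Lemma mixed_partials U f z : open U -> U z -> Cn 2 U f ->
  pd true (pd false f) z = pd false (pd true f) z.
Proof.
move=> oU Uz cf; have [e e0 eU] := open_boxP oU Uz.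
have ebox a b : `|a| < e -> `|b| < e -> U (z + hz a + vt b).
  move=> ha hb; apply: eU; rewrite /box /= !reD !imD; split.
    have -> : re z + re (hz a) + re (vt b) - re z = a by rewrite /=; ring.
    by [].
  have -> : im z + im (hz a) + im (vt b) - im z = b by rewrite /=; ring.
  by [].
have H (u : bool) (h : R) : 0 < h < e -> exists a b, [/\ 0 < a < h, 0 < b < h &
    f (z + hz h + vt h) - f (z + hz h) - f (z + vt h) + f z =
    pd (~~ u) (pd u f) (z + hz a + vt b) * h ^+ 2].
  move=> /andP[h0 he].
  (* [s] moves in the direction [u], which is differentiated first, and [r] in the other one, so
     that one argument serves both orders. *)
  pose P s r := if u then z + hz r + vt s else z + hz s + vt r.
  have PU s r : `|s| < e -> `|r| < e -> U (P s r).
    by move=> ? ?; rewrite /P; case: (u); exact: ebox.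
  have Ps s r : P s r = P 0 r + along u s.
    by rewrite /P; case: (u); apply: cplx_eq; rewrite ?(reD, imD) /=; ring.
  have Pr s r : P s r = P s 0 + along (~~ u) r.
    by rewrite /P; case: (u); apply: cplx_eq; rewrite ?(reD, imD) /=; ring.
  have D1 (s r : R) : `|s| < e -> `|r| < e -> is_derive s 1 (fun s => f (P s r)) (pd u f (P s r)).
    move=> hs hr; have -> : (fun s => f (P s r)) = (fun s => f (P 0 r + along u s)).
      by apply/funext => x; rewrite (Ps x).
    by rewrite (Ps s r); apply/is_derive_along; rewrite -Ps; apply: (Cn_has_pd u cf); exact: PU.
  have D2 (s r : R) : `|s| < e -> `|r| < e ->
      is_derive r 1 (fun r => pd u f (P s r)) (pd (~~ u) (pd u f) (P s r)).
    move=> hs hr; have -> : (fun r => pd u f (P s r)) = (fun r => pd u f (P s 0 + along (~~ u) r)).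
      by apply/funext => x; rewrite (Pr s x).
    rewrite (Pr s r); apply/is_derive_along; rewrite -Pr.
    by apply: (Cn_has_pd (~~ u) (Cn_pd u cf)); exact: PU.
  have nh : `|h| < e by rewrite gtr0_norm.
  have n0 : `|0 : R| < e by rewrite normr0.
  have D3 (s : R) : `|s| < e -> is_derive s 1 (fun s => f (P s h) - f (P s 0))
      (pd u f (P s h) - pd u f (P s 0)).
    by move=> hs; apply: is_deriveB; exact: D1.
  have lt_e (x : R) : 0 <= x <= h -> `|x| < e.
    by move=> /andP[x0 xh]; rewrite ger0_norm// (le_lt_trans xh).
  have [||a] := @MVT R (fun s => f (P s h) - f (P s 0))
      (fun s => pd u f (P s h) - pd u f (P s 0)) 0 h h0.
  - by move=> x; rewrite in_itv /= => /andP[x0 xh]; apply: D3; apply: lt_e; rewrite !ltW.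
  - apply: derivable_within_continuous => x; rewrite in_itv /= => /lt_e hx.
    by have [] := D3 x hx.
  rewrite in_itv /= => /andP[a0 ah] Ea.
  have na : `|a| < e by apply: lt_e; rewrite !ltW.
  have [||b] := @MVT R (fun r => pd u f (P a r)) (fun r => pd (~~ u) (pd u f) (P a r)) 0 h h0.
  - by move=> x; rewrite in_itv /= => /andP[x0 xh]; apply: D2 => //; apply: lt_e; rewrite !ltW.
  - apply: derivable_within_continuous => x; rewrite in_itv /= => /lt_e hx.
    by have [] := D2 a x na hx.
  rewrite in_itv /= => /andP[b0 bh] Eb.
  exists (if u then b else a), (if u then a else b); split.
  - by case: (u); apply/andP.
  - by case: (u); apply/andP.
  have -> : z + hz (if u then b else a) + vt (if u then a else b) = P a b.
    by rewrite /P; case: (u).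
  transitivity (f (P h h) - f (P h 0) - (f (P 0 h) - f (P 0 0))).
    by rewrite /P; case: (u); rewrite ?hz0 ?vt0; ring.
  by rewrite Ea Eb; ring.
have C u : {for z, continuous (pd (~~ u) (pd u f))}.
  by have := Cn_pd (~~ u) (Cn_pd u cf) => /Cn_continuous; apply.
apply/eqP; rewrite -subr_eq0 -normr_le0 leNgt; apply/negP => d0.
set d := `|_| in d0.
have nb u : \forall w \near z, `|pd (~~ u) (pd u f) z - pd (~~ u) (pd u f) w| < d / 2.
  have d2 : 0 < d / 2 by rewrite divr_gt0.
  exact: continuous_dist_lt (C u) d2.
have [d1 d10 h1] := (nbhs_boxP _ _).1 (nb false).
have [d2 d20 h2] := (nbhs_boxP _ _).1 (nb true).
pose m := Num.min e (Num.min d1 d2).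
have m0 : 0 < m by rewrite !lt_min e0 d10 d20.
pose h := m / 2.
have h0 : 0 < h by rewrite /h; lra.
have hm : h < m by rewrite /h; lra.
have [he hd1 hd2] : [/\ h < e, h < d1 & h < d2].
  by move: hm; rewrite /m !lt_min => /and3P[].
have [a [b [ha hb E1]]] := H false h ltac:(by rewrite h0).
have [a' [b' [ha' hb' E2]]] := H true h ltac:(by rewrite h0).
have bx (x y t : R) : 0 < x < h -> 0 < y < h -> h < t -> box z t (z + hz x + vt y).
  move=> /andP[x1 x2] /andP[y1 y2] ht; rewrite /box /= !reD !imD; split.
    have -> : re z + re (hz x) + re (vt y) - re z = x by rewrite /=; ring.
    by rewrite gtr0_norm// (lt_trans x2).
  have -> : im z + im (hz x) + im (vt y) - im z = y by rewrite /=; ring.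
  by rewrite gtr0_norm// (lt_trans y2).
have := h1 _ (bx a b d1 ha hb hd1); have := h2 _ (bx a' b' d2 ha' hb' hd2).
rewrite /=.
have -> : pd true (pd false f) (z + hz a + vt b) = pd false (pd true f) (z + hz a' + vt b').
  have h20 : h ^+ 2 != 0 by rewrite expf_neq0// gt_eqF.
  by apply: (mulIf h20); rewrite -E1 -E2.
set A := pd _ _ z; set B := pd true (pd false f) z; set M := pd _ _ (_ + _).
move=> k1 k2; have : d < d; last by rewrite ltxx.
rewrite {1}/d -/A -/B -(subrKA M).
rewrite (le_lt_trans (ler_normD _ _))// (distrC M); lra.
Qed.

End Laplacian.

(** * Unique continuation for holomorphic functions *)

(** An exact factorization with a continuous factor replaces the limit of difference quotients, so
    that composing [f] with a real curve becomes algebra. *)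
Lemma derivable_caratheodory (K : numFieldType) (f : K -> K) (x : K) :
  derivable f x 1 ->
  exists g : K -> K, [/\ forall z, f z - f x = g z * (z - x),
        {for x, continuous g} & g x = derive1 f x].
Proof.
move=> Hd.
exists (fun z => if z == x then derive1 f x else (f z - f x) / (z - x)); split.
- move=> z; case: eqP => [->|/eqP]; first by rewrite !subrr mulr0.
  by rewrite -subr_eq0 => /divfK->.
- apply/continuous_withinNshiftx; rewrite eqxx /=.
  pose g1 h := (h^-1 *: ((f \o shift x) h%:A - f x)).
  have F1 : g1 @ 0^' --> derive1 f x by rewrite derive1E; exact: Hd.
  apply: cvg_trans F1; apply: near_eq_cvg; rewrite /g1 !fctE.
  near=> i.
  rewrite ifN; first by rewrite addrK mulrC /= [_%:A]mulr1.
  rewrite -subr_eq0 addrK.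
  by near: i; rewrite near_withinE /= near_simpl; near=> x1.
by rewrite eqxx.
Unshelve. all: by end_near. Qed.

Lemma nbhsS (T : topologicalType) (x : T) (A B : set T) :
  A `<=` B -> nbhs x A -> nbhs x B.
Proof. exact: filterS. Qed.

Lemma nbhs_all (T : topologicalType) (x : T) (A : set T) : (forall y, A y) -> nbhs x A.
Proof. by move=> h; apply: filterS filterT. Qed.

Lemma nbhsI (T : topologicalType) (x : T) (A B : set T) :
  nbhs x A -> nbhs x B -> nbhs x (A `&` B).
Proof. exact: filterI. Qed.

Lemma near_gt0 (T : topologicalType) (R : realType) (f : T -> R) (x : T) :
  {for x, continuous f} -> 0 < f x -> \forall y \near x, 0 < f y.
Proof.
move=> cf f0; have := continuous_dist_lt cf f0; apply: filterS => y.
rewrite ltr_norml; lra.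
Qed.

Section Holomorphic.
Variable R : realType.
Implicit Types (q : cplx R -> cplx R) (z w a : cplx R) (U : set (cplx R)).

Lemma has_pd_val v (f : cplx R -> R) z (b c : R) : has_pd v f z b -> b = c -> has_pd v f z c.
Proof. by move=> ? <-. Qed.

Lemma reM z w : re (z * w) = re z * re w - im z * im w.
Proof. by case: z; case: w. Qed.
Lemma imM z w : im (z * w) = re z * im w + im z * re w.
Proof. by case: z; case: w. Qed.

(** The factors of [q] and of the two coordinates of the curve are multiplied and split into real
    and imaginary parts. It serves twice: on coordinate lines it gives the Cauchy-Riemann equations,
    on a path in the surface the change of velocity between charts. *)
Lemma holo_chain q (c : R -> cplx R) (s a b : R) : derivable q (c s) 1 ->
  is_derive s 1 (fun r => re (c r)) a -> is_derive s 1 (fun r => im (c r)) b ->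
  is_derive s 1 (fun r => re (q (c r))) (re (derive1 q (c s) * (a +i* b))) /\
  is_derive s 1 (fun r => im (q (c r))) (im (derive1 q (c s) * (a +i* b))).
Proof.
move=> /derivable_caratheodory[g [gE cg g0]].
move=> /is_derive1_caratheodory[ga [gaE cga ga0]].
move=> /is_derive1_caratheodory[gb [gbE cgb gb0]].
have cc : {for s, continuous c}.
  have c1 : {for s, continuous (fun r => re (c s) + ga r * (r - s))}.
    apply: cvgD; first exact: cvg_cst.
    by apply: cvgM => //; apply: cvgD; [exact: cvg_id|exact: cvg_cst].
  have c2 : {for s, continuous (fun r => im (c s) + gb r * (r - s))}.
    apply: cvgD; first exact: cvg_cst.
    by apply: cvgM => //; apply: cvgD; [exact: cvg_id|exact: cvg_cst].
  have cE : c = (fun r => (re (c s) + ga r * (r - s)) +i* (im (c s) + gb r * (r - s))).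
    by apply/funext => r; rewrite -gaE -gbE; apply: cplx_eq; rewrite /= addrC subrK.
  by have := continuous_cplx c1 c2; rewrite -cE.
have cgc : {for s, continuous (fun r => g (c r))} by exact: (continuous_comp cc cg).
have cr : {for s, continuous (fun r => re (g (c r)))}.
  by apply: (continuous_comp cgc); exact: re_continuous.
have ci : {for s, continuous (fun r => im (g (c r)))}.
  by apply: (continuous_comp cgc); exact: im_continuous.
have D r : q (c r) - q (c s) = g (c r) * (c r - c s) by [].
split; apply/is_derive1_caratheodory.
- exists (fun r => re (g (c r)) * ga r - im (g (c r)) * gb r); split.
  + move=> r; rewrite -reN -reD D reM reD imD reN imN gaE gbE; ring.
  + by apply: cvgB; apply: cvgM.
  + by rewrite ga0 gb0 g0 reM.
- exists (fun r => re (g (c r)) * gb r + im (g (c r)) * ga r); split.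
  + move=> r; rewrite -imN -imD D imM reD imD reN imN gaE gbE; ring.
  + by apply: cvgD; apply: cvgM.
  + by rewrite ga0 gb0 g0 imM.
Qed.

Lemma cauchy_riemann q z : derivable q z 1 ->
  exists a b : R, forall v,
    has_pd v (fun w => re (q w)) z (if v then - b else a) /\
    has_pd v (fun w => im (q w)) z (if v then a else b).
Proof.
move=> hq; exists (re (derive1 q z)), (im (derive1 q z)) => v.
have hq' : derivable q (z + along v 0) 1 by rewrite along0.
have Hr : is_derive (0 : R) 1 (fun r => re (z + along v r)) (if v then 0 else 1).
  exact: (has_pd_re v z).
have Hi : is_derive (0 : R) 1 (fun r => im (z + along v r)) (if v then 1 else 0).
  exact: (has_pd_im v z).
have [] := holo_chain hq' Hr Hi; rewrite along0 reM imM.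
by case: v {hq' Hr Hi}; rewrite /= /has_pd ?(mulr0, mulr1, sub0r, subr0, add0r, addr0).
Qed.

Lemma holo_continuous q z : derivable q z 1 -> {for z, continuous q}.
Proof. by move=> h; apply: differentiable_continuous; apply/derivable1_diffP. Qed.

(** The parts of [q] are not known to be twice differentiable; all regularity comes from |q|^2. With
    l = ln |q|, the Cauchy-Riemann equations give q' = q (l_x - i l_y), which expresses the first
    partials of the parts of [q] through l and [q] itself and lifts them to class C^2. Symmetry of
    their mixed partials then forces l to be harmonic. *)
Lemma lap_ln_holo q U z : open U -> U z ->
  (forall w, U w -> derivable q w 1) ->
  (forall w, U w -> 0 < cmod (q w) ^+ 2) ->
  Cn 2 U (fun w => cmod (q w) ^+ 2) ->
  lap (fun w => ln (cmod (q w) ^+ 2)) z = 0.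
Proof.
move=> oU Uz hq f0 cf.
pose f w := cmod (q w) ^+ 2.
pose l w := 2^-1 * ln (f w).
pose u w := re (q w).
pose v w := im (q w).
have fE w : f w = u w * u w + v w * v w by rewrite /f cmod2E !expr2.
have cl : Cn 2 U l by apply: CnM => //; [exact: Cn_cst|exact: Cn_ln].
have cont w : U w -> {for w, continuous u} /\ {for w, continuous v}.
  by move=> /hq/holo_continuous cq; split; apply: (continuous_comp cq);
    [exact: re_continuous|exact: im_continuous].
pose lx := pd false l; pose ly := pd true l.
(* [A] and [B] are the real and imaginary parts of q (l_x - i l_y), to be identified with those of
   q'. *)
pose A w := lx w * u w + ly w * v w.
pose B w := lx w * v w - ly w * u w.
have D w : U w -> forall k : bool,
    has_pd k u w (if k then - B w else A w) /\ has_pd k v w (if k then A w else B w).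
  move=> Uw; have [a [b hab]] := cauchy_riemann (hq w Uw).
  have fw0 := f0 w Uw; have fw : f w != 0 by rewrite gt_eqF.
  have Hf k : has_pd k f w (if k then 2 * (v w * a - u w * b) else 2 * (u w * a + v w * b)).
    have [hu hv] := hab k.
    have := has_pdD (has_pdM hu hu) (has_pdM hv hv).
    have -> : (fun w => re (q w) * re (q w) + im (q w) * im (q w)) = f.
      by apply/funext => x; rewrite fE.
    by move=> H; apply: (has_pd_val H); case: (k); rewrite /u /v; ring.
  have Hl k : pd k l w = (if k then (v w * a - u w * b) else (u w * a + v w * b)) / f w.
    have := has_pdM (has_pd_cst k 2^-1 w) (has_pd_ln fw0 (Hf k)).
    by move=> /has_pdP[_ ->]; case: (k); field.
  have EA : A w = a.
    rewrite /A /lx /ly !Hl; have := fw; rewrite fE => fw'; by field.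
  have EB : B w = b.
    rewrite /B /lx /ly !Hl; have := fw; rewrite fE => fw'; by field.
  by move=> k; rewrite EA EB.
have clx : Cn 1 U lx by exact: (Cn_pd false cl).
have cly : Cn 1 U ly by exact: (Cn_pd true cl).
(* The partials of [u] and [v] are polynomials in [u], [v], [lx], [ly], so each pass gains one
   derivative, up to the limit set by [lx] and [ly] being of class C^1. *)
have boot k : Cn k U u -> Cn k U v -> (k <= 1)%N -> Cn k.+1 U u /\ Cn k.+1 U v.
  move=> cu cv k1; have clx' := Cn_le k1 clx; have cly' := Cn_le k1 cly.
  have cA : Cn k U A by apply: CnD => //; apply: CnM.
  have cB : Cn k U B by apply: CnB => //; apply: CnM.
  split.
  - apply: (@Cn_intro _ _ _ _ (fun k w => if k then - B w else A w)) => // [w Uw|k' w Uw|[]] //.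
    + by have [] := cont w Uw.
    + by have [] := D w Uw k'.
    + exact: CnN.
  - apply: (@Cn_intro _ _ _ _ (fun k w => if k then A w else B w)) => // [w Uw|k' w Uw|[]] //.
    + by have [] := cont w Uw.
    + by have [] := D w Uw k'.
have [cu1 cv1] : Cn 1 U u /\ Cn 1 U v.
  by apply: boot => //; apply/Cn0P => w /cont[].
have [cu cv] : Cn 2 U u /\ Cn 2 U v by apply: boot.
have lxy : pd true lx z = pd false ly z by exact: (mixed_partials oU Uz cl).
have Hx k : has_pd k lx z (pd k lx z) by exact: (Cn_has_pd k clx Uz).
have Hy k : has_pd k ly z (pd k ly z) by exact: (Cn_has_pd k cly Uz).
have Du k : has_pd k u z (if k then - B z else A z) by have [] := D z Uz k.
have Dv k : has_pd k v z (if k then A z else B z) by have [] := D z Uz k.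
have pA k : has_pd k A z _ := has_pdD (has_pdM (Hx k) (Du k)) (has_pdM (Hy k) (Dv k)).
have pB k : has_pd k B z _ :=
  has_pdD (has_pdM (Hx k) (Dv k)) (has_pdN (has_pdM (Hy k) (Du k))).
have Uu w : U w -> has_pd false u w (A w) by move=> Uw; have [] := D w Uw false.
have Uu' w : U w -> has_pd true u w (- B w) by move=> Uw; have [] := D w Uw true.
have Uv w : U w -> has_pd false v w (B w) by move=> Uw; have [] := D w Uw false.
have Uv' w : U w -> has_pd true v w (A w) by move=> Uw; have [] := D w Uw true.
have P2 k k' (g d : cplx R -> R) c : (forall w, U w -> has_pd k g w (d w)) ->
    has_pd k' d z c -> pd k' (pd k g) z = c.
  move=> hg hd; have E : {in U, d =1 pd k g}.
    by move=> w; rewrite inE => /hg /has_pdP[].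
  have [_ dc] := has_pdP hd.
  by rewrite (pd_eq oU E Uz) ?dc.
(* Everything cancels except v times the Laplacian of l here, and u times it in [M2]; u and v do not
   vanish together. *)
have M1 := mixed_partials oU Uz cu.
rewrite (P2 _ _ _ _ _ Uu (pA true)) (P2 _ _ _ _ _ Uu' (has_pdN (pB false))) in M1.
have M2 := mixed_partials oU Uz cv.
rewrite (P2 _ _ _ _ _ Uv (pB true)) (P2 _ _ _ _ _ Uv' (pA false)) in M2.
rewrite /= lxy in M1 M2.
pose L := pd false lx z + pd true ly z.
have E1 : v z * L = 0 by rewrite /L; move: M1; lra.
have E2 : u z * L = 0 by rewrite /L; move: M2; lra.
have L0 : L = 0.
  have : f z * L = 0 by rewrite fE mulrDl -!mulrA E1 E2 !mulr0 addr0.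
  by move=> /eqP; rewrite mulf_eq0 (gt_eqF (f0 z Uz)) /= => /eqP.
have El : lap l z = 0 by rewrite lapE.
move: El; rewrite /l (lapZ _ oU Uz); last exact: Cn_ln.
by move=> /eqP; rewrite mulf_eq0 invr_eq0 pnatr_eq0 /= => /eqP.
Qed.

(** * The squared distance and the three circles argument *)

Definition dist2 a w : R := (re w - re a) ^+ 2 + (im w - im a) ^+ 2.

Lemma dist2_ge0 a w : 0 <= dist2 a w.
Proof. by rewrite addr_ge0 ?sqr_ge0. Qed.

Lemma Cn_dist2 k U a : open U -> Cn k U (dist2 a).
Proof.
by move=> oU; apply: CnD => //; apply: CnX => //; apply: CnB => //;
  [exact: Cn_re|exact: Cn_cst|exact: Cn_im|exact: Cn_cst].
Qed.

Lemma dist2_continuous a : continuous (dist2 a).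
Proof. by move=> z; apply: (Cn_continuous (Cn_dist2 0 a openT)). Qed.

Lemma has_pd_dist2 v a z :
  has_pd v (dist2 a) z (if v then 2 * (im z - im a) else 2 * (re z - re a)).
Proof.
have h1 := has_pdD (has_pd_re v z) (has_pd_cst v (- re a) z).
have h2 := has_pdD (has_pd_im v z) (has_pd_cst v (- im a) z).
have := has_pdD (has_pdM h1 h1) (has_pdM h2 h2).
have -> : (fun w => (re w - re a) * (re w - re a) + (im w - im a) * (im w - im a)) = dist2 a.
  by apply/funext => w; rewrite /dist2 !expr2.
by move=> H; apply: (has_pd_val H); case: (v); ring.
Qed.

Lemma lap_dist2 a z : lap (dist2 a) z = 4.
Proof.
have E v : pd v (pd v (dist2 a)) z = 2.
  apply: (@pd2E _ setT _ (fun v z => if v then 2 * (im z - im a) else 2 * (re z - re a))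
    v z _ openT I) => [w _|]; first exact: has_pd_dist2.
  have h1 := has_pdD (has_pd_re v z) (has_pd_cst v (- re a) z).
  have h2 := has_pdD (has_pd_im v z) (has_pd_cst v (- im a) z).
  case: v h1 h2 => h1 h2.
    by have := has_pdM (has_pd_cst true 2 z) h2; rewrite addr0 mulr1 mulr0 addr0.
  by have := has_pdM (has_pd_cst false 2 z) h1; rewrite addr0 mulr1 mulr0 addr0.
rewrite lapE !E; ring.
Qed.

Lemma grad2_dist2 a z : grad2 (dist2 a) z = 4 * dist2 a z.
Proof.
rewrite /grad2 /dist2.
have [_ ->] := has_pdP (has_pd_dist2 false a z).
have [_ ->] := has_pdP (has_pd_dist2 true a z).
by rewrite /=; ring.
Qed.

Lemma open_dist2_gt a (r : R) : open [set w | r < dist2 a w].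
Proof.
by apply: (@open_comp _ _ (dist2 a) [set x | r < x]);
  [move=> w _; exact: dist2_continuous|exact: open_gt].
Qed.

Lemma open_dist2_lt a (r : R) : open [set w | dist2 a w < r].
Proof.
by apply: (@open_comp _ _ (dist2 a) [set x | x < r]);
  [move=> w _; exact: dist2_continuous|exact: open_lt].
Qed.

Lemma lap_ln_dist2 a z : 0 < dist2 a z -> lap (fun w => ln (dist2 a w)) z = 0.
Proof.
move=> z0; have oU := @open_dist2_gt a 0.
rewrite (@lap_ln _ _ _ _ oU)//; last exact: Cn_dist2.
by rewrite lap_dist2 grad2_dist2; field; rewrite gt_eqF.
Qed.

Definition disc a (r : R) : set (cplx R) := [set w | dist2 a w <= r ^+ 2].

Lemma disc_compact a r : 0 <= r -> compact (disc a r).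
Proof.
move=> r0; apply: (@subclosed_compact _ _ (cbox a r)).
- apply: (@closed_comp _ _ (dist2 a) [set x | x <= r ^+ 2]).
    by move=> w _; exact: dist2_continuous.
  exact: closed_le.
- exact: cbox_compact.
- move=> w; rewrite /disc /= /dist2 => h.
  by split; rewrite -(@ler_pXn2r _ 2) ?nnegrE ?normr_ge0// real_normK ?num_real//;
    apply: le_trans h; rewrite ?lerDl ?lerDr sqr_ge0.
Qed.

(* Maximum principle for [f / dist2 ^ N * exp dist2], whose logarithm is strictly
   subharmonic where [f > 0]; then let [N] tend to infinity. *)
Lemma three_circles q U a (r r' : R) : open U -> 0 < r -> disc a r' `<=` U ->
  (forall w, U w -> derivable q w 1) ->
  Cn 2 U (fun w => cmod (q w) ^+ 2) ->
  (forall w, dist2 a w < r ^+ 2 -> q w = 0) ->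
  forall w, dist2 a w < r' ^+ 2 -> 0 <= r' -> q w = 0.
Proof.
move=> oU r0 dU hq cf q0 z zr r'0.
pose f w := cmod (q w) ^+ 2.
have cmod0 w : (q w == 0) = (f w == 0).
  apply/eqP/eqP => [|]; rewrite /f cmod2E.
    by move=> ->; rewrite /= expr0n /= addr0.
  move=> /eqP; rewrite paddr_eq0 ?sqr_ge0// !sqrf_eq0 => /andP[/eqP h1 /eqP h2].
  exact: cplx_eq.
apply/eqP; rewrite cmod0; apply/negPn/negP => fz.
have f_ge0 w : 0 <= f w by rewrite /f sqr_ge0.
have fz0 : 0 < f z by rewrite lt_neqAle eq_sym fz f_ge0.
have f_inner w : 0 < f w -> r ^+ 2 <= dist2 a w.
  move=> fw; rewrite leNgt; apply/negP => /q0 /eqP; rewrite cmod0.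
  by rewrite gt_eqF.
have r20 : 0 < r ^+ 2 by rewrite exprn_gt0.
(* The inner cut at squared radius r^2 / 2 lies inside the disc where [q] vanishes: the logarithm is
   defined on [K], and a positive maximum stays away from the inner circle. *)
pose K := disc a r' `&` [set w | r ^+ 2 / 2 <= dist2 a w].
have cK : compact K.
  apply: (@subclosed_compact _ _ (disc a r')).
  - apply: closedI.
      apply: (@closed_comp _ _ (dist2 a) [set x | x <= r' ^+ 2]).
        by move=> w _; exact: dist2_continuous.
      exact: closed_le.
    apply: (@closed_comp _ _ (dist2 a) [set x | r ^+ 2 / 2 <= x]).
      by move=> w _; exact: dist2_continuous.
    exact: closed_ge.
  - exact: disc_compact.
  - by move=> w [].
have Kz : K z.
  split; first exact: ltW.
  by have := f_inner z fz0; rewrite /=; lra.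
pose V := U `&` [set w | 0 < dist2 a w].
have oV : open V by apply: openI => //; exact: open_dist2_gt.
have KV : K `<=` V.
  by move=> w [/dU Uw h]; split => //=; apply: lt_le_trans h; rewrite divr_gt0.
have VU : V `<=` U by move=> w [].
(* The first term has Laplacian 4 and makes the comparison strict; the second is harmonic off [a]
   and penalizes the outer circle as [N] grows. *)
pose E N w := dist2 a w - N * ln (dist2 a w).
have cE N k : Cn k V (E N).
  apply: CnB => //; first exact: Cn_dist2.
  apply: CnM => //; first exact: Cn_cst.
  by apply: Cn_ln => //; [move=> w []|exact: Cn_dist2].
pose G N w := f w * expR (E N w).
have cG N : Cn 2 V (G N).
  by apply: CnM => //; [exact: Cn_sub cf|exact: Cn_expR].
have within_K (g : cplx R -> R) : Cn 2 V g -> {within K, continuous g}.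
  move=> cg; apply: continuous_in_subspaceT => w; rewrite inE => /KV Vw.
  exact: (Cn_continuous cg).
have [m mK maxf] : exists2 m, m \in K & forall t, t \in K -> f t <= f m.
  apply: compact_EVT_max => //; first by exists z.
  by apply: within_K; exact: Cn_sub cf.
have main N : f z * expR (E N z) <= f m * expR (r' ^+ 2 - N * ln (r' ^+ 2)).
  have [c cKc maxG] : exists2 c, c \in K & forall t, t \in K -> G N t <= G N c.
    by apply: compact_EVT_max => //; [exists z|apply: within_K].
  have Gz : G N z <= G N c by apply: maxG; rewrite inE.
  apply: (le_trans Gz).
  have Gc : 0 < G N c by apply: lt_le_trans Gz; rewrite mulr_gt0 ?expR_gt0.
  have fc : 0 < f c by move: Gc; rewrite /G pmulr_lgt0// expR_gt0.
  have Kc : K c by rewrite -inE.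
  have [dc _] := Kc.
  have [cr|] := ltP (dist2 a c) (r' ^+ 2); last first.
    move=> cr; have -> : G N c = f c * expR (r' ^+ 2 - N * ln (r' ^+ 2)).
      by rewrite /G /E (@le_anti _ _ (dist2 a c) (r' ^+ 2)) // cr andbT.
    by rewrite ler_wpM2r ?expR_ge0// maxf.
  (* At a maximum inside the outer circle, [H], minus the logarithm of [G N], would have a local
     minimum although its Laplacian is -4. *)
  exfalso.
  pose W := V `&` [set w | 0 < f w].
  have oW : open W.
    rewrite openE => w [Vw fw]; apply: nbhsI.
      exact: open_nbhs_nbhs.
    have cfw : {for w, continuous f} by apply: (Cn_continuous cf); apply: VU.
    exact: near_gt0 cfw fw.
  have Wc : W c by split => //; exact: KV.
  have WV : W `<=` V by move=> ? [].
  have WU : W `<=` U by move=> w /WV/VU.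
  pose H w := - (ln (f w) + E N w).
  have clnf : Cn 2 W (fun w => ln (f w)).
    by apply: Cn_ln => //; [move=> w []|exact: Cn_sub cf].
  have cEW : Cn 2 W (E N) := Cn_sub WV (cE N 2%N).
  have c2 : Cn 2 W (dist2 a) by exact: Cn_dist2.
  have cln2 : Cn 2 W (fun w => ln (dist2 a w)).
    by apply: Cn_ln => // w [[]].
  have lapH : lap H c = - 4.
    rewrite /H (lapN oW Wc (CnD oW clnf cEW)) (lapD oW Wc clnf cEW).
    rewrite (@lap_ln_holo q W)//; last 3 first.
    - by move=> w /WU/hq.
    - by move=> w [].
    - exact: Cn_sub cf.
    rewrite /E (lapB oW Wc c2 (CnM oW (Cn_cst _ N oW) cln2)) (lapZ N oW Wc cln2).
    rewrite lap_dist2 lap_ln_dist2; first by ring.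
    by have [[]] := Wc.
  have cH : Cn 2 W H by apply: CnN => //; exact: CnD.
  have : 0 <= lap H c.
    apply: (lap_local_min oW Wc cH).
    have nW : nbhs c W by exact: open_nbhs_nbhs.
    have n1 : nbhs c [set w | r ^+ 2 / 2 < dist2 a w].
      apply: open_nbhs_nbhs; split; first exact: open_dist2_gt.
      by have := f_inner c fc; rewrite /=; lra.
    have n2 : nbhs c [set w | dist2 a w < r' ^+ 2].
      by apply: open_nbhs_nbhs; split; first exact: open_dist2_lt.
    apply: (nbhsS _ (nbhsI nW (nbhsI n1 n2))) => w [[Vw fw] [w1 w2]].
    rewrite /H lerN2.
    have : G N w <= G N c by apply: maxG; rewrite inE; split; exact: ltW.
    rewrite /G -{1}(@lnK _ (f w)) ?posrE// -(@lnK _ (f c)) ?posrE// -!expRD ler_expR.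
    by rewrite !lnK ?posrE.
  by rewrite lapH; lra.
have dz : 0 < dist2 a z by have := f_inner z fz0; lra.
pose d := ln (r' ^+ 2) - ln (dist2 a z).
have d0 : 0 < d by rewrite subr_gt0 ltr_ln ?posrE// (lt_trans dz).
have key N : f z * expR (N * d) <= f m * expR (r' ^+ 2 - dist2 a z).
  have := main N; rewrite /E => h.
  have := ler_wpM2r (expR_ge0 (N * ln (r' ^+ 2) - dist2 a z)) h.
  rewrite -!mulrA -!expRD.
  have -> : dist2 a z - N * ln (dist2 a z) + (N * ln (r' ^+ 2) - dist2 a z) = N * d.
    by rewrite /d; ring.
  by have -> : r' ^+ 2 - N * ln (r' ^+ 2) + (N * ln (r' ^+ 2) - dist2 a z) = r' ^+ 2 - dist2 a z by ring.
set C := f m * _ in key.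
(* For this [N], bounding the exponential below by 1 + N d turns [key] into f(z) + C <= C. *)
have := key (C / (f z * d)).
have h : 1 + C / (f z * d) * d <= expR (C / (f z * d) * d) by exact: expR_ge1Dx.
have := ler_wpM2l (ltW fz0) h.
have -> : f z * (1 + C / (f z * d) * d) = f z + C.
  by field; rewrite gt_eqF//= gt_eqF.
move=> h1 h2; have := le_trans h1 h2; lra.
Qed.

End Holomorphic.

(** * Monotonicity of the solutions *)

Section Charts.
Variables (R : realType) (S : topologicalType) (M : riemannSurface R S).
Implicit Types (i j : chart_index M) (x y : S) (z w : cplx R) (F : S -> R).

Lemma cod_param i z : cod i z -> dom i (param i z) /\ chart i (param i z) = z.
Proof. by case=> x ix <-; rewrite chartK. Qed.

Lemma cod_chart i x : dom i x -> cod i (chart i x).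
Proof. by move=> ix; exists x. Qed.

Lemma nbhs_chart i x (P : set (cplx R)) : dom i x ->
  nbhs (chart i x) P -> nbhs x [set y | dom i y /\ P (chart i y)].
Proof.
move=> ix h; apply: nbhsI; first by apply: open_nbhs_nbhs; split => //; exact: dom_open.
exact: (chart_continuous ix).
Qed.

Lemma nbhs_param i z (P : set S) : cod i z ->
  nbhs (param i z) P -> nbhs z [set w | cod i w /\ P (param i w)].
Proof.
move=> iz h; apply: nbhsI; first by apply: open_nbhs_nbhs; split => //; exact: cod_open.
exact: (param_continuous iz).
Qed.

Lemma smooth_Cn F i k : smooth_function M F -> Cn k (cod i) (fun z => F (param i z)).
Proof. by move=> h; rewrite CnE; exact: h. Qed.

Lemma smooth_continuous F : smooth_function M F -> continuous F.
Proof.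
move=> sF x; have ix := dom_chart_at M x; set i := chart_at M x in ix.
have c1 : {for x, continuous (fun y => F (param i (chart i y)))}.
  apply: (@continuous_comp _ _ _ (chart i) (fun z => F (param i z))).
    exact: chart_continuous.
  exact: (Cn_continuous (smooth_Cn i 0 sF) (cod_chart ix)).
apply: continuous_near_eq c1.
have : nbhs x (dom i) by apply: open_nbhs_nbhs; split => //; exact: dom_open.
by apply: nbhsS => y iy; rewrite chartK.
Qed.

Lemma smooth_functionB F G : smooth_function M F -> smooth_function M G ->
  smooth_function M (fun x => F x - G x).
Proof.
move=> hF hG i k; rewrite -CnE.
by apply: CnB; [exact: cod_open|exact: smooth_Cn|exact: smooth_Cn].
Qed.

Lemma lap_min_surface F i x : smooth_function M F -> dom i x ->
  (forall y, F x <= F y) -> 0 <= lap (fun z => F (param i z)) (chart i x).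
Proof.
move=> sF ix hx; apply: (lap_local_min (@cod_open _ _ M i) (cod_chart ix)).
  exact: smooth_Cn.
by apply: nbhs_all => w; rewrite chartK.
Qed.

Lemma surface_min F : compact [set: S] -> [set: S] !=set0 -> continuous F ->
  exists x, forall y, F x <= F y.
Proof.
move=> cS S0 cF.
have [x _ hx] := compact_EVT_min S0 cS (continuous_subspaceT cF).
by exists x => y; apply: hx; rewrite inE.
Qed.

End Charts.

(** * Comparison of two solutions of the system *)

Section System.
Variables (R : realType) (S : topologicalType) (M : riemannSurface R S).
Variable (sigma : conformalMetric M).
Implicit Types (q : quarticDifferential M) (i : chart_index M) (z : cplx R).

Lemma qd_norm2_ge0 q i z : 0 <= qd_norm2 sigma q i z.
Proof. by rewrite /qd_norm2 mulr_ge0 ?invr_ge0 ?exprn_even_ge0 ?sqr_ge0. Qed.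

Lemma qd_norm2_scale (t : R) q i z :
  qd_norm2 sigma (qd_scale t q) i z = t ^+ 2 * qd_norm2 sigma q i z.
Proof.
rewrite /qd_norm2 /= !cmod2E reM imM /= !mul0r subr0 addr0 !exprMn -mulrDr.
by rewrite mulrA.
Qed.

Variables (q q' : quarticDifferential M) (a1 a2 b1 b2 : S -> R).
Hypothesis Ha : maximal_surface_system sigma q a1 a2.
Hypothesis Hb : maximal_surface_system sigma q' b1 b2.

Let E1 x := expR (b1 x - b2 x) - expR (a1 x - a2 x).
Let E2 x := expR (2 * b2 x) - expR (2 * a2 x).
Let E3 i z := expR (- (2 * b1 (param i z))) * qd_norm2 sigma q' i z
  - expR (- (2 * a1 (param i z))) * qd_norm2 sigma q i z.

Let smooth_all : [/\ smooth_function M a1, smooth_function M a2,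
  smooth_function M b1 & smooth_function M b2].
Proof. by case: Ha => ? ? _; case: Hb. Qed.

(** The operator of the system is [lap] divided by 4 sigma, whence the factor. Both solutions carry
    the same curvature term, which cancels. *)
Lemma lap_system_diff i z : cod i z ->
  lap (fun w => b1 (param i w) - a1 (param i w)) z =
    4 * sigma i z * (E1 (param i z) - E3 i z) /\
  lap (fun w => b2 (param i w) - a2 (param i w)) z =
    4 * sigma i z * (E2 (param i z) - E1 (param i z)).
Proof.
move=> iz; have [sa1 sa2 sb1 sb2] := smooth_all.
have s0 : sigma i z != 0 by rewrite gt_eqF// density_gt0.
have oU := @cod_open _ _ M i.
have [_ _ /(_ i z iz) /= [h1 h2]] := Ha.
have [_ _ /(_ i z iz) /= [h3 h4]] := Hb.
move: h1 h2 h3 h4; rewrite /laplacian !eucl_laplacianE => h1 h2 h3 h4.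
have inv (L Q : R) : L / 4 / sigma i z = Q -> L = 4 * sigma i z * Q.
  by move=> <-; field.
rewrite (lapB oU iz (smooth_Cn i 2 sb1) (smooth_Cn i 2 sa1)).
rewrite (lapB oU iz (smooth_Cn i 2 sb2) (smooth_Cn i 2 sa2)).
by rewrite (inv _ _ h1) (inv _ _ h2) (inv _ _ h3) (inv _ _ h4) /E1 /E2 /E3; split; ring.
Qed.

Lemma lap_system_diff12 i z : cod i z ->
  lap (fun w => (b1 (param i w) - b2 (param i w)) - (a1 (param i w) - a2 (param i w))) z =
    4 * sigma i z * (2 * E1 (param i z) - E2 (param i z) - E3 i z).
Proof.
move=> iz; have [sa1 sa2 sb1 sb2] := smooth_all.
have oU := @cod_open _ _ M i.
have [h1 h2] := lap_system_diff iz.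
have -> : (fun w => (b1 (param i w) - b2 (param i w)) - (a1 (param i w) - a2 (param i w))) =
    (fun w => (b1 (param i w) - a1 (param i w)) - (b2 (param i w) - a2 (param i w))).
  by apply/funext => w; ring.
rewrite (lapB oU iz).
- by rewrite h1 h2; ring.
- exact: (smooth_Cn i 2 (smooth_functionB sb1 sa1)).
- exact: (smooth_Cn i 2 (smooth_functionB sb2 sa2)).
Qed.

Hypothesis S_compact : compact [set: S].

Let at_min F x : smooth_function M F -> (forall y, F x <= F y) ->
  let i := chart_at M x in let z := chart i x in
  [/\ cod i z, param i z = x, 0 < 4 * sigma i z & 0 <= lap (fun z => F (param i z)) z].
Proof.
move=> sF hx i z; have ix := dom_chart_at M x; split.
- exact: cod_chart.
- exact: chartK.
- by rewrite mulr_gt0// density_gt0//; exact: cod_chart.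
- exact: lap_min_surface.
Qed.

Let expR_sub_le0 (u v : R) : u <= v -> expR u - expR v <= 0.
Proof. by move=> h; rewrite subr_le0 ler_expR. Qed.

Let expR_sub_ge0 (u v : R) : v <= u -> 0 <= expR u - expR v.
Proof. by move=> h; rewrite subr_ge0 ler_expR. Qed.

(** Let A = b1 - a1 and B = b2 - a2. If the smaller of their two minima is negative and belongs to
    B, then E2 < 0 <= E1 there. If it belongs to A, then E1 <= 0 <= E3 there, which is only a weak
    contradiction; equality forces A = B at that point, so that B has its minimum there too and the
    first case applies. *)
Lemma system_mono :
  (forall i z, cod i z -> qd_norm2 sigma q i z <= qd_norm2 sigma q' i z) ->
  (forall x, a1 x <= b1 x) /\ (forall x, a2 x <= b2 x).
Proof.
move=> hn; have [sa1 sa2 sb1 sb2] := smooth_all.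
have [[x0]|S0] := pselect ([set: S] !=set0); last first.
  by split=> x; exfalso; apply: S0; exists x.
move=> _; have S0 : [set: S] !=set0 by exists x0.
have sA := smooth_functionB sb1 sa1; have sB := smooth_functionB sb2 sa2.
have [x hx] := surface_min S_compact S0 (smooth_continuous sA).
have [y hy] := surface_min S_compact S0 (smooth_continuous sB).
(* At a common minimum of both differences which is negative, the second
   equation has the wrong sign. *)
have Bmin u : (forall v, b2 u - a2 u <= b2 v - a2 v) ->
    b2 u - a2 u <= b1 u - a1 u -> 0 <= b2 u - a2 u.
  move=> hu ab; rewrite leNgt; apply/negP => neg.
  have [iz pz s0] := at_min sB hu.
  rewrite (lap_system_diff iz).2 pz pmulr_rge0//.
  have : 0 <= E1 u by apply: expR_sub_ge0; lra.
  have : E2 u < 0 by rewrite /E2 subr_lt0 ltr_expR; lra.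
  lra.
have Amin : b1 x - a1 x <= b2 y - a2 y -> 0 <= b1 x - a1 x.
  move=> xy; rewrite leNgt; apply/negP => neg.
  have ab : b1 x - a1 x <= b2 x - a2 x by apply: le_trans xy (hy x).
  have [iz pz s0] := at_min sA hx.
  rewrite (lap_system_diff iz).1 pz pmulr_rge0//.
  have e3 : 0 <= E3 (chart_at M x) (chart (chart_at M x) x).
    rewrite /E3 pz subr_ge0.
    apply: (@le_trans _ _ (expR (- (2 * b1 x)) * qd_norm2 sigma q (chart_at M x) (chart (chart_at M x) x))).
      by rewrite ler_wpM2r ?qd_norm2_ge0// ler_expR; lra.
    by rewrite ler_wpM2l ?expR_ge0// hn.
  have e1 : E1 x <= 0 by apply: expR_sub_le0; lra.
  (* The borderline case: equal exponentials give A = B at [x], and [x] becomes a minimum of B. *)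
  move=> h; have /eqP : E1 x = 0 by lra.
  rewrite subr_eq0 => /eqP /expR_inj h'.
  have H : 0 <= b2 x - a2 x.
    by apply: Bmin; [move=> v; apply: le_trans (hy v); lra|lra].
  lra.
have [xy|yx] := leP (b1 x - a1 x) (b2 y - a2 y).
  have h := Amin xy; split=> u.
    by rewrite -subr_ge0; exact: le_trans (hx u).
  by rewrite -subr_ge0; apply: le_trans (hy u); exact: le_trans xy.
have h : 0 <= b2 y - a2 y.
  by apply: Bmin => //; exact: le_trans (ltW yx) (hx y).
split=> u; rewrite -subr_ge0.
  by apply: le_trans (hx u); apply: le_trans (ltW yx).
exact: le_trans (hy u).
Qed.

(** The argument of [system_mono] with the roles exchanged and threshold [l]: where b1 - a1 exceeds
    [l], the factor e^(-2 b1) more than absorbs the gain e^(2 l) in the norm of the quartic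
    differential, so E3 <= 0. The second component is bounded by [l] along the way. *)
Lemma system_upper (l : R) : 0 < l ->
  (forall i z, cod i z -> qd_norm2 sigma q' i z = expR (2 * l) * qd_norm2 sigma q i z) ->
  forall x, b1 x - a1 x <= l.
Proof.
move=> l0 hn; have [sa1 sa2 sb1 sb2] := smooth_all.
move=> x0; have S0 : [set: S] !=set0 by exists x0.
have sA := smooth_functionB sa1 sb1; have sB := smooth_functionB sa2 sb2.
have lapN' i z (f g : S -> R) : smooth_function M f -> smooth_function M g -> cod i z ->
    lap (fun w => f (param i w) - g (param i w)) z =
    - lap (fun w => g (param i w) - f (param i w)) z.
  move=> sf sg iz; have oU := @cod_open _ _ M i.
  rewrite (lapB oU iz (smooth_Cn i 2 sf) (smooth_Cn i 2 sg)).
  by rewrite (lapB oU iz (smooth_Cn i 2 sg) (smooth_Cn i 2 sf)) opprB.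
have [x hx] := surface_min S_compact S0 (smooth_continuous sA).
have [y hy] := surface_min S_compact S0 (smooth_continuous sB).
have Bmin u : (forall v, a2 u - b2 u <= a2 v - b2 v) ->
    a2 u - b2 u <= a1 u - b1 u -> 0 <= l + (a2 u - b2 u).
  move=> hu ab; rewrite leNgt; apply/negP => neg.
  have [iz pz s0] := at_min sB hu.
  rewrite lapN'// (lap_system_diff iz).2 pz -mulrN pmulr_rge0//.
  have : E1 u <= 0 by apply: expR_sub_le0; lra.
  have : 0 < E2 u by rewrite /E2 subr_gt0 ltr_expR; lra.
  lra.
have Amin : a1 x - b1 x <= a2 y - b2 y -> 0 <= l + (a1 x - b1 x).
  move=> xy; rewrite leNgt; apply/negP => neg.
  have ab : a1 x - b1 x <= a2 x - b2 x by apply: le_trans xy (hy x).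
  have [iz pz s0] := at_min sA hx.
  rewrite lapN'// (lap_system_diff iz).1 pz -mulrN pmulr_rge0//.
  have e3 : E3 (chart_at M x) (chart (chart_at M x) x) <= 0.
    rewrite /E3 pz hn// subr_le0 mulrA -expRD.
    by rewrite ler_wpM2r ?qd_norm2_ge0// ler_expR; lra.
  have e1 : 0 <= E1 x by apply: expR_sub_ge0; lra.
  move=> h; have /eqP : E1 x = 0 by lra.
  rewrite subr_eq0 => /eqP /expR_inj h'.
  have H : 0 <= l + (a2 x - b2 x).
    by apply: Bmin; [move=> v; apply: le_trans (hy v); lra|lra].
  lra.
have h : 0 <= l + (a1 x - b1 x).
  have [xy|yx] := leP (a1 x - b1 x) (a2 y - b2 y); first exact: Amin.
  have := Bmin y hy (le_trans (ltW yx) (hx y)); lra.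
have := hx x0; lra.
Qed.

(** The Laplacian of the difference is a positive multiple of 2 E1 - E2 - E3. At a negative minimum
    E1 < 0, and the two assumptions are just the signs of E2 and E3 that make this a
    contradiction. *)
Lemma system_diff_mono :
  (forall x, a2 x <= b2 x) -> (forall i z, cod i z -> 0 <= E3 i z) ->
  forall x, a1 x - a2 x <= b1 x - b2 x.
Proof.
move=> h2 h3 x0; have [sa1 sa2 sb1 sb2] := smooth_all.
have S0 : [set: S] !=set0 by exists x0.
have sF := smooth_functionB (smooth_functionB sb1 sb2) (smooth_functionB sa1 sa2).
have [x hx] := surface_min S_compact S0 (smooth_continuous sF).
rewrite -subr_ge0; apply: le_trans (hx x0); rewrite leNgt; apply/negP => neg.
have [iz pz s0] := at_min sF hx.
rewrite lap_system_diff12// pz pmulr_rge0//.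
have e1 : E1 x < 0 by rewrite /E1 subr_lt0 ltr_expR; lra.
have e2 : 0 <= E2 x by apply: expR_sub_ge0; have := h2 x; lra.
have := h3 _ _ iz; lra.
Qed.

End System.

Section Family.
Variables (R : realType) (S : topologicalType) (M : riemannSurface R S).
Variable (sigma : conformalMetric M).
Variable (q : quarticDifferential M).
Hypothesis S_compact : compact [set: S].
Variables psi1 psi2 : R -> S -> R.
Hypothesis psi_solution : forall t : R, 0 <= t ->
  maximal_surface_system sigma (qd_scale t q) (psi1 t) (psi2 t).

Lemma qd_scale_norm_le (s t : R) i z : 0 <= s -> s <= t ->
  qd_norm2 sigma (qd_scale s q) i z <= qd_norm2 sigma (qd_scale t q) i z.
Proof.
move=> s0 st; rewrite !qd_norm2_scale ler_wpM2r ?qd_norm2_ge0//.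
by rewrite ler_pXn2r ?nnegrE// (le_trans s0).
Qed.

Lemma psi_mono (s t : R) x : 0 <= s -> s <= t ->
  psi1 s x <= psi1 t x /\ psi2 s x <= psi2 t x.
Proof.
move=> s0 st; have [h1 h2] := system_mono (psi_solution s0) (psi_solution (le_trans s0 st))
  S_compact (fun i z _ => qd_scale_norm_le i z s0 st).
by split.
Qed.

(** [system_upper] with l = ln (t / s) bounds psi1(t) - psi1(s); this is the inequality e^(-2
    psi1(s)) s^2 <= e^(-2 psi1(t)) t^2 needed for E3. *)
Lemma psi_diff_mono (s t : R) x : 0 <= s -> s <= t ->
  psi1 s x - psi2 s x <= psi1 t x - psi2 t x.
Proof.
move=> s0 st; have t0 := le_trans s0 st.
apply: (system_diff_mono (psi_solution s0) (psi_solution t0) S_compact).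
  by move=> y; have [] := psi_mono y s0 st.
move=> i z iz; rewrite !qd_norm2_scale.
move: st; rewrite le_eqVlt => /predU1P[<-|st]; first by rewrite subrr.
(* The logarithm requires s > 0; for s = 0 the subtracted term of E3 vanishes. *)
move: s0; rewrite le_eqVlt => /predU1P[<-|s0].
  by rewrite expr0n /= mul0r mulr0 subr0 mulr_ge0 ?expR_ge0// mulr_ge0 ?sqr_ge0// qd_norm2_ge0.
have t0' : 0 < t by exact: lt_trans st.
pose l := ln t - ln s.
have l0 : 0 < l by rewrite subr_gt0 ltr_ln.
have El : expR (2 * l) * s ^+ 2 = t ^+ 2.
  by rewrite mulrC [2 * l]mulrDr expRD mulrN expRN !expRM_natl !lnK ?posrE//;
     field; rewrite gt_eqF.
have := system_upper (psi_solution (ltW s0)) (psi_solution t0) S_compact l0 _ (param i z).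
move=> /(_ _)H; have {}H : psi1 t (param i z) - psi1 s (param i z) <= l.
  by apply: H => j w _; rewrite !qd_norm2_scale mulrA El.
have n0 := qd_norm2_ge0 sigma q i z; set n := qd_norm2 sigma q i z in n0 *.
have -> : expR (- (2 * psi1 t (param i z))) * (t ^+ 2 * n) =
    expR (- (2 * psi1 t (param i z)) + 2 * l) * (s ^+ 2 * n).
  by rewrite -El expRD; ring.
rewrite subr_ge0 ler_wpM2r ?(mulr_ge0 (sqr_ge0 s))// ler_expR; lra.
Qed.

End Family.

(** * Blow-up of the conformal factor *)

Lemma pinfty_exists (R : realType) (P : set R) :
  (\forall t \near +oo, P t) -> exists2 t, 0 <= t & P t.
Proof.
move=> [m [_ h]]; exists (Num.max 0 (m + 1)); first by rewrite le_max lexx.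
by apply: h; rewrite lt_max; apply/orP; right; rewrite ltrDl.
Qed.

Lemma disc_sub_cbox (R : realType) (a : cplx R) (r : R) : 0 <= r -> disc a r `<=` cbox a r.
Proof.
move=> r0 w; rewrite /disc /= /dist2 => h.
by split; rewrite -(@ler_pXn2r _ 2) ?nnegrE ?normr_ge0// real_normK ?num_real//;
  apply: le_trans h; rewrite ?lerDl ?lerDr sqr_ge0.
Qed.

Lemma box_dist2 (R : realType) (z w : cplx R) (e : R) : 0 < e -> box z e w ->
  dist2 w z < 2 * e ^+ 2.
Proof.
move=> e0 [h1 h2]; rewrite /dist2.
have s (x : R) : `|x| < e -> x ^+ 2 < e ^+ 2.
  by move=> xe; rewrite -(real_normK (num_real x)) ltr_pXn2r ?nnegrE// ltW.
have := ltrD (s _ h1) (s _ h2); lra.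
Qed.

Section Blowup.
Variables (R : realType) (S : topologicalType) (M : riemannSurface R S).
Variable (sigma : conformalMetric M).
Variable (q : quarticDifferential M).
Hypothesis S_compact : compact [set: S].
Variables psi1 psi2 : R -> S -> R.
Hypothesis psi_solution : forall t : R, 0 <= t ->
  maximal_surface_system sigma (qd_scale t q) (psi1 t) (psi2 t).
Implicit Types (i : chart_index M) (z w : cplx R) (t : R) (x : S).

Definition growth t x : R := (psi1 t x - psi2 t x) - (psi1 0 x - psi2 0 x).

Lemma smooth_psi t : 0 <= t -> smooth_function M (psi1 t) /\ smooth_function M (psi2 t).
Proof. by move=> /psi_solution[]. Qed.

Lemma growth_smooth t : 0 <= t -> smooth_function M (growth t).
Proof.
move=> t0; have [? ?] := smooth_psi t0; have [? ?] := smooth_psi (lexx 0).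
by apply: smooth_functionB; exact: smooth_functionB.
Qed.

Lemma growth_continuous t : 0 <= t -> continuous (growth t).
Proof. by move=> t0; apply: smooth_continuous; exact: growth_smooth. Qed.

Lemma growth_ge0 t x : 0 <= t -> 0 <= growth t x.
Proof.
move=> t0; rewrite subr_ge0.
exact: (psi_diff_mono S_compact psi_solution x (lexx 0) t0).
Qed.

Lemma growth_mono s t x : 0 <= s -> s <= t -> growth s x <= growth t x.
Proof.
move=> s0 st; rewrite lerB//.
exact: (psi_diff_mono S_compact psi_solution x s0 st).
Qed.

Definition factor0 x : R := expR (psi1 0 x - psi2 0 x).

Lemma lap_growth t i z : 0 <= t -> cod i z ->
  lap (fun w => growth t (param i w)) z =
  4 * sigma i z * (2 * factor0 (param i z) * (expR (growth t (param i z)) - 1)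
    - (expR (2 * psi2 t (param i z)) - expR (2 * psi2 0 (param i z)))
    - expR (- (2 * psi1 t (param i z))) * (t ^+ 2 * qd_norm2 sigma q i z)).
Proof.
move=> t0 iz; rewrite (lap_system_diff12 (psi_solution (lexx 0)) (psi_solution t0) iz).
rewrite !qd_norm2_scale expr0n /= mul0r mulr0 subr0.
have hE : expR (psi1 t (param i z) - psi2 t (param i z)) =
    factor0 (param i z) * expR (growth t (param i z)).
  by rewrite /factor0 /growth -expRD; congr expR; ring.
by rewrite hE -/(factor0 _); ring.
Qed.

(** Only terms of favourable sign are dropped: psi2 increases with [t], and the quartic term is
    nonnegative. The coefficient does not depend on [t], and the bound holds at zeros of [q] as
    well. *)
Lemma lap_growth_le t i z : 0 <= t -> cod i z ->
  lap (fun w => growth t (param i w)) z <=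
  8 * sigma i z * factor0 (param i z) * expR (growth t (param i z)).
Proof.
move=> t0 iz; rewrite lap_growth//.
set x := param i z.
have s0 : 0 < sigma i z by exact: density_gt0.
have -> : 8 * sigma i z * factor0 x * expR (growth t x) =
    4 * sigma i z * (2 * factor0 x * expR (growth t x)) by ring.
rewrite ler_pM2l ?mulr_gt0//.
have : 0 <= expR (- (2 * psi1 t x)) * (t ^+ 2 * qd_norm2 sigma q i z).
  by rewrite mulr_ge0 ?expR_ge0// mulr_ge0 ?sqr_ge0// qd_norm2_ge0.
have : expR (2 * psi2 0 x) <= expR (2 * psi2 t x).
  have [_ h] := psi_mono S_compact psi_solution x (lexx 0) t0.
  by rewrite ler_expR; lra.
have : 0 < factor0 x by exact: expR_gt0.
lra.
Qed.

Lemma q_continuous i z : cod i z -> {for z, continuous (fun w => cmod (q i w) ^+ 2)}.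
Proof.
move=> iz; have cq := holo_continuous (@qcoef_holomorphic _ _ _ q i z iz).
have -> : (fun w => cmod (q i w) ^+ 2) =
    (fun w => re (q i w) * re (q i w) + im (q i w) * im (q i w)).
  by apply/funext => w; rewrite cmod2E !expr2.
have c1 : {for z, continuous (fun w => re (q i w))}.
  by apply: (continuous_comp cq); exact: re_continuous.
have c2 : {for z, continuous (fun w => im (q i w))}.
  by apply: (continuous_comp cq); exact: im_continuous.
by apply: continuousD; apply: continuousM.
Qed.

Lemma density_Cn i k : Cn k (cod i) (sigma i).
Proof. by rewrite CnE; exact: density_smooth. Qed.

Lemma density_continuous i z : cod i z -> {for z, continuous (sigma i)}.
Proof. by move=> iz; exact: (Cn_continuous (density_Cn i 0) iz). Qed.

Lemma qd_norm2_continuous i z : cod i z -> {for z, continuous (qd_norm2 sigma q i)}.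
Proof.
move=> iz; apply: (continuousM (q_continuous iz)).
apply: continuousV; first by rewrite expf_neq0// gt_eqF// density_gt0.
exact: (Cn_continuous (CnX 4 (@cod_open _ _ M i) (density_Cn i 0)) iz).
Qed.

Lemma param_comp_continuous (F : S -> R) i z : continuous F -> cod i z ->
  {for z, continuous (fun w => F (param i w))}.
Proof. by move=> cF iz; apply: (continuous_comp (param_continuous iz)); exact: cF. Qed.

Lemma factor0_continuous : continuous factor0.
Proof.
have [s1 s2] := smooth_psi (lexx 0).
have c := smooth_continuous (smooth_functionB s1 s2).
by move=> x; apply: (continuous_comp (c x)); exact: continuous_expR.
Qed.

(* A nonnegative function bounded by [L] at the centre of a disc, plus a paraboloid
   exceeding [L] on the boundary, has an interior minimum. *)
Lemma growth_unbounded_nonzero i z : cod i z -> q i z != 0 ->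
  forall L : R, exists2 t, 0 <= t & L < growth t (param i z).
Proof.
move=> iz qz L; apply: contrapT => Hn.
have HL t : 0 <= t -> growth t (param i z) <= L.
  by move=> t0; rewrite leNgt; apply/negP => h; apply: Hn; exists t.
have L0 : 0 <= L by apply: le_trans (HL 0 (lexx 0)); exact: growth_ge0.
pose n0 := qd_norm2 sigma q i z.
have n00 : 0 < n0.
  rewrite /n0 /qd_norm2; apply: divr_gt0; last by rewrite exprn_gt0// density_gt0.
  rewrite lt_neqAle eq_sym sqr_ge0 andbT.
  apply: contra qz => /eqP h; apply/eqP; apply: cplx_eq;
    move: h; rewrite cmod2E => /eqP; rewrite paddr_eq0 ?sqr_ge0// !sqrf_eq0 => /andP[/eqP ? /eqP ?] //.
pose s0 := sigma i z; have s00 : 0 < s0 by exact: density_gt0.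
pose H := 2 * factor0 (param i z); have H0 : 0 < H by rewrite mulr_gt0// expR_gt0.
pose P := 2 * expR (2 * psi2 0 (param i z)).
have P0 : 0 < P by rewrite mulr_gt0// expR_gt0.
have near_bounds : \forall w \near z, [/\ cod i w, n0 / 2 < qd_norm2 sigma q i w,
    s0 / 2 < sigma i w, factor0 (param i w) < H & expR (2 * psi2 0 (param i w)) < P].
  have d (F : cplx R -> R) e : {for z, continuous F} -> 0 < e ->
    \forall w \near z, `|F z - F w| < e by exact: continuous_dist_lt.
  have n02 : 0 < n0 / 2 by rewrite divr_gt0.
  have s02 : 0 < s0 / 2 by rewrite divr_gt0.
  have h1 := d _ _ (qd_norm2_continuous iz) n02.
  have h2 := d _ _ (density_continuous iz) s02.
  have h3 := d _ _ (param_comp_continuous factor0_continuous iz) (expR_gt0 (psi1 0 (param i z) - psi2 0 (param i z))).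
  have [_ sp] := smooth_psi (lexx 0).
  have cp : {for z, continuous (fun w => expR (2 * psi2 0 (param i w)))}.
    apply: (@Cn_continuous _ 0 (cod i)) => //.
    apply: Cn_expR; first exact: cod_open.
    apply: CnM; [exact: cod_open|apply: Cn_cst; exact: cod_open|exact: smooth_Cn].
  have h4 := d _ _ cp (expR_gt0 (2 * psi2 0 (param i z))).
  have h5 : \forall w \near z, cod i w.
    by apply: open_nbhs_nbhs; split => //; exact: cod_open.
  apply: (nbhsS _ (nbhsI h5 (nbhsI h1 (nbhsI h2 (nbhsI h3 h4))))).
  move=> w [w5 [w1 [w2 [w3 w4]]]]; move: w1 w2 w3 w4.
  rewrite !ltr_norml /n0 /s0 /H /P /= -/(factor0 (param i z)).
  move=> /andP[_ w1] /andP[_ w2] /andP[w3 _] /andP[w4 _]; split => //; lra.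
have [e e0 eb] := (nbhs_boxP _ _).1 near_bounds.
pose r := e / 2; have r0 : 0 < r by rewrite divr_gt0.
have db : disc z r `<=` box z e.
  by apply: subset_trans (disc_sub_cbox (ltW r0)) _; apply: cbox_sub_box; rewrite /r; lra.
(* The paraboloid reaches L + 1 on the boundary circle, above the value at the centre, which is at
   most [L]. *)
pose B := (L + 1) / r ^+ 2.
have r20 : 0 < r ^+ 2 by rewrite exprn_gt0.
have B0 : 0 < B by rewrite divr_gt0//; lra.
have BrL : B * r ^+ 2 = L + 1 by rewrite /B divfK// gt_eqF.
pose H1 := H * expR L; have H10 : 0 < H1 by rewrite mulr_gt0// expR_gt0.
pose m := Num.sqrt (n0 / 2).
have m0 : 0 < m by rewrite sqrtr_gt0 divr_gt0.
have m2 : m ^+ 2 = n0 / 2 by rewrite sqr_sqrtr// ltW// divr_gt0.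
(* [X] makes 4 sigma X at least 4 (B + 1), more than the Laplacian 4 B of the paraboloid. Then [t]
   solves 2 t m / H1 = 2 H1 + P + X, where [m] bounds |q| / sigma^2 from below and [H1] bounds
   e^(psi1 - psi2) at the minimum. *)
pose X := 2 * (B + 1) / s0.
have X0 : 0 < X by rewrite divr_gt0// mulr_gt0//; lra.
pose t := (2 * H1 + P + X) * H1 / (2 * m).
have t0 : 0 <= t.
  by apply: divr_ge0; [apply: mulr_ge0; [lra|exact: ltW]|rewrite mulr_ge0// ltW].
have tE : 2 * t * m / H1 = 2 * H1 + P + X.
  by rewrite /t; field; rewrite !gt_eqF.
pose F w := growth t (param i w) + B * dist2 z w.
have oU := @cod_open _ _ M i.
have cg : Cn 2 (cod i) (fun w => growth t (param i w)).
  by apply: smooth_Cn; exact: growth_smooth.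
have cB : Cn 2 (cod i) (fun w => B * dist2 z w).
  by apply: CnM => //; [exact: Cn_cst|exact: Cn_dist2].
have cF : Cn 2 (cod i) F by apply: CnD.
have dU : disc z r `<=` cod i by move=> w /db /eb [].
have dz : disc z r z by rewrite /disc /= /dist2 !subrr expr0n /= addr0 ltW.
have [c cd hc] : exists2 c, c \in disc z r & forall w, w \in disc z r -> F c <= F w.
  apply: compact_EVT_min; [by exists z|exact: disc_compact (ltW r0)|].
  apply: continuous_in_subspaceT => w; rewrite inE => /dU iw.
  exact: (Cn_continuous cF).
have Fz : F z <= L.
  by rewrite /F /dist2 !subrr expr0n /= addr0 mulr0 addr0 HL.
have Fc : F c <= L by apply: le_trans Fz; apply: hc; rewrite inE.
have dc : disc z r c by rewrite -inE.
have gc : 0 <= growth t (param i c) by exact: growth_ge0.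
have cr : dist2 z c < r ^+ 2.
  rewrite ltNge; apply/negP => h; have := ler_wpM2l (ltW B0) h.
  rewrite BrL; move: Fc; rewrite /F; lra.
have ic := dU _ dc.
have : 0 <= lap F c.
  apply: (lap_local_min oU ic cF).
  have n1 : nbhs c [set w | dist2 z w < r ^+ 2].
    by apply: open_nbhs_nbhs; split; first exact: open_dist2_lt.
  by apply: nbhsS n1 => w /ltW h; apply: hc; rewrite inE.
rewrite /F (lapD oU ic cg cB) (lapZ B oU ic); last exact: Cn_dist2.
rewrite lap_dist2 lap_growth//.
have [_ b1 b2 b3 b4] := eb _ (db _ dc).
set x := param i c in Fc gc b3 b4 *.
have uL : growth t x <= L.
  have : 0 <= B * dist2 z c by exact: mulr_ge0 (ltW B0) (dist2_ge0 z c).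
  move: Fc; rewrite /F -/x; lra.
have ht : factor0 x * expR (growth t x) <= H1.
  by rewrite /H1 ler_pM ?expR_ge0 ?ler_expR// ltW.
(* Arithmetic-geometric mean: the product of the two terms depends on the solution only through psi1
   - psi2, which [ht] bounds above. *)
have am : 2 * t * m / H1 <= expR (2 * psi2 t x) +
    expR (- (2 * psi1 t x)) * (t ^+ 2 * qd_norm2 sigma q i c).
  apply: (@le_trans _ _ (2 * (expR (psi2 t x) * (t * m * expR (- psi1 t x))))).
    have -> : expR (psi2 t x) * (t * m * expR (- psi1 t x)) = t * m * (factor0 x * expR (growth t x))^-1.
      have -> : factor0 x * expR (growth t x) = expR (psi1 t x - psi2 t x).
        by rewrite /factor0 /growth -expRD; congr expR; ring.
      rewrite -expRN mulrCA -expRD; congr (_ * expR _); ring.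
    have -> : 2 * t * m / H1 = 2 * (t * m * H1^-1) by ring.
    have tm : 0 <= t * m := mulr_ge0 t0 (ltW m0).
    rewrite ler_pM2l//; apply: (ler_wpM2l tm); rewrite lef_pV2 ?posrE//.
    by rewrite mulr_gt0// expR_gt0.
  have -> : 2 * psi2 t x = psi2 t x + psi2 t x by ring.
  have -> : - (2 * psi1 t x) = - psi1 t x + - psi1 t x by ring.
  rewrite !expRD.
  apply: (@le_trans _ _ (expR (psi2 t x) * expR (psi2 t x) +
     expR (- psi1 t x) * expR (- psi1 t x) * (t ^+ 2 * m ^+ 2))).
    have := sqr_ge0 (expR (psi2 t x) - t * m * expR (- psi1 t x)); lra.
  rewrite lerD2l ler_wpM2l ?mulr_ge0 ?expR_ge0// ler_wpM2l ?sqr_ge0// m2 ltW//.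
have sc : 0 < sigma i c by exact: density_gt0.
set Y := (_ - _ - _); have Yle : Y <= - X.
  rewrite /Y; have : 0 < factor0 x by exact: expR_gt0.
  move: tE am ht; lra.
have : 4 * sigma i c * Y <= 4 * sigma i c * (- X) by rewrite ler_pM2l// mulr_gt0.
have : 4 * (s0 / 2) * X <= 4 * sigma i c * X by rewrite ler_pM2r// ler_pM2l// ltW.
have -> : 4 * (s0 / 2) * X = 4 * (B + 1) by rewrite /X; field; rewrite gt_eqF.
lra.
Qed.

(** By continuity a bound exceeded at one point is exceeded nearby at the same time [s], and by
    monotonicity it remains exceeded later. Compactness then makes the time uniform. *)
Lemma growth_dini (K : set S) : compact K ->
  (forall x, K x -> forall L : R, exists2 t, 0 <= t & L < growth t x) ->
  forall L : R, \forall t \near +oo, forall x, K x -> L < growth t x.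
Proof.
move=> /compact_near_coveringP cK hK L.
have := cK R (pinfty_nbhs R) (fun t x => L < growth t x) _; apply.
move=> x Kx; have [s s0 hs] := hK x Kx L.
have ns : nbhs x [set y | 0 < growth s y - L].
  apply: (@near_gt0 _ _ (fun y => growth s y - L)); last by rewrite subr_gt0.
  by apply: cvgD; [exact: growth_continuous|exact: cvg_cst].
exists ([set y | 0 < growth s y - L], [set t | s < t]); first split => //=.
  by exists s; split; [exact: num_real|].
move=> [y t] [/= h1 h2]; apply: (@lt_le_trans _ _ (growth s y)); first by rewrite -subr_gt0.
by apply: growth_mono => //; exact: ltW.
Qed.

(** In the difference of the first equations for t = 1 and t = 0 the quartic term occurs once,
    multiplied by a positive smooth function. Solving for |q|^2 expresses it by sigma, the solutions
    and their derivatives; this is [f]. *)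
Lemma q_norm_Cn i k : Cn k (cod i) (fun w => cmod (q i w) ^+ 2).
Proof.
have oU := @cod_open _ _ M i.
have [s1 s2] := smooth_psi ler01; have [s3 s4] := smooth_psi (lexx 0).
pose u w := psi1 1 (param i w) - psi1 0 (param i w).
pose E w := expR (psi1 1 (param i w) - psi2 1 (param i w)) -
            expR (psi1 0 (param i w) - psi2 0 (param i w)).
pose f w := expR (2 * psi1 1 (param i w)) * sigma i w ^+ 4 *
  (E w - lap u w * (4 * sigma i w)^-1).
have sC n : Cn n (cod i) (sigma i) by exact: density_Cn.
apply: (@Cn_ext _ k (cod i) f) => //.
  move=> z; rewrite inE => iz.
  have := (lap_system_diff (psi_solution (lexx 0)) (psi_solution ler01) iz).1.
  rewrite !qd_norm2_scale expr0n expr1n /= mul0r mulr0 subr0 mul1r => h.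
  rewrite /f /u h /E /qd_norm2.
  have sz : sigma i z != 0 by rewrite gt_eqF// density_gt0.
  rewrite expRN; field; rewrite sz /=.
  by rewrite gt_eqF// expR_gt0.
apply: CnM => //.
  apply: CnM => //; last exact: CnX.
  by apply: Cn_expR => //; apply: CnM => //; [exact: Cn_cst|exact: smooth_Cn].
apply: CnB => //.
  by apply: CnB => //; apply: Cn_expR => //; apply: CnB => //; exact: smooth_Cn.
apply: CnM => //.
  have -> : lap u = (fun w => pd false (pd false u) w + pd true (pd true u) w).
    by apply/funext => w; rewrite lapE.
  have cu : Cn k.+2 (cod i) u by exact: (smooth_Cn i k.+2 (smooth_functionB s1 s3)).
  by apply: CnD => //; apply: Cn_pd; apply: Cn_pd.
apply: CnV => //; last by apply: CnM => //; exact: Cn_cst.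
by move=> z iz; rewrite gt_eqF// mulr_gt0// density_gt0.
Qed.

Hypothesis S_connected : connected [set: S].
Hypothesis q_nonzero : qd_nonzero q.

Lemma q_zero_chart i j x : dom i x -> dom j x ->
  q j (chart j x) = 0 -> q i (chart i x) = 0.
Proof.
move=> ix jx h; have o : overlap i j (chart i x) by exists x.
by rewrite (qcoef_transition q o) /transition chartK// h mul0r.
Qed.

(** The identity theorem: the interior of the zero set is open, and closed because [three_circles]
    enlarges a small disc of zeros to one of controlled size. By connectedness it would be all of
    [S]. *)
Lemma q_zero_nowhere_dense i z (P : set (cplx R)) : cod i z -> nbhs z P ->
  exists2 a, P a & cod i a /\ q i a != 0.
Proof.
move=> iz zP; apply: contrapT => Hn.
pose Z := [set x : S | q (chart_at M x) (chart (chart_at M x) x) = 0].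
have ZE j x : dom j x -> Z x <-> q j (chart j x) = 0.
  move=> jx; split; apply: q_zero_chart => //; exact: dom_chart_at.
have oZ : open (interior Z) by exact: open_interior.
have cZ : closed (interior Z).
  move=> x clx; pose j := chart_at M x; have jx : dom j x := dom_chart_at M x.
  have [e e0 eU] := open_boxP (@cod_open _ _ M j) (cod_chart jx).
  (* With [a] this close to chart j x, the disc of radius e / 2 about [a] stays in the box of
     half-width [e] and still contains chart j x, since 2 (e / 8)^2 < (e / 2)^2. *)
  have e80 : 0 < e / 8 by rewrite divr_gt0.
  have [y [Zy [jy yb]]] := clx _ (nbhs_chart jx (nbhs_box (chart j x) e80)).
  set a := chart j y in yb.
  have ja : cod j a by exact: cod_chart.
  have : nbhs a [set w | cod j w /\ Z (param j w)].
    by apply: nbhs_param => //; rewrite /a chartK.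
  move=> /nbhs_boxP[r1 r10 hr1].
  pose r := r1 / 2; have r0 : 0 < r by rewrite divr_gt0.
  pose r' := e / 2; have r'0 : 0 <= r' by rewrite divr_ge0// ltW.
  have TC w : dist2 a w < r' ^+ 2 -> q j w = 0.
    move=> hw; apply: (@three_circles _ (q j) (cod j) a r r') => //.
    - exact: cod_open.
    - apply: subset_trans eU => v /(disc_sub_cbox r'0)[v1 v2].
      have [y1 y2] := yb; split.
        rewrite -(subrKA (re a)); apply: le_lt_trans (ler_normD _ _) _.
        move: v1 y1; rewrite /r'; lra.
      rewrite -(subrKA (im a)); apply: le_lt_trans (ler_normD _ _) _.
      move: v2 y2; rewrite /r'; lra.
    - by move=> v; exact: qcoef_holomorphic.
    - exact: q_norm_Cn.
    - move=> v hv; have vb : box a r1 v.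
        apply: (@cbox_sub_box _ a r); first by rewrite /r; lra.
        by apply: disc_sub_cbox; [exact: ltW|exact: ltW].
      have [jv Zv] := hr1 _ vb; have [dv cv] := cod_param jv.
      by have := (ZE j _ dv).1 Zv; rewrite cv.
  have n1 : nbhs (chart j x) [set w | dist2 a w < r' ^+ 2].
    apply: open_nbhs_nbhs; split; first exact: open_dist2_lt.
    have := box_dist2 e80 yb; rewrite /= /r'.
    have : 0 < e ^+ 2 by rewrite exprn_gt0.
    have -> : (e / 8) ^+ 2 = e ^+ 2 / 64 by field.
    have -> : (e / 2) ^+ 2 = e ^+ 2 / 4 by field.
    lra.
  apply: nbhsS (nbhs_chart jx n1) => v [jv hv].
  by apply/(ZE j) => //; exact: TC.
have x0Z : interior Z (param i z).
  apply: nbhsS (nbhs_chart (cod_param iz).1 _) => [y|]; last first.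
    by rewrite (cod_param iz).2; exact: zP.
  move=> [iy Py]; apply/(ZE i) => //; apply: contrapT => /eqP h.
  by apply: Hn; exists (chart i y) => //; split => //; exact: cod_chart.
have ZT : interior Z = setT.
  apply: S_connected; first by exists (param i z).
    by exists (interior Z) => //; rewrite setTI.
  by exists (interior Z) => //; rewrite setTI.
have [j [w [jw]]] := q_nonzero; move=> /eqP; apply.
have [dw cw] := cod_param jw.
have : interior Z (param j w) by rewrite ZT.
by move=> /interior_subset /(ZE j _ dw); rewrite cw.
Qed.

(* Compare with the barrier [- ln r + C + r] in the distance [r] to a nearby nonzero
   of [q]: its Laplacian [1 / r] makes it a subsolution. *)
Lemma growth_unbounded x : forall L : R, exists2 t, 0 <= t & L < growth t x.
Proof.
move=> L; pose i := chart_at M x; have ix : dom i x := dom_chart_at M x.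
pose z := chart i x; have iz : cod i z := cod_chart ix.
have xE : param i z = x by rewrite /z chartK.
have [qz|qz] := boolP (q i z == 0); last first.
  by rewrite -xE; exact: growth_unbounded_nonzero.
have oU := @cod_open _ _ M i.
have [e e0 eU] := open_boxP oU iz.
pose r := e / 4; have r0 : 0 < r by rewrite divr_gt0.
have cU : cbox z (2 * r) `<=` cod i.
  by apply: subset_trans eU; apply: cbox_sub_box; rewrite /r; lra.
pose bnd w := 8 * sigma i w * factor0 (param i w).
have [m mK hm] : exists2 m, m \in cbox z (2 * r) &
    forall w, w \in cbox z (2 * r) -> bnd w <= bnd m.
  apply: compact_EVT_max; [|exact: cbox_compact|].
    by exists z; rewrite /cbox /= !subrr normr0 mulr_ge0 ?ltW.
  apply: continuous_in_subspaceT => w; rewrite inE => /cU iw.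
  have c8 : {for w, continuous (fun=> 8 : R)} by exact: cst_continuous.
  exact: (continuousM (continuousM c8 (density_continuous iw))
    (param_comp_continuous factor0_continuous iw)).
pose K := bnd m.
have K0 : 0 < K.
  by rewrite /K /bnd !mulr_gt0 ?expR_gt0// density_gt0//; apply: cU; rewrite -inE.
(* The first bound makes the Laplacian of the barrier win at an interior minimum, the second makes
   the barrier nonpositive on the outer circle, where the growth is nonnegative. *)
pose C := Num.min (- ln K - r - 1) (ln r - r).
have C1 : K * expR (C + r) < 1.
  have : C <= - ln K - r - 1 by rewrite /C ge_min lexx.
  move=> h; rewrite -[X in X * _](@lnK _ K) ?posrE// -expRD -expR0 ltr_expR; lra.
have C2 : C <= ln r - r by rewrite /C ge_min lexx orbT.
(* The second bound puts [a] so close to [z] that - ln |z - a| + C exceeds [L]: the barrier is above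
   [L] at [z]. *)
pose T := Num.min (r ^+ 2) (expR (2 * (C - L))).
have T0 : 0 < T by rewrite lt_min exprn_gt0 ?expR_gt0.
pose d := Num.min (r / 2) (Num.sqrt (T / 2)).
have d0 : 0 < d by rewrite lt_min divr_gt0//= sqrtr_gt0 divr_gt0.
have [a ab [ia qa]] := q_zero_nowhere_dense iz (nbhs_box z d0).
have dT : dist2 a z < T.
  apply: lt_le_trans (box_dist2 d0 ab) _.
  have : d ^+ 2 <= T / 2.
    rewrite -(@sqr_sqrtr _ (T / 2)) ?divr_ge0 ?(ltW T0)//.
    by rewrite ler_pXn2r ?nnegrE ?(ltW d0) ?sqrtr_ge0// /d ge_min lexx orbT.
  lra.
have az0 : 0 < dist2 a z.
  rewrite lt_neqAle dist2_ge0 andbT eq_sym; apply: contra qa => /eqP.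
  rewrite /dist2 => /eqP; rewrite paddr_eq0 ?sqr_ge0// !sqrf_eq0 !subr_eq0.
  by move=> /andP[/eqP h1 /eqP h2]; rewrite -(cplx_eq h1 h2).
have azr : dist2 a z < r ^+ 2 by apply: lt_le_trans dT _; rewrite ge_min lexx.
have daU : disc a r `<=` cbox z (2 * r).
  move=> v /(disc_sub_cbox (ltW r0))[v1 v2]; have [y1 y2] := ab.
  have dr : d <= r / 2 by rewrite /d ge_min lexx.
  split.
    rewrite -(subrKA (re a)); apply: le_trans (ler_normD _ _) _; move: v1 y1; lra.
  rewrite -(subrKA (im a)); apply: le_trans (ler_normD _ _) _; move: v2 y2; lra.
have [r2 r20 hr2] : exists2 r2, 0 < r2 & box a r2 `<=` [set w | cod i w /\ 0 < cmod (q i w) ^+ 2].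
  apply/nbhs_boxP; apply: nbhsI; first exact: open_nbhs_nbhs.
  apply: near_gt0 (q_continuous ia) _.
  rewrite lt_neqAle eq_sym sqr_ge0 andbT; apply: contra qa => /eqP.
  rewrite cmod2E => /eqP; rewrite paddr_eq0 ?sqr_ge0// !sqrf_eq0.
  by move=> /andP[/eqP h1 /eqP h2]; apply/eqP; apply: cplx_eq.
(* The inner disc must avoid the zeros of [q] and leave [z] outside, in the annulus of
   comparison. *)
pose r1 := Num.min (r2 / 2) (Num.sqrt (dist2 a z) / 2).
have r10 : 0 < r1 by rewrite lt_min !divr_gt0// sqrtr_gt0.
have r1sq : r1 ^+ 2 < dist2 a z.
  rewrite -(@sqr_sqrtr _ (dist2 a z)) ?dist2_ge0//.
  rewrite ltr_pXn2r ?nnegrE ?sqrtr_ge0 ?(ltW r10)//.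
  have : 0 < Num.sqrt (dist2 a z) by rewrite sqrtr_gt0.
  have : r1 <= Num.sqrt (dist2 a z) / 2 by rewrite /r1 ge_min lexx orbT.
  lra.
have d1U : disc a r1 `<=` [set w | cod i w /\ 0 < cmod (q i w) ^+ 2].
  apply: subset_trans hr2; apply: subset_trans (disc_sub_cbox (ltW r10)) _.
  apply: cbox_sub_box; have : r1 <= r2 / 2 by rewrite /r1 ge_min lexx.
  lra.
pose g w := 2^-1 * ln (dist2 a w).
pose v w := - g w + C + expR (g w).
have cI : compact (param i @` disc a r1).
  apply: continuous_compact; last exact: disc_compact (ltW r10).
  apply: continuous_in_subspaceT => w; rewrite inE => /d1U[iw _].
  exact: param_continuous.
(* The barrier as a function of the squared distance, hence constant on the inner circle. Since [q]
   has no zero in the inner disc, one [t] lifts the growth above that constant on the whole disc. *)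
pose gv (s : R) := - (2^-1 * ln s) + C + expR (2^-1 * ln s).
have hK y : (param i @` disc a r1) y -> forall L' : R, exists2 t, 0 <= t & L' < growth t y.
  move=> [w dw <-]; have [iw fw] := d1U w dw; apply: growth_unbounded_nonzero => //.
  by apply: contraTneq fw => ->; rewrite cmod2E /= expr0n /= addr0 ltxx.
have [t t0 ht] := pinfty_exists (growth_dini cI hK (gv (r1 ^+ 2))).
exists t => //; rewrite ltNge; apply/negP => uL.
pose V := cod i `&` [set w | 0 < dist2 a w].
have oV : open V by apply: openI => //; exact: open_dist2_gt.
have VU : V `<=` cod i by move=> w [].
have c2 : Cn 2 V (fun w => ln (dist2 a w)).
  by apply: Cn_ln => //; [move=> w []|exact: Cn_dist2].
have cg : Cn 2 V g by apply: CnM => //; exact: Cn_cst.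
have cNg : Cn 2 V (fun w => - g w + C).
  by apply: CnD => //; [exact: CnN|exact: Cn_cst].
have ceg : Cn 2 V (fun w => expR (g w)) by exact: Cn_expR.
have cv : Cn 2 V v by exact: CnD.
pose F w := growth t (param i w) - v w.
have cgr : Cn 2 V (fun w => growth t (param i w)).
  by apply: (Cn_sub VU); apply: smooth_Cn; exact: growth_smooth.
have cF : Cn 2 V F by exact: CnB.
pose A := disc a r `&` [set w | r1 ^+ 2 <= dist2 a w].
have cA : compact A.
  apply: (@subclosed_compact _ _ (disc a r)).
  - apply: closedI.
      apply: (@closed_comp _ _ (dist2 a) [set x | x <= r ^+ 2]).
        by move=> w _; exact: dist2_continuous.
      exact: closed_le.
    apply: (@closed_comp _ _ (dist2 a) [set x | r1 ^+ 2 <= x]).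
      by move=> w _; exact: dist2_continuous.
    exact: closed_ge.
  - exact: disc_compact (ltW r0).
  - by move=> w [].
have AV : A `<=` V.
  move=> w [/daU/cU iw h]; split => //=.
  by apply: lt_le_trans h; rewrite exprn_gt0.
have Az : A z by split; exact: ltW.
have [c cinA hc] : exists2 c, c \in A & forall w, w \in A -> F c <= F w.
  apply: compact_EVT_min => //; first by exists z.
  apply: continuous_in_subspaceT => w; rewrite inE => /AV Vw.
  exact: (Cn_continuous cF).
have Ac : A c by rewrite -inE.
have vz : L < v z.
  have h : ln (dist2 a z) < 2 * (C - L).
    rewrite -[X in _ < X]expRK ltr_ln ?posrE ?expR_gt0//.
    by apply: lt_le_trans dT _; rewrite ge_min lexx orbT.
  have := expR_gt0 (g z); rewrite /v /g; lra.
have Fz : F z < 0 by rewrite /F xE; lra.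
have Fc : F c < 0 by apply: le_lt_trans Fz; apply: hc; rewrite inE.
have [/= dc1 dc2] := Ac; have [ic dc0] := AV _ Ac.
have gc : 0 <= growth t (param i c) by exact: growth_ge0.
have rc : dist2 a c < r ^+ 2.
  rewrite lt_neqAle dc1 andbT; apply/negP => /eqP E.
  have : v c <= 0.
    rewrite /v /g E lnXn// mulrnAr -mulr_natr mulrAC mulVf ?pnatr_eq0// mul1r.
    by rewrite lnK ?posrE//; lra.
  move: Fc; rewrite /F; lra.
have r1c : r1 ^+ 2 < dist2 a c.
  rewrite lt_neqAle dc2 andbT; apply/negP => /eqP E.
  have : gv (r1 ^+ 2) < growth t (param i c).
    by apply: ht; exists c => //; rewrite /disc /= -E.
  by move: Fc; rewrite /F /v /g -E -/(gv _); lra.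
have Vc : V c by exact: AV.
have : 0 <= lap F c.
  apply: (lap_local_min oV Vc cF).
  have n1 : nbhs c [set w | dist2 a w < r ^+ 2].
    by apply: open_nbhs_nbhs; split; first exact: open_dist2_lt.
  have n2 : nbhs c [set w | r1 ^+ 2 < dist2 a w].
    by apply: open_nbhs_nbhs; split; first exact: open_dist2_gt.
  by apply: nbhsS (nbhsI n1 n2) => w [/ltW w1 /ltW w2]; apply: hc; rewrite inE.
have lapg w : V w -> lap g w = 0.
  by move=> Vw; rewrite /g (lapZ _ oV Vw c2) lap_ln_dist2 ?mulr0//; have [] := Vw.
have gradg w : V w -> grad2 g w = (dist2 a w)^-1.
  move=> Vw; have w0 : 0 < dist2 a w by have [] := Vw.
  have E k : pd k g w = 2^-1 * ((dist2 a w)^-1 * pd k (dist2 a) w).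
    have hd := pd_has_pd (has_pdP (has_pd_dist2 k a w)).1.
    have := has_pdM (has_pd_cst k 2^-1 w) (has_pd_ln w0 hd).
    by rewrite mulr0 addr0 => /has_pdP[].
  have := grad2_dist2 a w; rewrite /grad2 (E false) (E true) !exprMn -!mulrDr => ->.
  by field; rewrite gt_eqF.
(* [g] is the logarithm of the distance: it is harmonic with squared gradient 1 / dist^2, so only
   the term e^g of the barrier contributes, with 1 / dist. *)
have lapv : lap v c = expR (- g c).
  rewrite /v (lapD oV Vc cNg ceg) (lapD oV Vc (CnN oV cg) (Cn_cst 2 C oV)) lap_cst.
  rewrite (lapN oV Vc cg) (lap_expR oV Vc cg) lapg// gradg//.
  have -> : dist2 a c = expR (g c) * expR (g c).
    rewrite -expRD /g -mulrDl; have -> : (2^-1 + 2^-1 : R) = 1 by field.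
    by rewrite mul1r lnK.
  by rewrite expRN; field; rewrite gt_eqF// expR_gt0.
(* At the negative minimum the growth is below - g + C + r, so its Laplacian is at most K e^(C + r)
   e^(-g), strictly less than the Laplacian e^(-g) of the barrier. *)
rewrite /F (lapB oV Vc cgr cv) lapv.
have h1 := lap_growth_le t0 ic.
have h2 : bnd c <= K by apply: hm; rewrite inE; exact: daU.
have gr : expR (g c) <= r.
  rewrite -[X in _ <= X](@lnK _ r) ?posrE// ler_expR /g.
  have : ln (dist2 a c) <= ln (r ^+ 2) by rewrite ler_ln ?posrE ?exprn_gt0.
  by rewrite lnXn// -mulr_natr; lra.
have h3 : expR (growth t (param i c)) <= expR (- g c) * expR (C + r).
  rewrite -expRD ler_expR; move: Fc; rewrite /F /v; lra.
have h4 : bnd c * expR (growth t (param i c)) <= K * (expR (- g c) * expR (C + r)).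
  by rewrite ler_pM ?expR_ge0// /bnd !mulr_ge0 ?expR_ge0// ltW// density_gt0.
have h5 : expR (- g c) * (K * expR (C + r)) < expR (- g c).
  by rewrite -[X in _ < X]mulr1 ltr_pM2l// expR_gt0.
move: h1; rewrite -/(bnd c); lra.
Qed.

Lemma growth_unbounded_unif (L : R) : \forall t \near +oo, forall x, L < growth t x.
Proof.
have := growth_dini S_compact (fun x _ => @growth_unbounded x) L.
by apply: filterS => t h x; exact: h.
Qed.

End Blowup.

(** * Length of curves *)

Lemma continuous_sqr (T : topologicalType) (R : realType) (f : T -> R) (x : T) :
  {for x, continuous f} -> {for x, continuous (fun y => f y ^+ 2)}.
Proof.
move=> cf; apply: (@continuous_near_eq _ _ (f * f)); last exact: continuousM.
by apply: nbhs_all => y; rewrite expr2.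
Qed.

Section Curves.
Variables (R : realType) (S : topologicalType) (M : riemannSurface R S).
Variables (X : topologicalType) (p : X -> S).
Hypothesis p_continuous : continuous p.
Variable g : chart_index M -> cplx R -> R.
Arguments g : clear implicits.
Hypothesis g_gt0 : forall i z, cod i z -> 0 < g i z.
Hypothesis g_continuous : forall i z, cod i z -> {for z, continuous (g i)}.
Hypothesis g_transition : forall i j z, overlap i j z ->
  g i z = g j (transition i j z) * cmod (derive1 (transition i j) z) ^+ 2.
Implicit Types (c : R -> X) (i j : chart_index M) (s r : R).

Let mu := @lebesgue_measure R.

(** [speed] takes the chart selected at the current point, and this choice need not vary
    continuously along the curve; continuity has to be read in one fixed chart. *)
Definition chart_speed i c s : R :=
  Num.sqrt (g i (chart i (p (c s))) *
    (derive1 (coord_re p i c) s ^+ 2 + derive1 (coord_im p i c) s ^+ 2)).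

Lemma near_dom i c s : {for s, continuous c} -> dom i (p (c s)) ->
  \forall r \near s, dom i (p (c r)).
Proof.
move=> cc ds; have cpc : {for s, continuous (fun r => p (c r))}.
  by apply: (continuous_comp cc); exact: p_continuous.
by apply: cpc; apply: open_nbhs_nbhs; split => //; exact: dom_open.
Qed.

(** The chain rule multiplies the squared velocity by |transition'|^2, the very factor in the
    transformation law of [g]. *)
Lemma speed_chart i c s : nbhs s [set r | dom i (p (c r))] ->
  derivable (coord_re p i c) s 1 -> derivable (coord_im p i c) s 1 ->
  speed p g c s = chart_speed i c s.
Proof.
move=> nd dr di; have ds : dom i (p (c s)) := nbhs_singleton nd.
rewrite /speed /chart_speed; set j := chart_at M (p (c s)).
have dj : dom j (p (c s)) := dom_chart_at M (p (c s)).
pose ci r : cplx R := chart i (p (c r)).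
have o : overlap i j (ci s) by exists (p (c s)).
have Hr : is_derive s 1 (fun r => re (ci r)) (derive1 (coord_re p i c) s).
  by rewrite derive1E; exact/derivableP.
have Hi : is_derive s 1 (fun r => im (ci r)) (derive1 (coord_im p i c) s).
  by rewrite derive1E; exact/derivableP.
have [Kr Ki] := holo_chain (transition_holomorphic o) Hr Hi.
have near_j : \forall r \near s, transition i j (ci r) = chart j (p (c r)).
  by apply: nbhsS nd => r dr'; rewrite /transition /ci chartK.
pose d := derive1 (transition i j) (ci s) *
  (derive1 (coord_re p i c) s +i* derive1 (coord_im p i c) s).
have Jr : is_derive s 1 (coord_re p j c) (re d).
  exact: (near_eq_is_derive (nbhsS (fun r (E : _ = _) => congr1 (@re R) E) near_j) Kr).
have Ji : is_derive s 1 (coord_im p j c) (im d).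
  exact: (near_eq_is_derive (nbhsS (fun r (E : _ = _) => congr1 (@im R) E) near_j) Ki).
have [_ Ej] := Jr; have [_ Ej'] := Ji; rewrite -!derive1E in Ej Ej'.
rewrite Ej Ej' (g_transition o).
have -> : transition i j (ci s) = chart j (p (c s)) by exact: nbhs_singleton near_j.
congr Num.sqrt; rewrite -mulrA; congr (_ * _).
by rewrite cmod2E /d reM imM [re (_ +i* _)]/= [im (_ +i* _)]/=; ring.
Qed.

Lemma speed_near c s i : C1_curve M p c -> s \in `[0, 1] -> dom i (p (c s)) ->
  \forall r \near s, speed p g c r = chart_speed i c r.
Proof.
move=> hc sI ds; have [cc /(_ i ds) [dr di _ _]] := hc s sI.
have nd := nbhs_interior (near_dom cc ds).
apply: nbhsS (nbhsI nd (nbhsI dr di)) => r [r1 [r2 r3]].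
exact: speed_chart.
Qed.

Lemma speed_continuous c s : C1_curve M p c -> s \in `[0, 1] ->
  {for s, continuous (speed p g c)}.
Proof.
move=> hc sI; pose i := chart_at M (p (c s)).
have ds : dom i (p (c s)) := dom_chart_at M (p (c s)).
have [cc /(_ i ds) [_ _ cr ci]] := hc s sI.
apply: (@continuous_near_eq _ _ (chart_speed i c)).
  by apply: nbhsS (speed_near hc sI ds) => r ->.
have cpc : {for s, continuous (fun r => p (c r))}.
  by apply: (continuous_comp cc); exact: p_continuous.
have cch : {for s, continuous (fun r => chart i (p (c r)))}.
  by apply: (continuous_comp cpc); exact: chart_continuous.
have cg : {for s, continuous (fun r => g i (chart i (p (c r))))}.
  by apply: (continuous_comp cch); apply: g_continuous; exact: cod_chart.
apply: (@continuous_comp _ _ _ _ Num.sqrt); last exact: sqrt_continuous.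
exact: (continuousM cg (continuousD (continuous_sqr cr) (continuous_sqr ci))).
Qed.

Lemma speed_ge0 c s : 0 <= speed p g c s.
Proof. exact: sqrtr_ge0. Qed.

Lemma within_speed c : C1_curve M p c -> {within `[0, 1], continuous (speed p g c)}.
Proof.
move=> hc; apply: continuous_in_subspaceT => s; rewrite inE => sI.
exact: speed_continuous.
Qed.

Lemma speed_integrable c : C1_curve M p c -> mu.-integrable `[0, 1] (EFin \o speed p g c).
Proof.
by move=> hc; apply: continuous_compact_integrable; [exact: segment_compact|exact: within_speed].
Qed.

Definition arc_length c t : R := parameterized_integral mu 0 t (speed p g c).

Lemma arc_length0 c : arc_length c 0 = 0.
Proof. by rewrite /arc_length /parameterized_integral set_itv1 Rintegral_set1. Qed.

Lemma arc_length1 c : C1_curve M p c -> (arc_length c 1)%:E = curve_length p g c.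
Proof.
move=> hc; rewrite /arc_length /parameterized_integral /Rintegral fineK//.
exact: integrable_fin_num (speed_integrable hc).
Qed.

Lemma arc_length_within c : C1_curve M p c -> {within `[0, 1], continuous (arc_length c)}.
Proof. by move=> hc; apply: parameterized_integral_continuous => //; exact: speed_integrable. Qed.

Lemma arc_length_derive c s : C1_curve M p c -> s \in `]0, 1[ ->
  derivable (arc_length c) s 1 /\ derive1 (arc_length c) s = speed p g c s.
Proof.
move=> hc; rewrite in_itv /= => /andP[s0 s1].
apply: (continuous_FTC1_closed s1 (speed_integrable hc) s0).
by apply: speed_continuous => //; rewrite in_itv /= !ltW.
Qed.

Lemma sub_itv01 (s1 s2 : R) : 0 <= s1 -> s2 <= 1 -> `[s1, s2] `<=` `[0, 1].
Proof. by move=> h1 h2; apply: subset_itv; rewrite bnd_simp. Qed.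

Lemma arc_length_mono c s1 s2 : C1_curve M p c -> 0 <= s1 -> s1 <= s2 -> s2 <= 1 ->
  arc_length c s1 <= arc_length c s2.
Proof.
move=> hc h1 h12 h2.
have s1I : s1 \in `[0, 1]%R by rewrite in_itv /= h1 (le_trans h12).
have s2I : s2 \in `[0, 1]%R by rewrite in_itv /= h2 (le_trans h1).
apply: (@ger0_derive1_le_cc _ (arc_length c) 0 1) => // [s /(arc_length_derive hc)[] //|s sI|].
  by rewrite (arc_length_derive hc sI).2 speed_ge0.
exact: arc_length_within.
Qed.

(** Both arc_length + k F and arc_length - k F have nonnegative derivative, hence are
    nondecreasing. *)
Lemma coord_lipschitz c (F : R -> R) (k s1 s2 : R) : C1_curve M p c -> 0 < k ->
  0 <= s1 -> s1 <= s2 -> s2 <= 1 ->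
  (forall s, s1 <= s <= s2 -> derivable F s 1) ->
  (forall s, s1 <= s <= s2 -> k * `|derive1 F s| <= speed p g c s) ->
  `|F s2 - F s1| <= (arc_length c s2 - arc_length c s1) / k.
Proof.
move=> hc k0 h1 h12 h2 dF hF.
have cA : {within `[s1, s2], continuous (arc_length c)}.
  exact: continuous_subspaceW (sub_itv01 h1 h2) (arc_length_within hc).
have cF : {within `[s1, s2], continuous F}.
  by apply: derivable_within_continuous => s; rewrite in_itv /=; exact: dF.
have H (e : R) : `|e| <= 1 ->
    arc_length c s1 + e * k * F s1 <= arc_length c s2 + e * k * F s2.
  move=> e1; apply: (@ger0_derive1_le_cc _ (fun s => arc_length c s + e * k * F s) s1 s2) => //.
  - move=> s; rewrite in_itv /= => /andP[a b].
    apply: derivableD; first apply: (arc_length_derive hc _).1.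
      by rewrite in_itv /= (le_lt_trans h1)//= (lt_le_trans b).
    by apply: derivableM; [exact: derivable_cst|apply: dF; rewrite !ltW].
  - move=> s; rewrite in_itv /= => /andP[a b].
    have sI : s \in `]0, 1[ by rewrite in_itv /= (le_lt_trans h1)//= (lt_le_trans b).
    have [d1 d2] := arc_length_derive hc sI.
    have sI' : s1 <= s <= s2 by rewrite !ltW.
    have H1 : is_derive s 1 (arc_length c) (speed p g c s).
      by rewrite -d2 derive1E; exact/derivableP.
    have H2 : is_derive s 1 F (derive1 F s).
      by rewrite derive1E; apply/derivableP; exact: dF.
    have H3 : is_derive s 1 (fun s => arc_length c s + e * k * F s)
        (speed p g c s + (e * k) *: derive1 F s).
      by apply: is_deriveD; apply: is_deriveZ.
    have [_ E] := H3; rewrite derive1E E.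
    have h := hF s sI'.
    have : `|e * k * derive1 F s| <= speed p g c s.
      rewrite -mulrA normrM normrM (gtr0_norm k0); apply: le_trans h.
      by rewrite ler_piMl// mulr_ge0// ltW.
    by rewrite ler_norml /GRing.scale /=; lra.
  - have cek : {within `[s1, s2], continuous (fun s => e * k * F s)}.
      by move=> x; apply: cvgM; [exact: cvg_cst|exact: cF].
    by move=> x; apply: cvgD; [exact: cA|exact: cek].
  - by rewrite in_itv /= lexx.
  - by rewrite in_itv /= h12 lexx.
have e1 : `|1 : R| <= 1 by rewrite normr1.
have e2 : `|-1 : R| <= 1 by rewrite normrN normr1.
have h3 := H _ e1; have h4 := H _ e2.
rewrite ler_pdivlMr// -[X in _ * X](gtr0_norm k0) -normrM ler_norml.
by apply/andP; split; lra.
Qed.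

Lemma curve_chart_lipschitz c i (k s1 s2 : R) : C1_curve M p c -> 0 < k ->
  0 <= s1 -> s1 <= s2 -> s2 <= 1 ->
  (forall s, s1 <= s <= s2 -> dom i (p (c s)) /\ k ^+ 2 <= g i (chart i (p (c s)))) ->
  `|coord_re p i c s2 - coord_re p i c s1| <= (arc_length c s2 - arc_length c s1) / k /\
  `|coord_im p i c s2 - coord_im p i c s1| <= (arc_length c s2 - arc_length c s1) / k.
Proof.
move=> hc k0 h1 h12 h2 hs.
have D s : s1 <= s <= s2 -> [/\ derivable (coord_re p i c) s 1,
    derivable (coord_im p i c) s 1 & speed p g c s = chart_speed i c s].
  move=> sI; have sI' : s \in `[0, 1].
    by move: sI => /andP[a b]; rewrite in_itv /= (le_trans h1)//= (le_trans b).
  have [ds _] := hs s sI; have [_ /(_ i ds)[dr di _ _]] := hc s sI'.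
  split; [exact: nbhs_singleton dr|exact: nbhs_singleton di|].
  exact: nbhs_singleton (speed_near hc sI' ds).
have B (s x y : R) : s1 <= s <= s2 -> `|x| ^+ 2 <= derive1 (coord_re p i c) s ^+ 2 +
    derive1 (coord_im p i c) s ^+ 2 -> k * `|x| <= chart_speed i c s.
  move=> sI hx; have [ds kg] := hs s sI.
  rewrite -(@ler_pXn2r _ 2) ?nnegrE ?mulr_ge0 ?sqrtr_ge0 ?(ltW k0)//.
  rewrite exprMn sqr_sqrtr ?ler_pM ?sqr_ge0//.
  by rewrite mulr_ge0 ?addr_ge0 ?sqr_ge0// ltW// g_gt0//; exact: cod_chart.
split; apply: coord_lipschitz => // s sI; have [d1 d2 E] := D s sI; rewrite // E.
  by apply: B => //; rewrite real_normK ?num_real// lerDl sqr_ge0.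
by apply: B => //; rewrite real_normK ?num_real// lerDr sqr_ge0.
Qed.

End Curves.

(** * Covers by sheets *)

(** Compactness in its near-covering form, for the filter of finite sequences ordered by inclusion:
    near each [x], every sequence containing [x] already covers. *)
Lemma finite_subcover (T : topologicalType) (f : T -> set T) :
  compact [set: T] -> (forall x, nbhs x (f x)) ->
  exists s : seq T, forall y, exists2 a, a \in s & f a y.
Proof.
move=> /compact_near_coveringP cT hf.
pose F : set_system (seq T) :=
  [set P | exists s0 : seq T, forall s : seq T, {subset s0 <= s} -> P s].
have FF : Filter F.
  split.
  - by exists [::].
  - move=> P Q [s1 h1] [s2 h2]; exists (s1 ++ s2) => s hs; split.
      by apply: h1 => x xs; apply: hs; rewrite mem_cat xs.
    by apply: h2 => x xs; apply: hs; rewrite mem_cat xs orbT.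
  - by move=> P Q PQ [s0 h]; exists s0 => s /h /PQ.
have [|s0 hs0] := cT (seq T) F (fun s y => exists2 a, a \in s & f a y) FF.
  move=> x _; exists (f x, [set s : seq T | x \in s]); first split => //=.
    by exists [:: x] => s; apply; rewrite mem_head.
  by move=> [y s] /= [fy xs]; exists x.
by exists s0 => y; apply: (hs0 s0).
Qed.

Lemma box_connected (R : realType) (z : cplx R) (e : R) : connected (box z e).
Proof.
have R1 (a b : R) : re (a +i* b : cplx R) = a by [].
have R2 (a b : R) : im (a +i* b : cplx R) = b by [].
pose seg (w : cplx R) := (fun s : R =>
  (re z + s * (re w - re z)) +i* (im z + s * (im w - im z)) : cplx R) @` `[0, 1].
have -> : box z e = \bigcup_(w in box z e) seg w.
  apply/seteqP; split => [w bw|_ [w [b1 b2] [s /= + <-]]].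
    exists w => //; exists 1; first by rewrite /= in_itv /= ler01 lexx.
    by apply: cplx_eq; rewrite /= mul1r addrC subrK.
  rewrite in_itv /= => /andP[s0 s1]; rewrite /box /mkset R1 R2.
  rewrite addrAC subrr add0r addrAC subrr add0r !normrM (ger0_norm s0).
  by split; apply: le_lt_trans (ler_piMl _ s1) _.
have [e0|e0] := ltP 0 e; last first.
  have -> : box z e = set0.
    by rewrite -subset0 => w [h _]; have := le_lt_trans (normr_ge0 _) (lt_le_trans h e0); rewrite ltxx.
  by rewrite bigcup_set0; exact: connected0.
apply: bigcup_connected.
  exists z => w _; exists 0; first by rewrite /= in_itv /= lexx ler01.
  by apply: cplx_eq; rewrite /= mul0r addr0.
move=> w _.
have cs : continuous (fun s : R =>
    (re z + s * (re w - re z)) +i* (im z + s * (im w - im z)) : cplx R).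
  have lin (a b : R) : continuous (fun s : R => a + s * b).
    by move=> s; apply: cvgD; [exact: cvg_cst|apply: cvgM; [exact: cvg_id|exact: cvg_cst]].
  by move=> s; exact: (continuous_cplx (lin (re z) (re w - re z) s) (lin (im z) (im w - im z) s)).
apply: connected_continuous_connected; first exact: segment_connected.
apply: continuous_subspaceT; exact: cs.
Qed.

Section Sheets.
Variables (S X : topologicalType) (p : X -> S).
Implicit Types (U V : set S) (A B T : set X).

(** The sheets form a set of subsets instead of an indexed family, so that sheets that meet are
    equal as sets, with no index to compare. *)
Definition sheet_family U (fam : set (set X)) : Prop :=
  [/\ p @^-1` U `<=` \bigcup_(T in fam) T,
      forall T T', fam T -> fam T' -> T `&` T' !=set0 -> T = T' &
      forall T, fam T -> [/\ open T, set_bij T U p &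
        forall W, open W -> W `<=` T -> open (p @` W)]].

Lemma evenly_covered_family U : evenly_covered p U -> exists fam, sheet_family U fam.
Proof.
move=> [I [sh [h1 h2 h3]]]; exists (range sh); split.
- by rewrite h1 => x [k _ hk]; exists (sh k) => //; exists k.
- by move=> _ _ [k _ <-] [l _ <-] /h2 ->.
- by move=> _ [k _ <-]; exact: h3.
Qed.

Definition restrict_family (fam : set (set X)) V : set (set X) :=
  [set A | exists2 T, fam T & A = T `&` p @^-1` V].

Section Restrict.
Variables (U V : set S) (fam : set (set X)).
Hypothesis p_continuous : continuous p.
Hypothesis hfam : sheet_family U fam.
Hypothesis VU : V `<=` U.
Hypothesis V_open : open V.

Lemma restrict_open A : restrict_family fam V A -> open A.
Proof.
move=> [T fT ->]; have [_ _ /(_ _ fT)[oT _ _]] := hfam.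
by apply: openI => //; apply: open_comp => // x _; exact: p_continuous.
Qed.

Lemma restrict_inj A : restrict_family fam V A -> forall x y, A x -> A y -> p x = p y -> x = y.
Proof.
move=> [T fT ->] x y [Tx _] [Ty _]; have [_ _ /(_ _ fT)[_ [_ iT _] _]] := hfam.
by apply: iT; rewrite inE.
Qed.

Lemma restrict_surj A v : restrict_family fam V A -> V v -> exists2 x, A x & p x = v.
Proof.
move=> [T fT ->] Vv; have [_ _ /(_ _ fT)[_ [_ _ sT] _]] := hfam.
by have [x Tx xv] := sT _ (VU Vv); exists x => //; split => //=; rewrite xv.
Qed.

Lemma restrict_exists x : V (p x) -> exists2 A, restrict_family fam V A & A x.
Proof.
move=> Vx; have [h _ _] := hfam; have [T fT Tx] := h x (VU Vx).
by exists (T `&` p @^-1` V) => //; exists T.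
Qed.

Lemma restrict_disjoint A B x : restrict_family fam V A -> restrict_family fam V B ->
  A x -> B x -> A = B.
Proof.
move=> [T fT ->] [T' fT' ->] [Tx _] [T'x _]; have [_ h _] := hfam.
by rewrite (h T T') //; exists x.
Qed.

(** A nonempty relatively clopen part of [A] projects onto a relatively clopen part of [V], hence
    onto [V]; injectivity of [p] on the sheet then gives all of [A]. Openness of [p] on the sheet
    takes the place of a continuous inverse. *)
Lemma restrict_connected A : connected V -> restrict_family fam V A -> connected A.
Proof.
move=> cV hA B [b Bb] [C oC BC] [D cD BD].
have [T fT AT] := hA; have [_ _ /(_ _ fT)[oT [_ iT sT] opT]] := hfam.
have AV x : A x -> V (p x) by rewrite AT => -[].
have AsT x : A x -> T x by rewrite AT => -[].
have pBV : p @` B = V.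
  apply: cV.
  - by exists (p b); exists b.
  - exists (p @` (T `&` C)); first by apply: opT; [exact: openI|move=> ? []].
    apply/seteqP; split => [_ [x Bx <-]|v [Vv [x [Tx Cx] xv]]].
      move: Bx; rewrite BC => -[Ax Cx]; split; first exact: AV.
      by exists x => //; split => //; exact: AsT.
    exists x => //; rewrite BC; split => //; rewrite AT; split => //=; by rewrite xv.
  - exists (~` (p @` (T `&` ~` D))).
      apply: open_closedC; apply: opT; last by move=> ? [].
      by apply: openI => //; exact: closed_openC.
    apply/seteqP; split => [_ [x Bx <-]|v [Vv hv]].
      move: Bx; rewrite BD => -[Ax Dx]; split; first exact: AV.
      move=> [y [Ty Dy] yx]; apply: Dy.
      by have -> : y = x by apply: iT; rewrite ?inE//; exact: AsT.
    have [x Ax xv] := restrict_surj hA Vv; exists x => //; rewrite BD; split => //.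
    by apply: contrapT => Dx; apply: hv; exists x => //; split => //; exact: AsT.
apply/seteqP; split => [x|x Ax]; first by rewrite BC => -[].
have : V (p x) by exact: AV.
rewrite -pBV => -[y By yx].
have Ay : A y by move: By; rewrite BC => -[].
by rewrite -(restrict_inj hA Ay Ax yx).
Qed.

End Restrict.

(** The union of the other sheets is open, so the part of [A] in the sheet of [x] is relatively
    clopen. *)
Lemma connected_in_sheet U fam A x : sheet_family U fam -> connected A ->
  A `<=` p @^-1` U -> A x -> exists2 T, fam T & A `<=` T.
Proof.
move=> [h1 h2 h3] cA AU Ax; have [T fT Tx] := h1 _ (AU _ Ax); exists T => //.
suff -> : A = A `&` T by move=> y [].
symmetry; apply: cA; first by exists x.
  by exists T => //; have [] := h3 _ fT.
exists (~` (\bigcup_(T' in fam `&` [set T' | T' <> T]) T')).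
  apply: open_closedC; apply: bigcup_open => T' [fT' _]; by have [] := h3 _ fT'.
apply/seteqP; split => y [Ay Hy]; split => //.
  by move=> [T' [fT' nT] T'y]; apply: nT; apply: h2 => //; exists y.
have [T' fT' T'y] := h1 _ (AU _ Ay).
have [<- //|nT] := pselect (T' = T).
by exfalso; apply: Hy; exists T'.
Qed.

(** [A], [B] and [B'] are connected and lie over the evenly covered [W], each in one sheet of it. As
    [A] meets both others, it is the same sheet; [p] is injective there, and [B] and [B'] have the
    same image. *)
Lemma restrict_meet_unique U V W fU fV fW (VV : set S) A B B' x y :
  sheet_family U fU -> sheet_family W fW -> sheet_family VV fV ->
  V `<=` U -> connected V -> restrict_family fU V A ->
  forall V', V' `<=` VV -> connected V' ->
  restrict_family fV V' B -> restrict_family fV V' B' ->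
  V `<=` W -> V' `<=` W -> A x -> B x -> A y -> B' y -> B = B'.
Proof.
move=> hU hW hV VU cV hA V' V'VV cV' hB hB' VW V'W Ax Bx Ay B'y.
have sub fam Q C : restrict_family fam Q C -> Q `<=` W -> C `<=` p @^-1` W.
  by move=> [T _ ->] QW z [_ /QW].
have cA := restrict_connected hU VU cV hA.
have cB := restrict_connected hV V'VV cV' hB.
have cB' := restrict_connected hV V'VV cV' hB'.
have [T fT AT] := connected_in_sheet hW cA (sub _ _ _ hA VW) Ax.
have [T1 fT1 BT] := connected_in_sheet hW cB (sub _ _ _ hB V'W) Bx.
have [T2 fT2 BT'] := connected_in_sheet hW cB' (sub _ _ _ hB' V'W) B'y.
have [_ hd h3] := hW.
have E1 : T = T1 by apply: hd => //; exists x; split; [exact: AT|exact: BT].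
have E2 : T = T2 by apply: hd => //; exists y; split; [exact: AT|exact: BT'].
subst T1 T2; have [_ [_ iT _] _] := h3 _ fT.
have inc C C' : restrict_family fV V' C -> restrict_family fV V' C' ->
    C `<=` T -> C' `<=` T -> C `<=` C'.
  move=> hC hC' CT C'T z Cz; have Vz : V' (p z) by case: hC Cz => Q _ -> [].
  have [z' Cz' zz'] := restrict_surj hV V'VV hC' Vz.
  suff <- : z' = z by [].
  by apply: iT => //; rewrite inE; [exact: C'T|exact: CT].
by apply/seteqP; split; apply: inc.
Qed.

End Sheets.

(** * A finite cover by evenly covered coordinate boxes *)

Section GoodCover.
Variables (R : realType) (S : topologicalType) (M : riemannSurface R S).
Variables (X : topologicalType) (p : X -> S).
Hypothesis S_hausdorff : hausdorff_space S.
Hypothesis S_compact : compact [set: S].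
Hypothesis p_covering : covering_map p.
Variable g : chart_index M -> cplx R -> R.
Arguments g : clear implicits.
Hypothesis g_gt0 : forall i z, cod i z -> 0 < g i z.
Hypothesis g_continuous : forall i z, cod i z -> {for z, continuous (g i)}.

Definition chart_box (i : chart_index M) (z : cplx R) (e : R) : set S :=
  [set y | dom i y /\ box z e (chart i y)].

Lemma chart_box_open i z e : open (chart_box i z e).
Proof.
rewrite openE => y [iy by_]; apply: nbhs_chart => //.
by apply: open_nbhs_nbhs; split => //; exact: box_open.
Qed.

Lemma chart_boxE (i : chart_index M) z e : box z e `<=` cod i -> chart_box i z e = param i @` box z e.
Proof.
move=> h; apply/seteqP; split => [y [iy by_]|_ [w bw <-]].
  by exists (chart i y) => //; rewrite chartK.
by have [d E] := cod_param (h _ bw); split => //; rewrite E.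
Qed.

Lemma chart_box_connected (i : chart_index M) z e : box z e `<=` cod i -> connected (chart_box i z e).
Proof.
move=> h; rewrite chart_boxE//; apply: connected_continuous_connected.
  exact: box_connected.
by apply: continuous_in_subspaceT => w; rewrite inE => /h; exact: param_continuous.
Qed.

Lemma param_cbox_closed (i : chart_index M) z e : cbox z e `<=` cod i -> closed (param i @` cbox z e).
Proof.
move=> h; apply: compact_closed => //; apply: continuous_compact; last exact: cbox_compact.
by apply: continuous_in_subspaceT => w; rewrite inE => /h; exact: param_continuous.
Qed.

(** The boxes of half-width [e] cover [S], while the sheets and the lower bound [k ^+ 2] for the
    metric live on the doubled boxes; the margin between the two cannot be crossed without length.
    [gc_unique] makes the next sheet a function of the current one and the next index. *)
Record good_cover (m : nat) (ci : 'I_m -> chart_index M) (z : 'I_m -> cplx R)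
    (e k : 'I_m -> R) (sheets : 'I_m -> set (set X)) : Prop := GoodCover {
  gc_e : forall j, 0 < e j;
  gc_k : forall j, 0 < k j;
  gc_cod : forall j, box (z j) (2 * e j) `<=` cod (ci j);
  gc_g : forall j w, box (z j) (2 * e j) w -> k j ^+ 2 <= g (ci j) w;
  gc_cover : forall x, exists j, chart_box (ci j) (z j) (e j) x;
  gc_open : forall j A, sheets j A -> open A;
  gc_sub : forall j A y, sheets j A -> A y -> chart_box (ci j) (z j) (2 * e j) (p y);
  gc_inj : forall j A, sheets j A -> forall x y, A x -> A y -> p x = p y -> x = y;
  gc_ex : forall j y, chart_box (ci j) (z j) (2 * e j) (p y) -> exists2 A, sheets j A & A y;
  gc_disj : forall j A B x, sheets j A -> sheets j B -> A x -> B x -> A = B;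
  gc_unique : forall i j A B B' x y, sheets i A -> sheets j B -> sheets j B' ->
    A x -> B x -> A y -> B' y -> B = B'
}.

(* The conditions on [l] in [H2] make the second cover a star refinement of the first:
   two of its members that meet lie in a common [U (a1 l)]. *)
Lemma good_cover_exists : exists m ci z e k sheets, @good_cover m ci z e k sheets.
Proof.
have [p_cont p_ev] := p_covering.
have H1 x : exists Ue : set S * R * set (set X),
    [/\ open Ue.1.1, sheet_family p Ue.1.1 Ue.2, 0 < Ue.1.2,
        cbox (chart (chart_at M x) x) Ue.1.2 `<=` cod (chart_at M x) &
        param (chart_at M x) @` cbox (chart (chart_at M x) x) Ue.1.2 `<=` Ue.1.1].
  have [U [oU Ux /evenly_covered_family[fam hfam]]] := p_ev x.
  have ix := dom_chart_at M x; set i := chart_at M x in ix *.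
  have : nbhs (chart i x) [set w | cod i w /\ U (param i w)].
    apply: nbhs_param; first exact: cod_chart.
    by rewrite chartK//; exact: open_nbhs_nbhs.
  move=> /nbhs_boxP[e e0 he]; exists (U, e / 2, fam); split => //=.
  - by rewrite divr_gt0.
  - move=> w hw; have := he w; case => //; apply: cbox_sub_box hw; lra.
  - move=> _ [w hw <-]; have := he w; case => //; apply: cbox_sub_box hw; lra.
have [D HD] := choice H1.
pose U x := (D x).1.1; pose e1 x := (D x).1.2; pose fam x := (D x).2.
pose K x := param (chart_at M x) @` cbox (chart (chart_at M x) x) (e1 x).
have cK x : closed (K x) by have [_ _ _ h _] := HD x; exact: param_cbox_closed.
have KU x : K x `<=` U x by have [_ _ _ _ h] := HD x.
have nK x : nbhs x (K x).
  have [_ _ e0 h _] := HD x; have ix := dom_chart_at M x.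
  apply: nbhsS (nbhs_chart ix (nbhs_box _ e0)) => y [iy by_].
  by exists (chart (chart_at M x) y); [exact: box_sub_cbox|rewrite chartK].
have [s1 hs1] := finite_subcover S_compact nK.
pose a1 (l : 'I_(size s1)) := tnth (in_tuple s1) l.
have cov1 y : exists l, K (a1 l) y.
  have [a as1 Ka] := hs1 y; have : a \in in_tuple s1 by [].
  by move=> /tnthP[l El]; exists l; rewrite /a1 -El.
have H2 x : exists ek : R * R, [/\ 0 < ek.1, 0 < ek.2,
    box (chart (chart_at M x) x) (2 * ek.1) `<=` cod (chart_at M x),
    forall w, box (chart (chart_at M x) x) (2 * ek.1) w -> ek.2 ^+ 2 <= g (chart_at M x) w &
    forall y, chart_box (chart_at M x) (chart (chart_at M x) x) (2 * ek.1) y ->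
      forall l, (K (a1 l) x -> U (a1 l) y) /\ (K (a1 l) y -> K (a1 l) x)].
  have ix := dom_chart_at M x; set i := chart_at M x in ix *.
  have ic := cod_chart ix; set z := chart i x in ic *.
  have g0 := g_gt0 ic.
  have n1 : nbhs z (cod i) by apply: open_nbhs_nbhs; split => //; exact: cod_open.
  have n2 : nbhs z [set w | 0 < g i w - g i z / 2].
    apply: (@near_gt0 _ _ (fun w => g i w - g i z / 2)); last by lra.
    by apply: continuousB; [exact: g_continuous|exact: cst_continuous].
  (* For each [l], either [x] is in K_l and the neighbourhood shrinks into the open U_l, or [x] is
     outside the closed K_l and the neighbourhood avoids it. *)
  have n3 : nbhs x [set y | forall l, (K (a1 l) x -> U (a1 l) y) /\ (K (a1 l) y -> K (a1 l) x)].
    apply: filter_forall => l; have [Kx|Kx] := pselect (K (a1 l) x).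
      have [oU _ _ _ _] := HD (a1 l).
      have : nbhs x (U (a1 l)) by apply: open_nbhs_nbhs; split => //; exact: KU.
      by apply: nbhsS => y Uy; split.
    have : nbhs x (~` K (a1 l)) by apply: open_nbhs_nbhs; split => //; exact: closed_openC.
    by apply: nbhsS => y Ky; split.
  have n4 : nbhs z [set w | cod i w /\ [set y | forall l, (K (a1 l) x -> U (a1 l) y) /\
      (K (a1 l) y -> K (a1 l) x)] (param i w)].
    by apply: nbhs_param => //; rewrite /z chartK.
  have [e e0 he] := (nbhs_boxP _ _).1 (nbhsI n1 (nbhsI n2 n4)).
  exists (e / 2, Num.sqrt (g i z / 2)) => /=.
  have -> : 2 * (e / 2) = e by field.
  split.
  - by rewrite divr_gt0.
  - by rewrite sqrtr_gt0 divr_gt0.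
  - by move=> w /he[].
  - move=> w /he[_ [/= h _]]; rewrite sqr_sqrtr ?divr_ge0 ?(ltW g0)//; lra.
  - by move=> y [iy /he[_ [_ [_]]]]; rewrite /= chartK.
have [ek Hek] := choice H2.
pose V x := chart_box (chart_at M x) (chart (chart_at M x) x) (2 * (ek x).1).
have oV x : open (V x) by exact: chart_box_open.
have cV x : connected (V x) by apply: chart_box_connected; have [] := Hek x.
have [kx Hkx] := choice cov1.
have VU x l : K (a1 l) x -> V x `<=` U (a1 l).
  by move=> Kx y Vy; have [_ _ _ _ /(_ y Vy l)[h _]] := Hek x; exact: h.
(* Some K_l contains the common point [v]; then it contains both centres, and both boxes lie in
   U_l. *)
have meet x y v : V x v -> V y v -> exists l, V x `<=` U (a1 l) /\ V y `<=` U (a1 l).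
  move=> Vx Vy; have [l Kv] := cov1 v; exists l.
  have [_ _ _ _ /(_ v Vx l)[_ hx]] := Hek x; have [_ _ _ _ /(_ v Vy l)[_ hy]] := Hek y.
  by split; apply: VU; [exact: hx|exact: hy].
pose sh x := restrict_family p (fam (a1 (kx x))) (V x).
have hU x : sheet_family p (U x) (fam x) by have [] := HD x.
have VUx x : V x `<=` U (a1 (kx x)) by exact: VU.
have nW x : nbhs x (chart_box (chart_at M x) (chart (chart_at M x) x) (ek x).1).
  have [e0 _ _ _ _] := Hek x; apply: open_nbhs_nbhs; split; first exact: chart_box_open.
  by split; [exact: dom_chart_at|exact: box_center].
have [s2 hs2] := finite_subcover S_compact nW.
pose a2 (l : 'I_(size s2)) := tnth (in_tuple s2) l.
exists (size s2), (fun l => chart_at M (a2 l)),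
  (fun l => chart (chart_at M (a2 l)) (a2 l)), (fun l => (ek (a2 l)).1),
  (fun l => (ek (a2 l)).2), (fun l => sh (a2 l)).
split.
- by move=> j; have [] := Hek (a2 j).
- by move=> j; have [] := Hek (a2 j).
- by move=> j; have [] := Hek (a2 j).
- by move=> j; have [] := Hek (a2 j).
- move=> y; have [a as2 Ka] := hs2 y; have : a \in in_tuple s2 by [].
  by move=> /tnthP[l El]; exists l; rewrite /a2 -El.
- by move=> j A; apply: restrict_open => //; exact: hU.
- by move=> j A y [T _ ->] [].
- by move=> j A hA; exact: (restrict_inj (hU _) hA).
- by move=> j y; apply: restrict_exists; [exact: hU|exact: VUx].
- by move=> j A B x hA hB; exact: (restrict_disjoint (hU _) hA hB).
- move=> i j A B B' x y hA hB hB' Ax Bx Ay B'y.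
  have Vp l C v : sh (a2 l) C -> C v -> V (a2 l) (p v) by move=> [T _ ->] [].
  have [l [V1 V2]] := meet _ _ _ (Vp _ _ _ hA Ax) (Vp _ _ _ hB Bx).
  exact: (restrict_meet_unique (hU _) (hU (a1 l)) (hU _) (VUx _) (cV _) hA
    (VUx _) (cV _) hB hB' V1 V2 Ax Bx Ay B'y).
Qed.

End GoodCover.

(** * Exponential growth of orbits *)

(** At the supremum [b] of the parameters satisfying [Q], the local step goes from a point just left
    of [b] to one just right of it. This is why it is required for pairs on either side of [s]. *)
Lemma real_induction (R : realType) (Q : R -> Prop) :
  (forall s, 0 <= s <= 1 -> exists2 h, 0 < h & forall s1 s2,
    0 <= s1 -> s1 <= s2 -> s2 <= 1 -> `|s1 - s| < h -> `|s2 - s| < h -> Q s1 -> Q s2) ->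
  Q 0 -> Q 1.
Proof.
move=> loc Q0; pose A := [set s : R | 0 <= s <= 1 /\ Q s].
have A0 : A 0 by split => //; rewrite lexx ler01.
have hA : has_sup A by split; [exists 0|exists 1 => s [/andP[]]].
pose b := sup A.
have b0 : 0 <= b by apply: sup_upper_bound.
have b1 : b <= 1 by apply: ge_sup; [exists 0|move=> s [/andP[]]].
have [|h h0 hh] := loc b; first by rewrite b0.
have [a [/andP[a0 a1] Qa] ab] := sup_adherent h0 hA.
have ab' : a <= b by apply: sup_upper_bound => //; split => //; rewrite a0.
pose s2 := Num.min 1 (b + h / 2).
have bs2 : b <= s2 by rewrite le_min b1 lerDl divr_ge0// ltW.
have s21 : s2 <= 1 by rewrite ge_min lexx.
have s2h : s2 <= b + h / 2 by rewrite ge_min lexx orbT.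
have Qs2 : Q s2.
  apply: (hh a s2) => //; first exact: le_trans bs2.
    by rewrite ler0_norm ?subr_le0//; move: ab; rewrite -/b; lra.
  by rewrite ger0_norm ?subr_ge0//; lra.
have s2b : s2 <= b.
  by apply: sup_upper_bound => //; split => //; rewrite (le_trans b0).
suff -> : 1 = s2 :> R by [].
apply/eqP; rewrite eq_le s21 andbT /s2 le_min lexx /= .
have : b + h / 2 <= b \/ 1 <= b.
  have [h1|h1] := leP 1 (b + h / 2).
    by right; apply: le_trans s2b; rewrite le_min lexx.
  by left; apply: le_trans s2b; rewrite le_min lexx andbT ltW.
by case; lra.
Qed.

Lemma nbhs_forall (T : topologicalType) (I : finType) (x : T) (P : I -> set T) :
  (forall i, nbhs x (P i)) -> nbhs x [set y | forall i, P i y].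
Proof. exact: filter_forall. Qed.

Lemma finite_lower_bound (R : realType) (m : nat) (f : 'I_m -> R) :
  (forall j, 0 < f j) -> exists2 d, 0 < d & forall j, d <= f j.
Proof.
move=> f0; pose s := 1 + \sum_j (f j)^-1.
have s0 : 0 < s by rewrite ltr_wpDr// sumr_ge0// => j _; rewrite invr_ge0 ltW.
exists s^-1; first by rewrite invr_gt0.
move=> j; rewrite -[f j]invrK lef_pV2 ?posrE ?invr_gt0//.
rewrite /s (bigD1 j)//= addrCA lerDl addr_ge0// sumr_ge0// => l _.
by rewrite invr_ge0 ltW.
Qed.

Lemma counting_le (T : choiceType) (R : realType) (A : set T) (I : finType) (f : T -> I) :
  {in A &, injective f} -> (counting A <= #|I|%:R%:E :> \bar R)%E.
Proof.
move=> fi; pose h x : nat := enum_rank (f x).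
have hi : {in A &, injective h}.
  by move=> x y xA yA /val_inj /enum_rank_inj; exact: fi.
have AI : (A #<= `I_#|I|)%card.
  rewrite -(card_le_eql (inj_card_eq hi)); apply: subset_card_le.
  by move=> _ [x Ax <-]; rewrite /h /=; exact: ltn_ord.
have fA : finite_set A by apply/finite_set_leP; exists #|I|.
by rewrite /counting asboolT// lee_fin ler_nat; exact: geq_card_fset_set.
Qed.

Lemma counting_mono (T : choiceType) (R : realType) (A B : set T) :
  A `<=` B -> (counting A <= counting B :> \bar R)%E.
Proof.
move=> AB; rewrite /counting; have [fB|nB] := pselect (finite_set B); last first.
  by rewrite (asboolF nB) leey.
have fA := sub_finite_set AB fB.
rewrite !asboolT// lee_fin ler_nat.
apply: finmap.fsubset_leq_card; apply/finmap.fsubsetP => x.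
by rewrite !in_fset_set// !inE; exact: AB.
Qed.

(** * Coding paths by words of boxes *)

Section Counting.
Variables (R : realType) (S : topologicalType) (M : riemannSurface R S).
Variables (X : topologicalType) (p : X -> S).
Hypothesis S_hausdorff : hausdorff_space S.
Hypothesis p_continuous : continuous p.
Variable g : chart_index M -> cplx R -> R.
Arguments g : clear implicits.
Hypothesis g_gt0 : forall i z, cod i z -> 0 < g i z.
Hypothesis g_continuous : forall i z, cod i z -> {for z, continuous (g i)}.
Hypothesis g_transition : forall i j z, overlap i j z ->
  g i z = g j (transition i j z) * cmod (derive1 (transition i j) z) ^+ 2.

Variables (m : nat) (ci : 'I_m -> chart_index M) (z : 'I_m -> cplx R).
Variables (e k : 'I_m -> R) (sheets : 'I_m -> set (set X)).
Hypothesis GC : good_cover p g ci z e k sheets.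

Variables (j0 : 'I_m) (A0 : set X).
Hypothesis hA0 : sheets j0 A0.

(** The head of the word is the most recent box, and the empty word stands for the starting sheet.
    Consecutive sheets need only meet. *)
Fixpoint run (w : seq 'I_m) (j : 'I_m) (A : set X) : Prop :=
  if w is j' :: w' then
    [/\ j = j', sheets j A & exists i B x, [/\ run w' i B, B x & A x]]
  else j = j0 /\ A = A0.

Lemma run_sheet w j A : run w j A -> sheets j A.
Proof. by case: w => [[-> ->]|j' w []]. Qed.

Lemma run_unique w j j' A A' : run w j A -> run w j' A' -> j = j' /\ A = A'.
Proof.
elim: w j j' A A' => [|l w IH] j j' A A'; first by move=> [-> ->] [-> ->].
move=> [-> sA [i [B [x [rB Bx Ax]]]]] [-> sA' [i' [B' [x' [rB' Bx' Ax']]]]].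
have [ii BB] := IH _ _ _ _ rB rB'; subst i' B'; split => //.
exact: (gc_unique GC (run_sheet rB) sA sA' Bx Ax Bx' Ax').
Qed.

(** Brings all words to one common length, so that they can be counted as tuples. *)
Lemma run_pad n w j A x : run w j A -> A x -> run (nseq n j ++ w) j A.
Proof.
move=> r Ax; elim: n => [//|n IH] /=; split => //; first exact: run_sheet r.
by exists j, A, x.
Qed.

Variable d : R.
Hypothesis d0 : 0 < d.
Hypothesis d_small : forall j, d <= k j * e j / 2.

(** Length [u] spent since the last change of box moves each coordinate by at most u / k. With u <=
    d <= k e / 2 the bound is at most 3 e / 2, still short of 2 e. *)
Definition near_center j (y : X) (u : R) : Prop :=
  `|re (chart (ci j) (p y)) - re (z j)| <= e j + u / k j /\
  `|im (chart (ci j) (p y)) - im (z j)| <= e j + u / k j.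

(* [y] is reached by a path of length at most [L], which has been re-centred at most
   [L / d] times and has had length [u <= d] since the last time. *)
Definition reached (y : X) (L : R) : Prop :=
  exists w j A u, [/\ run w j A, A y, near_center j y u, 0 <= u <= d &
    (size w)%:R * d + u <= L].

(** If the length spent stays within [d], the word is kept. Otherwise a box of half-width [e] around
    the end point is appended and the length reset to 0; the new letter is paid for by the more than
    [d] just spent. *)
Lemma reached_step (c : R -> X) (s1 s2 L : R) j (T : set X) : C1_curve M p c ->
  0 <= s1 -> s1 <= s2 -> s2 <= 1 -> sheets j T ->
  (forall s, s1 <= s <= s2 -> T (c s)) ->
  forall w u, run w j T -> near_center j (c s1) u -> 0 <= u <= d ->
  (size w)%:R * d + u <= L ->
  reached (c s2) (L + (arc_length p g c s2 - arc_length p g c s1)).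
Proof.
move=> hc h1 h12 h2 sT hT w u rw [n1 n2] /andP[u0 ud] hL.
have kj := gc_k GC j.
have [|l1 l2] := curve_chart_lipschitz p_continuous g_gt0 g_continuous g_transition
    (i := ci j) hc kj h1 h12 h2.
  move=> s /hT Ts; have [ds bs] := gc_sub GC sT Ts; split => //.
  exact: (gc_g GC bs).
have := arc_length_mono p_continuous g_continuous g_transition hc h1 h12 h2.
rewrite -subr_ge0; set du := arc_length p g c s2 - arc_length p g c s1 in l1 l2 *; move=> du0.
have tri (x y a : R) : `|x - y| <= du / k j -> `|y - a| <= e j + u / k j ->
    `|x - a| <= e j + (u + du) / k j.
  move=> hx hy; rewrite -(subrKA y); apply: le_trans (ler_normD _ _) _.
  rewrite mulrDl; lra.
have T2 : T (c s2) by apply: hT; rewrite h12 lexx.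
have [ud'|ud'] := leP (u + du) d.
  exists w, j, T, (u + du); split => //.
  - by split; [exact: tri l1 n1|exact: tri l2 n2].
  - by rewrite ud' addr_ge0.
  - by rewrite addrA lerD2r.
have [j' [dj' bj']] := gc_cover GC (p (c s2)).
have ej' := gc_e GC j'.
have [|A' sA' A'2] := gc_ex GC (j := j') (y := c s2).
  by split => //; apply: box_sub bj'; lra.
exists (j' :: w), j', A', 0; split => //.
- by split => //; exists j, T, (c s2).
- by rewrite /near_center mul0r addr0; case: bj' => /ltW ? /ltW ?.
- by rewrite lexx ltW.
- rewrite /= -natr1 mulrDl mul1r; lra.
Qed.

Lemma reached_curve (c : R -> X) (L : R) : C1_curve M p c ->
  reached (c 0) L -> reached (c 1) (L + arc_length p g c 1).
Proof.
move=> hc h0; pose Q s := reached (c s) (L + arc_length p g c s).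
apply: (@real_induction _ Q); last by rewrite /Q arc_length0 addr0.
move=> s sI; have sI' : s \in `[0, 1] by rewrite in_itv.
have [cs _] := hc s sI'.
have cpc : {for s, continuous (fun r => p (c r))}.
  by apply: (continuous_comp cs); exact: p_continuous.
pose V j := chart_box (ci j) (z j) (2 * e j).
(* A closed set between the points allowed by [near_center] and the open doubled box. If c(s) is not
   over the box V j, then nearby points are not over D j; so a box in use near [s] contains p(c(s)),
   and its sheet is the one through c(s), which contains the nearby arc. *)
pose D j := param (ci j) @` cbox (z j) (3 / 2 * e j).
have DV j x : D j x -> V j x.
  have ej := gc_e GC j.
  move=> [w hw <-]; have bw : box (z j) (2 * e j) w.
    by apply: cbox_sub_box hw; rewrite ltr_pM2r//; lra.
  by have [dw E] := cod_param (gc_cod GC bw); split => //; rewrite E.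
have cD j : closed (D j).
  apply: param_cbox_closed => // w hw; apply: (gc_cod GC (j := j)).
  by apply: cbox_sub_box hw; have ej := gc_e GC j; rewrite ltr_pM2r//; lra.
have nearQ : \forall r \near s, forall j,
    (V j (p (c s)) -> exists T, [/\ sheets j T, T (c s) & T (c r)]) /\
    (~ V j (p (c s)) -> ~ D j (p (c r))).
  apply: nbhs_forall => j; have [Vs|Vs] := pselect (V j (p (c s))).
    have [T sT Ts] := gc_ex GC Vs.
    have : nbhs s (c @^-1` T).
      by apply: cs; apply: open_nbhs_nbhs; split => //; exact: (gc_open GC sT).
    by apply: nbhsS => r Tr; split => // _; exists T.
  have : nbhs s [set r | ~ D j (p (c r))].
    apply: (cpc (~` D j)); apply: open_nbhs_nbhs; split; first exact: closed_openC (cD j).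
    by move=> /DV.
  by apply: nbhsS => r Dr; split.
move: nearQ => /nbhs_ballP[h /= h_gt0 hh].
exists h => // s1 s2 h1 h12 h2 b1 b2 [w [j [A [u [rw A1 nc ud hL]]]]].
have D1 : D j (p (c s1)).
  have [dc bc] := gc_sub GC (run_sheet rw) A1.
  exists (chart (ci j) (p (c s1))); last by rewrite chartK.
  have kj := gc_k GC j; have : u / k j <= e j / 2.
    rewrite ler_pdivrMr//; case/andP: ud => _ ud; have := d_small j; lra.
  by case: nc => n1 n2 hu; split; lra.
have bsub r : s1 <= r <= s2 -> ball s h r.
  move=> /andP[r1 r2]; rewrite -ball_normE /= distrC.
  by move: b1 b2; rewrite !ltr_norml => /andP[? ?] /andP[? ?]; apply/andP; split; lra.
have s11 : s1 <= s1 <= s2 by rewrite lexx.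
have Vs : V j (p (c s)).
  by apply: contrapT => nV; have [_ /(_ nV)] := hh _ (bsub _ s11) j; apply.
have [/(_ Vs)[T [sT Ts T1]] _] := hh _ (bsub _ s11) j.
have AT : A = T := gc_disj GC (run_sheet rw) sT A1 T1.
subst T.
rewrite /Q; have -> : L + arc_length p g c s2 =
    L + arc_length p g c s1 + (arc_length p g c s2 - arc_length p g c s1) by ring.
apply: (reached_step hc h1 h12 h2 sT _ rw nc ud hL).
move=> r hr; have [/(_ Vs)[T' [sT' T's T'r]] _] := hh _ (bsub _ hr) j.
by rewrite (gc_disj GC sT sT' Ts T's).
Qed.

Lemma reached_chain (n : nat) (c : nat -> R -> X) (x0 : X) :
  reached x0 0 -> (forall l, (l <= n)%N -> C1_curve M p (c l)) -> c 0%N 0 = x0 ->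
  (forall l, (l < n)%N -> c l 1 = c l.+1 0) ->
  reached (c n 1) (\sum_(0 <= l < n.+1) arc_length p g (c l) 1).
Proof.
move=> h0 hc c0; elim: n hc => [|n IH] hc hj.
  rewrite big_nat1 -[X in reached _ X]add0r; apply: reached_curve; first exact: hc.
  by rewrite c0.
rewrite big_nat_recr//=; apply: reached_curve; first exact: hc.
rewrite -hj//; apply: IH => l ln; first by apply: hc; exact: leqW.
by apply: hj; exact: ltnW.
Qed.

Lemma reached_of_dist (x0 y : X) (r : R) : reached x0 0 ->
  (riem_dist p g x0 y < r%:E)%E -> exists2 L, L < r & reached y L.
Proof.
move=> h0 /ereal_inf_lt[_ [n [c [hc [c0 cn] hj ->]]] hr].
exists (\sum_(0 <= l < n.+1) arc_length p g (c l) 1).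
  move: hr; rewrite (eq_big_nat _ _ (F2 := fun l => (arc_length p g (c l) 1)%:E)).
    by rewrite sumEFin lte_fin.
  by move=> l /andP[_ ln]; rewrite arc_length1//; exact: hc.
by rewrite -cn; exact: (reached_chain h0 hc c0 hj).
Qed.

Lemma reached_word (y : X) (L r : R) : L < r -> reached y L ->
  exists w : (Num.truncn (r / d)).-tuple 'I_m, exists j A, run w j A /\ A y.
Proof.
move=> Lr [w [j [A [u [rw Ay _ /andP[u0 _] hL]]]]].
have sz : (size w <= Num.truncn (r / d))%N.
  rewrite -ltnS -(@ltr_nat R); apply: le_lt_trans (truncnS_gt _).
  rewrite ler_pdivlMr//; lra.
have := run_pad (Num.truncn (r / d) - size w) rw Ay.
set w' := _ ++ _ => rw'.
have sw : size w' == Num.truncn (r / d) by rewrite size_cat size_nseq subnK.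
by exists (Tuple sw), j, A.
Qed.

(** A word determines its last sheet, and a sheet contains at most one point of the fibre; so the
    points counted inject into words of length floor(r / d) in [m] letters. *)
Lemma fiber_count (x0 : X) (r : R) : reached x0 0 ->
  (counting ([set y | p y = p x0] `&` [set y | (riem_dist p g x0 y < r%:E)%E])
    <= (m ^ Num.truncn (r / d))%N%:R%:E :> \bar R)%E.
Proof.
move=> h0; set Y := _ `&` _; pose N := Num.truncn (r / d).
have H y : exists w : N.-tuple 'I_m, Y y -> exists j A, run w j A /\ A y.
  have [Yy|nY] := pselect (Y y); last by exists [tuple of nseq N j0].
  have [_ hr] := Yy; have [L Lr hL] := reached_of_dist h0 hr.
  by have [w hw] := reached_word Lr hL; exists w.
have [f hf] := choice H.
have fi : {in Y &, injective f}.
  move=> x y; rewrite !inE => Yx Yy E.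
  have [j [A [rA Ax]]] := hf x Yx; have [j' [A' [rA' Ay]]] := hf y Yy.
  rewrite E in rA; have [jj AA] := run_unique rA rA'; subst j' A'.
  by apply: (gc_inj GC (run_sheet rA) Ax Ay); rewrite Yx.1 Yy.1.
by have := counting_le R fi; rewrite card_tuple card_ord.
Qed.

End Counting.

Section OrbitGrowth.
Variables (R : realType) (S : topologicalType) (M : riemannSurface R S).
Variables (X : topologicalType) (p : X -> S).
Hypothesis S_hausdorff : hausdorff_space S.
Hypothesis S_compact : compact [set: S].
Hypothesis p_covering : covering_map p.
Variable g : chart_index M -> cplx R -> R.
Arguments g : clear implicits.
Hypothesis g_gt0 : forall i z, cod i z -> 0 < g i z.
Hypothesis g_continuous : forall i z, cod i z -> {for z, continuous (g i)}.
Hypothesis g_transition : forall i j z, overlap i j z ->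
  g i z = g j (transition i j z) * cmod (derive1 (transition i j) z) ^+ 2.

(** Deck transformations preserve [p], so the orbit lies in a single fibre and [fiber_count]
    applies. Here [m] is the number of boxes and [d] a common lower bound for the numbers k e /
    2. *)
Lemma orbit_count_exponential (x0 : X) : exists m d, [/\ (0 < m)%N, 0 < d &
  forall r : R, (orbit_count p g x0 r <= (m ^ Num.truncn (r / d))%N%:R%:E)%E].
Proof.
have [p_cont _] := p_covering.
have [m [ci [z [e [k [sheets GC]]]]]] :=
  good_cover_exists S_hausdorff S_compact p_covering g_gt0 g_continuous.
have [|d d0 hd] := @finite_lower_bound R m (fun j => k j * e j / 2).
  by move=> j; rewrite divr_gt0// mulr_gt0// ?(gc_k GC) ?(gc_e GC).
have [j0 [dj0 bj0]] := gc_cover GC (p x0).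
have ej := gc_e GC j0.
have [|A0 sA0 A0x] := gc_ex GC (j := j0) (y := x0).
  by split => //; apply: box_sub bj0; lra.
exists m, d; split => //; first by apply: leq_ltn_trans (ltn_ord j0).
move=> r; have h0 : reached p ci z e k sheets j0 A0 d x0 0.
  exists [::], j0, A0, 0; split => //.
  - by rewrite /near_center mul0r addr0; case: bj0 => /ltW ? /ltW ?.
  - by rewrite lexx ltW.
  - by rewrite mul0r addr0.
have := fiber_count S_hausdorff p_cont g_gt0 g_continuous g_transition GC sA0 d0 hd r h0.
apply: le_trans; apply: counting_mono => y [[f [f' [_ _ hp <-]]] hy].
by split => //=; rewrite hp.
Qed.

End OrbitGrowth.

(** * Volume entropy *)

Section LimfEsup.
Variable R : realType.
Implicit Types f h : R -> \bar R.

Lemma limf_esup_le_near f h :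
  (\forall r \near +oo, (f r <= h r)%E) ->
  (limf_esup f (pinfty_nbhs R) <= limf_esup h (pinfty_nbhs R))%E.
Proof.
move=> fh; rewrite !limf_esupE; apply: le_ereal_inf_tmp => _ [V FV <-].
apply: (@le_trans _ _ (ereal_sup (f @` (V `&` [set r | (f r <= h r)%E])))).
  by apply: ereal_inf_lbound; exists (V `&` [set r | (f r <= h r)%E]) => //; exact: filterI.
apply: ge_ereal_sup => _ [r [Vr hr] <-]; apply: le_trans hr _.
by apply: ereal_sup_ubound; exists r.
Qed.

Lemma limf_esup_le_cst f (c : \bar R) :
  (\forall r \near +oo, (f r <= c)%E) -> (limf_esup f (pinfty_nbhs R) <= c)%E.
Proof.
move=> fc; rewrite limf_esupE.
apply: (@le_trans _ _ (ereal_sup (f @` [set r | (f r <= c)%E]))).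
  by apply: ereal_inf_lbound; exists [set r | (f r <= c)%E].
by apply: ge_ereal_sup => _ [r hr <-].
Qed.

Lemma limf_esup_ge0_near f :
  (\forall r \near +oo, (0 <= f r)%E) -> (0 <= limf_esup f (pinfty_nbhs R))%E.
Proof.
move=> f0; rewrite limf_esupE; apply: le_ereal_inf_tmp => _ [V FV <-].
have [r [Vr fr]] := filter_ex (filterI FV f0).
by apply: le_trans fr _; apply: ereal_sup_ubound; exists r.
Qed.

Lemma lne_le (x y : \bar R) : (0 <= x)%E -> (x <= y)%E -> (lne x <= lne y)%E.
Proof.
by move=> x0 xy; rewrite lee_lne// in_itv /= ?x0 ?leey ?(le_trans x0 xy).
Qed.

End LimfEsup.

Section Metrics.
Variables (R : realType) (S : topologicalType) (M : riemannSurface R S).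
Variables (X : topologicalType) (p : X -> S).

Record continuous_metric (g : chart_index M -> cplx R -> R) : Prop := ContinuousMetric {
  cm_gt0 : forall i z, cod i z -> 0 < g i z;
  cm_continuous : forall i z, cod i z -> {for z, continuous (g i)};
  cm_transition : forall i j z, overlap i j z ->
    g i z = g j (transition i j z) * cmod (derive1 (transition i j) z) ^+ 2
}.

Lemma induced_metric_continuous (sigma : conformalMetric M) (f1 f2 : S -> R) :
  smooth_function M f1 -> smooth_function M f2 ->
  continuous_metric (induced_metric sigma f1 f2).
Proof.
move=> s1 s2; split.
- by move=> i z iz; rewrite /induced_metric !mulr_gt0 ?expR_gt0// density_gt0.
- move=> i z iz; have oU := @cod_open _ _ M i.
  have c : Cn 0 (cod i) (fun w => 4 * expR (f1 (param i w) - f2 (param i w)) * sigma i w).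
    apply: CnM => //; last exact: density_Cn.
    apply: CnM => //; first exact: Cn_cst.
    by apply: Cn_expR => //; exact: (smooth_Cn i 0 (smooth_functionB s1 s2)).
  exact: (Cn_continuous c iz).
- move=> i j z o; rewrite /induced_metric (density_transition sigma o).
  have -> : param j (transition i j z) = param i z.
    by case: o => x [ix jx] <-; rewrite /transition !chartK.
  by rewrite mulrA.
Qed.

Hypothesis p_continuous : continuous p.

Section Compare.
Variables g g' : chart_index M -> cplx R -> R.
Hypothesis hg : continuous_metric g.
Hypothesis hg' : continuous_metric g'.
Variable l : R.
Hypothesis l0 : 0 < l.
Hypothesis gg' : forall i z, cod i z -> l ^+ 2 * g i z <= g' i z.

Lemma speed_compare (c : R -> X) s : l * speed p g c s <= speed p g' c s.
Proof.
rewrite /speed; set i := chart_at M _; set w := chart i _.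
rewrite -[X in X * _](@ger0_norm _ l) ?(ltW l0)// -sqrtr_sqr -sqrtrM ?sqr_ge0//.
rewrite ler_wsqrtr// mulrA ler_wpM2r ?addr_ge0 ?sqr_ge0//.
by apply: gg'; apply: cod_chart; exact: dom_chart_at.
Qed.

Lemma curve_length_compare (c : R -> X) : C1_curve M p c ->
  (curve_length p g c <= (l^-1)%:E * curve_length p g' c)%E.
Proof.
move=> hc.
have i1 := speed_integrable p_continuous (cm_continuous hg) (cm_transition hg) hc.
have i2 := speed_integrable p_continuous (cm_continuous hg') (cm_transition hg') hc.
have mI : measurable (`[0, 1]%classic : set (measurableTypeR R)) by exact: measurable_itv.
have i3 := integrableZl mI l^-1 i2.
rewrite /curve_length -integralZl//.
apply: le_integral => // s _; rewrite /= -EFinM lee_fin.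
by rewrite mulrC ler_pdivlMr// mulrC speed_compare.
Qed.

Lemma riem_dist_compare (x y : X) (r : R) :
  (riem_dist p g' x y < r%:E)%E -> (riem_dist p g x y < (r / l)%:E)%E.
Proof.
move=> /ereal_inf_lt[_ [n [c [hc ce hj ->]]] hr].
apply: (@le_lt_trans _ _ (\sum_(0 <= k < n.+1) curve_length p g (c k))%E).
  by apply: ereal_inf_lbound; exists n, c; split.
apply: (@le_lt_trans _ _ ((l^-1)%:E * \sum_(0 <= k < n.+1) curve_length p g' (c k))%E).
  rewrite ge0_sume_distrr; last first.
    by move=> k _; apply: integral_ge0 => s _; rewrite lee_fin; exact: speed_ge0.
  rewrite big_nat [leRHS]big_nat; apply: lee_sum => k /andP[_ kn].
  by apply: curve_length_compare; exact: hc.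
by rewrite mulrC EFinM lte_pmul2l// lte_fin invr_gt0.
Qed.

Lemma orbit_count_compare (x0 : X) (r : R) :
  (orbit_count p g' x0 r <= orbit_count p g x0 (r / l))%E.
Proof. by apply: counting_mono => y [oy /riem_dist_compare]. Qed.

End Compare.

Lemma riem_dist_refl (g : chart_index M -> cplx R -> R) (x : X) : (riem_dist p g x x <= 0)%E.
Proof.
have C i : coord_re p i (fun=> x) = cst (complex.Re (chart i (p x))) by [].
have C' i : coord_im p i (fun=> x) = cst (complex.Im (chart i (p x))) by [].
have D (a : R) : derive1 (cst a : R -> R) = cst 0 by apply/funext => s; rewrite derive1_cst.
have L0 : curve_length p g (fun=> x) = 0%E.
  rewrite /curve_length; apply: integral0_eq => s _.
  by rewrite /speed C C' !D /= expr0n /= addr0 mulr0 sqrtr0.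
apply: ereal_inf_lbound; exists 0%N, (fun _ _ => x); split => //.
- move=> k _ s _; split; first exact: cst_continuous.
  move=> i _; rewrite C C' !D; split;
    try (by apply: nbhs_all => r; exact: derivable_cst); exact: cst_continuous.
- by rewrite big_nat1 L0.
Qed.

(** The base point is counted, through the identity and the constant path; this keeps the logarithm
    of the count nonnegative. *)
Lemma orbit_count_ge1 (g : chart_index M -> cplx R -> R) (x0 : X) (r : R) : 0 < r ->
  (1 <= orbit_count p g x0 r)%E.
Proof.
move=> r0; have -> : 1%E = counting [set x0] :> \bar R.
  by rewrite /counting asboolT// fset_set1 finmap.cardfs1.
apply: counting_mono => _ ->; split.
  exists id, id; split => //; split => ?; exact: cvg_id.
by apply: le_lt_trans (riem_dist_refl g x0) _; rewrite lte_fin.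
Qed.

Lemma near_pinfty_gt0 : \forall r \near +oo, 0 < r :> R.
Proof. exact: nbhs_pinfty_gt. Qed.

Lemma volume_entropy_ge0 (g : chart_index M -> cplx R -> R) (x0 : X) :
  (0 <= volume_entropy p g x0)%E.
Proof.
apply: limf_esup_ge0_near; have := near_pinfty_gt0; apply: filterS => r r0.
rewrite mule_ge0 ?lee_fin ?invr_ge0 ?(ltW r0)//.
by rewrite lne_ge0; exact: orbit_count_ge1.
Qed.

Lemma volume_entropy_mono g g' (x0 : X) : continuous_metric g -> continuous_metric g' ->
  (forall i z, cod i z -> g i z <= g' i z) ->
  (volume_entropy p g' x0 <= volume_entropy p g x0)%E.
Proof.
move=> hg hg' gg'; apply: limf_esup_le_near; have := near_pinfty_gt0; apply: filterS => r r0.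
have h1 : (orbit_count p g' x0 r <= orbit_count p g x0 r)%E.
  have := @orbit_count_compare g g' hg hg' 1 ltr01 _ x0 r; rewrite divr1; apply.
  by move=> i z iz; rewrite expr1n mul1r; exact: gg'.
apply: lee_wpmul2r; first by rewrite lee_fin invr_ge0 ltW.
exact: lne_le (le_trans lee01 (orbit_count_ge1 g' x0 r0)) h1.
Qed.

(** Lengths for g' are at least [l] times those for [g], so a ball of radius [r] lies in a [g]-ball
    of radius r / l, where the logarithm of the count is at most (r / (l d)) ln m. *)
Lemma volume_entropy_bound g g' (x0 : X) (l d : R) (m : nat) :
  continuous_metric g -> continuous_metric g' -> 0 < l -> 0 < d -> (0 < m)%N ->
  (forall i z, cod i z -> l ^+ 2 * g i z <= g' i z) ->
  (forall r : R, (orbit_count p g x0 r <= (m ^ Num.truncn (r / d))%N%:R%:E)%E) ->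
  (volume_entropy p g' x0 <= (ln m%:R / (d * l))%:E)%E.
Proof.
move=> hg hg' l0 d0 m0 gg' hm; apply: limf_esup_le_cst.
have := near_pinfty_gt0; apply: filterS => r r0.
have h1 := le_trans (orbit_count_compare hg hg' l0 gg' x0 r) (hm (r / l)).
have h2 : (lne (orbit_count p g' x0 r) <=
    ((Num.truncn (r / l / d))%:R * ln m%:R)%:E)%E.
  apply: (@le_trans _ _ (lne ((m ^ Num.truncn (r / l / d))%N%:R%:E))).
    exact: lne_le (le_trans lee01 (orbit_count_ge1 g' x0 r0)) h1.
  have mp : 0 < m%:R :> R by rewrite ltr0n.
  by rewrite natrX lne_EFin ?exprn_gt0// lnXn// mulr_natl.
apply: (@le_trans _ _ (((Num.truncn (r / l / d))%:R * ln m%:R)%:E * (r^-1)%:E)%E).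
  by apply: lee_wpmul2r => //; rewrite lee_fin invr_ge0 ltW.
rewrite -EFinM lee_fin.
have lm : 0 <= ln (m%:R : R) by rewrite ln_ge0// ler1n.
have tr : (Num.truncn (r / l / d))%:R <= r / l / d.
  by rewrite truncn_le !divr_ge0// ltW.
have -> : ln (m%:R : R) / (d * l) = r / l / d * ln m%:R * r^-1.
  by field; rewrite !gt_eqF.
by rewrite ler_wpM2r ?invr_ge0 ?(ltW r0)// ler_wpM2r.
Qed.

End Metrics.

Theorem theorem3 (R : realType) (S : topologicalType)
    (S_hausdorff : hausdorff_space S)
    (S_compact : compact [set: S])
    (S_connected : connected [set: S])
    (S_genus : genus_ge R 2 S)
    (M : riemannSurface R S)
    (sigma : conformalMetric M)
    (sigma_hyperbolic : hyperbolic_normalized sigma)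
    (q : quarticDifferential M)
    (q_nonzero : qd_nonzero q)
    (X : topologicalType) (p : X -> S)
    (p_universal : universal_cover R p)
    (p0 : X)
    (psi1 psi2 : R -> S -> R)
    (psi_solution : forall t : R, 0 <= t ->
      maximal_surface_system sigma (qd_scale t q) (psi1 t) (psi2 t)) :
  let Ent := fun t : R =>
    volume_entropy p (induced_metric sigma (psi1 t) (psi2 t)) p0 in
  (forall s t : R, 0 <= s -> s <= t -> (Ent t <= Ent s)%E) /\
  Ent t @[t --> +oo%R] --> 0%E.
Proof.
have [p_covering _ _] := p_universal; have [p_cont _] := p_covering.
move=> Ent; pose g t := induced_metric sigma (psi1 t) (psi2 t).
have hg t : 0 <= t -> continuous_metric (g t).
  by move=> /psi_solution[s1 s2 _]; exact: induced_metric_continuous.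
split=> [s t s0 st|].
  apply: (volume_entropy_mono p_cont p0 (hg _ s0) (hg _ (le_trans s0 st))) => i z iz.
  rewrite /g /induced_metric ler_pM2r ?density_gt0// ler_pM2l// ler_expR.
  exact: (psi_diff_mono S_compact psi_solution).
have g0 := hg 0 (lexx 0).
have [m [d [m0 d0 hm]]] := orbit_count_exponential S_hausdorff S_compact p_covering
  (cm_gt0 g0) (cm_continuous g0) (cm_transition g0) p0.
have Ent0 t : (0 <= Ent t)%E by exact: volume_entropy_ge0.
have lm : 0 <= ln (m%:R : R) by rewrite ln_ge0// ler1n.
have small (e : R) : 0 < e -> \forall t \near +oo, (Ent t <= e%:E)%E.
  (* Chosen so that ln m / (d l) <= e; the added 1 keeps [l] positive when m = 1. The threshold 2 ln
     l for the growth below amounts to g_t >= l^2 g_0. *)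
  move=> e0; pose l := ln m%:R / d / e + 1.
  have l0 : 0 < l by rewrite ltr_wpDl// !divr_ge0// ltW.
  have H := growth_unbounded_unif S_compact psi_solution S_connected q_nonzero (2 * ln l).
  apply: (filterS2 _ _ H (near_pinfty_gt0 R)) => t ht t0.
  have gt0 := hg t (ltW t0).
  apply: le_trans (volume_entropy_bound p_cont g0 gt0 l0 d0 m0 _ hm) _.
    move=> i z iz; rewrite /g /induced_metric.
    have := ht (param i z); rewrite /growth => h.
    have -> : l ^+ 2 = expR (2 * ln l) by rewrite mulrC expRM_natr lnK.
    rewrite mulrA ler_pM2r ?density_gt0// mulrCA ler_pM2l// -expRD ler_expR; lra.
  rewrite lee_fin ler_pdivrMr ?mulr_gt0// /l.
  have -> : e * (d * (ln m%:R / d / e + 1)) = ln m%:R + e * d.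
    by field; rewrite !gt_eqF.
  by rewrite lerDl ltW// mulr_gt0.
(* Entropies are extended reals; being eventually finite, they converge as soon as their real parts
   do. *)
have fin : \forall t \near +oo, Ent t \is a fin_num.
  have := small 1 ltr01; apply: filterS => t h.
  by rewrite ge0_fin_numE//; apply: le_lt_trans h _; exact: ltry.
apply/fine_cvgP; split => //.
apply/cvgrPdist_le => e e0; apply: (filterS2 _ _ fin (small e e0)) => t ft he; rewrite sub0r normrN /=.
by rewrite ger0_norm ?fine_ge0// -lee_fin fineK.
Qed.
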